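(* As $n\to\infty$, uniformly for $m\ge1$, $$G_{n,m}=\frac{\rho\,e^{n\rho}\,G_m(e^{-\rho})}{\sqrt{2\pi\Lambda_2(\rho)}}\Bigl(1+O\bigl(\Lambda_2(\rho)^{-1}\bigr)\Bigr),$$ where $\rho=\rho(n,m)>0$ solves the equation $$n\rho-\Lambda_1(\rho)=0,\qquad\text{or, equivalently,}\qquad n=-\partial_\tau\log G_m(e^{-\tau})\big|_{\tau=\rho}.$$
   Context: $G_{n,m}$ is the number of banded plane partitions of size $n$ and width $m$: functions $f:\mathbb{T}_m\to\mathbb{N}$ of finite support on $\mathbb{T}_m=\{(i,j)\in\mathbb{N}^2: j\le i\le j+m-1\}$ with entry sum $n$, such that $f(i,j)\ge f(i,j+1)$ and $f(i,j)\ge f(i+1,j)$ whenever the points involved lie in $\mathbb{T}_m$. By a known theorem of Han and Xiong, $$\sum_{n\ge0}G_{n,m}z^n=G_m(z)=\prod_{k\ge1}\frac1{1-z^k}\cdot\prod_{k\ge0}\ \prod_{1\le h<j<m}\frac1{1-z^{2mk+h+j}}\qquad(|z|<1).$$ (For $m\in\{1,2\}$ the second product is empty, equal to $1$, and $G_{n,m}$ denotes the coefficient of $z^n$ in this product.) Let $\Lambda(z):=\log G_m(z)$ (the branch with $\Lambda(0)=0$) and $$\Lambda_1(\rho):=\rho e^{-\rho}\Lambda'(e^{-\rho}),\qquad \Lambda_2(\rho):=\rho^2\bigl(e^{-\rho}\Lambda'(e^{-\rho})+e^{-2\rho}\Lambda''(e^{-\rho})\bigr),$$ where primes denote derivatives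 of $\Lambda$ with respect to $z$. *)

(* Defs.v *)
From HB Require Import structures.
From mathcomp Require Import all_boot all_order all_algebra finmap.
From mathcomp Require Import all_classical all_reals all_analysis.

Set Implicit Arguments.
Unset Strict Implicit.
Unset Printing Implicit Defensive.

Import Order.TTheory GRing.Theory Num.Theory.
Import numFieldNormedType.Exports.

Local Open Scope classical_set_scope.
Local Open Scope ring_scope.

(* For m >= 1 the condition i <= j + m - 1 is i < j + m. *)
Definition in_band (m : nat) (p : nat * nat) : bool :=
  (p.2 <= p.1 < p.2 + m)%N.

Definition band (m : nat) := {p : nat * nat | in_band m p}.

(* The two monotonicity conditions f(i,j) >= f(i,j+1) and f(i,j) >= f(i+1,j)
   are imposed only when both points belong to the band. *)
Definition banded_plane_partition (m n : nat) :
    set {fsfun band m -> nat with 0%N} :=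
  [set f : {fsfun band m -> nat with 0%N} |
    [/\ (forall p q : band m, val q = ((val p).1, (val p).2.+1) ->
           (f q <= f p)%N),
        (forall p q : band m, val q = ((val p).1.+1, (val p).2) ->
           (f q <= f p)%N)
      & (\sum_(p <- finsupp f) f p)%N = n] ].
Arguments banded_plane_partition : clear implicits.

Section GeneratingFunction.
Variable R : realType.
Implicit Types (m n : nat) (z rho : R).

Definition gen_fun m z : R :=
  limn (fun N => \prod_(1 <= k < N.+1) (1 - z ^+ k)^-1) *
  limn (fun N => \prod_(0 <= k < N) \prod_(1 <= j < m) \prod_(1 <= h < j)
                   (1 - z ^+ (2 * m * k + h + j))^-1).

(* For m = 1 there are infinitely many banded plane partitions of any size
   n >= 1, so for m <= 2 the number is the n-th Taylor coefficient at 0 of the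
   product (for m = 2 both descriptions agree).  For m > 2 the set of banded
   plane partitions of size n is finite and fset_set gives its elements. *)
Definition num_bpp m n : R :=
  if (m <= 2)%N then derive1n n (gen_fun m) 0 / n`!%:R
  else (#|` fset_set (banded_plane_partition m n)|)%:R.

(* On ]-1, 1[ every factor of the product is positive, so the branch of the
   complex logarithm vanishing at z = 0 is the real one there. *)
Definition Lambda m z : R := ln (gen_fun m z).

Definition Lambda1 m rho : R :=
  rho * expR (- rho) * derive1 (Lambda m) (expR (- rho)).

Definition Lambda2 m rho : R :=
  rho ^+ 2 * (expR (- rho) * derive1 (Lambda m) (expR (- rho)) +
              expR (- (2 * rho)) * derive1n 2 (Lambda m) (expR (- rho))).

Definition saddle_point_approx m n rho : R :=
  rho * expR (n%:R * rho) * gen_fun m (expR (- rho)) /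
  Num.sqrt (2 * pi * Lambda2 m rho).

End GeneratingFunction.

(* Main.v *)
Require Import Defs.
From mathcomp Require Import all_boot all_order all_algebra finmap.
From mathcomp Require Import all_classical all_reals all_analysis.
From mathcomp Require Import zify ring lra.

Set Implicit Arguments.
Unset Strict Implicit.
Unset Printing Implicit Defensive.

Import Order.TTheory GRing.Theory Num.Theory.
Import numFieldNormedType.Exports.

Local Open Scope classical_set_scope.
Local Open Scope ring_scope.

(** The number of banded plane partitions is a coefficient of an infinite
    product, and the saddle-point method estimates this coefficient; the work
    lies in proving the product formula and in making every estimate uniform
    in [m].

    Product formula.  The diagonals of a band array are [m] partitions, each
    interlacing the next one.  A toggle replaces one partition of such a chain
    by its reflection inside the intervals that its neighbours allow, which
    reverses the direction of the interlacing; the largest part has no upper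
    bound, and its excess is a free natural number that is split off.  With
    reflecting ends, a sweep of toggles through the chain restores its shape,
    and a suitable weight, linear in the sizes of the rows, decreases at each
    toggle by a fixed hook weight times the excess ([weight_tog]).  Each toggle
    thus contributes one factor [1 / (1 - z ^ h)].  The row weights grow from
    sweep to sweep; once they exceed [n], all rows of a chain of weight [n]
    are equal ([counts_const_chain]) and only ordinary partitions remain.
    The hook weights met on the way are the exponents of the product
    ([perm_exps]), whence [card_banded_plane_partition].

    Saddle point.  For a finite product of factors [1 / (1 - z ^ h)], the
    coefficient of [z ^ n] is an integral over the circle of radius
    [q = expR (- rho)].  The integrand is real after pairing conjugate points:
    it is an amplitude times the cosine of a phase, and a recursion on the list
    of exponents gives Fourier inversion without complex numbers ([circ_wave]).
    At the saddle point the linear part of the phase vanishes.  With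
    [t = theta / rho] and [L] the variance times [rho ^ 2], the amplitude is
    [expR (- L t ^ 2 / 2)] up to [O(L t ^ 4)] in the exponent, and the phase is
    [O(L |t| ^ 3)].  The phase enters through [1 - cos], hence squared, so that
    both errors integrate to a relative [O(1 / L)] ([wave_gauss],
    [saddle_truncated]).  Away from the saddle point the partition factor
    [1 / (1 - z ^ k)], [k >= 1], alone makes the amplitude at most
    [expR (- c / rho)] ([wave_tail]), and this is [O(1 / L)] because
    [L = O(rho ^- 3)].

    Uniformity.  All remainders are sums of
    [(h rho) ^ j q ^ h / (1 - q ^ h) ^ j] with [j <= 4], which are at most a
    constant times the sum of the [expR (- h rho / 2)].  Replacing [rho / 2] by
    [rho] costs a factor independent of [m] ([expsum_double]), and the sum of
    the [expR (- h rho)] is at most [L].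

    Passage to the limit.  The truncated products converge to the generating
    function, with their first two derivatives ([lim_mean_sum], [lim_var_sum]),
    because their coefficients become stationary and are dominated by those of
    the limit.  Monotonicity of the mean size gives existence and uniqueness of
    [rho]; a saddle point with [rho > 1] occurs only for bounded [n]
    ([boltzmann_mean_bounded]). *)

(** * Interlacing sequences and toggles *)

Definition finsup (a : nat -> nat) := exists L, forall i, (L <= i)%N -> a i = 0%N.

(** A bound of the support is chosen; by [psizeE] every bound gives the same sum. *)
Definition psize (a : nat -> nat) : nat :=
  (\sum_(i < xget 0%N [set L | forall i, (L <= i)%N -> a i = 0%N]%classic) a i)%N.

Lemma psizeE (a : nat -> nat) L :
  (forall i, (L <= i)%N -> a i = 0%N) -> psize a = (\sum_(i < L) a i)%N.
Proof.
move=> aL; rewrite /psize; set S := [set _ | _]%classic.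
have SL : S L by [].
have SX : S (xget 0%N S) by apply: xgetPex; exists L.
set X := xget _ _ in SX *.
have H (p q : nat) : S p -> (p <= q)%N ->
    (\sum_(i < q) a i = \sum_(i < p) a i)%N.
  move=> Sp /subnKC <-; elim: (q - p)%N => [|d IH]; first by rewrite addn0.
  by rewrite addnS big_ord_recr /= IH Sp ?leq_addr ?addn0.
by case: (leqP X L) => XL; [rewrite -(H X L) | rewrite (H L X) // ltnW].
Qed.

Definition interlace (a b : nat -> nat) :=
  forall i, (b i <= a i)%N /\ (a i.+1 <= b i)%N.

(** Part [i.+1] of [k] lies between [maxn (a i.+1) (b i.+1)] and
    [minn (a i) (b i)], and is reflected in that interval; part [0] is only
    bounded below, and its excess is [toggle_head]. *)
Definition toggle (a b k : nat -> nat) : nat -> nat :=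
  fun i => (maxn (a i.+1) (b i.+1) + minn (a i) (b i) - k i.+1)%N.

Definition toggle_head (a b k : nat -> nat) : nat :=
  (k 0 - maxn (a 0) (b 0))%N.

Definition untoggle (j : nat) (a b t : nat -> nat) : nat -> nat :=
  fun i => if i is i'.+1
    then (maxn (a i'.+1) (b i'.+1) + minn (a i') (b i') - t i')%N
    else (j + maxn (a 0%N) (b 0%N))%N.

Section Toggle.
Variables (a b : nat -> nat).

Lemma toggle_interlace k : interlace k a -> interlace k b ->
  interlace a (toggle a b k) /\ interlace b (toggle a b k).
Proof.
move=> ka kb; split=> i; rewrite /toggle; move: (ka i) (ka i.+1) (kb i) (kb i.+1); lia.
Qed.

Lemma untoggle_interlace j t : interlace a t -> interlace b t ->
  interlace (untoggle j a b t) a /\ interlace (untoggle j a b t) b.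
Proof.
move=> ta tb; split=> -[|i]; rewrite /untoggle.
- move: (ta 0%N) (tb 0%N); lia.
- move: (ta i) (tb i) (ta i.+1) (tb i.+1); lia.
- move: (ta 0%N) (tb 0%N); lia.
- move: (ta i) (tb i) (ta i.+1) (tb i.+1); lia.
Qed.

Lemma toggleK k : interlace k a -> interlace k b ->
  untoggle (toggle_head a b k) a b (toggle a b k) = k.
Proof.
move=> ka kb; apply/funext => -[|i]; rewrite /untoggle /toggle_head /toggle.
  by move: (ka 0%N) (kb 0%N); lia.
by move: (ka i) (ka i.+1) (kb i) (kb i.+1); lia.
Qed.

Lemma untoggleK j t : interlace a t -> interlace b t ->
  toggle a b (untoggle j a b t) = t /\ toggle_head a b (untoggle j a b t) = j.
Proof.
move=> ta tb; split; last by rewrite /toggle_head /=; lia.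
apply/funext => i; rewrite /untoggle /toggle.
by move: (ta i) (tb i) (ta i.+1) (tb i.+1); lia.
Qed.

Lemma toggle_finsup k : finsup a -> finsup b -> finsup (toggle a b k).
Proof.
move=> [L aL] [K bK]; exists (maxn L K) => i; rewrite geq_max => /andP[Li Ki].
by rewrite /toggle aL ?bK // ?(leqW Li) ?(leqW Ki) // aL // bK.
Qed.

Lemma untoggle_finsup j t : finsup a -> finsup b -> finsup (untoggle j a b t).
Proof.
move=> [L aL] [K bK]; exists (maxn L K).+1 => -[|i] //.
rewrite ltnS geq_max => /andP[Li Ki].
by rewrite /untoggle aL ?bK // ?(leqW Li) ?(leqW Ki) // aL // bK.
Qed.

(** Each part of the new row is the reflection of an old part inside the
    interval allowed by the two neighbours, and the ends of all these intervals
    are the parts of the neighbours; only the first part has no upper bound. *)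
Lemma psize_toggle k : finsup a -> finsup b -> interlace k a -> interlace k b ->
  (psize k + psize (toggle a b k) =
   toggle_head a b k + (psize a + psize b))%N.
Proof.
move=> [La aL] [Lb bL] ka kb; set L := maxn La Lb.
have zL i : (L <= i)%N -> a i = 0%N /\ b i = 0%N.
  by rewrite geq_max => /andP[/aL -> /bL ->].
rewrite (@psizeE a L) => [|i /zL[]//]; rewrite (@psizeE b L) => [|i /zL[]//].
rewrite (@psizeE k L.+1) => [|[|i]// /zL[a0 b0]]; last first.
  by move: (ka i) (kb i); lia.
rewrite (@psizeE _ L) => [|i Li]; last first.
  by rewrite /toggle; have [-> ->] := zL _ Li; have [] := zL i.+1 (leqW Li) => -> ->.
rewrite big_ord_recl.
under eq_bigr do rewrite lift0.
(* The ends of the intervals telescope; the last one vanishes for large [M]. *)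
have E (M : nat) : (\sum_(i < M) k i.+1 + \sum_(i < M) toggle a b k i
    + maxn (a 0) (b 0) =
    \sum_(i < M) a i + \sum_(i < M) b i + maxn (a M) (b M))%N.
  elim: M => [|M IH]; first by rewrite !big_ord0.
  rewrite !big_ord_recr /=.
  have H : (k M.+1 + toggle a b k M = maxn (a M.+1) (b M.+1) + minn (a M) (b M))%N.
    by rewrite /toggle; move: (ka M) (kb M) (ka M.+1) (kb M.+1); lia.
  rewrite addnACA [in LHS]addnAC H; move: IH.
  move: (\sum_(i < M) k i.+1)%N (\sum_(i < M) toggle a b k i)%N.
  move: (\sum_(i < M) a i)%N (\sum_(i < M) b i)%N => *; lia.
have := E L; have [-> ->] := zL _ (leqnn L); move: (ka 0%N) (kb 0%N).
rewrite maxnn addn0 /toggle_head /=.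
move: (\sum_(i < L) k i.+1)%N (\sum_(i < L) toggle a b k i)%N.
by move: (\sum_(i < L) a i)%N (\sum_(i < L) b i)%N => *; lia.
Qed.

End Toggle.

(** * Chains of rows and their weights *)

Definition upd (c : nat -> nat -> nat) (p : nat) (t : nat -> nat) :=
  fun d => if d == p then t else c d.

(** Both neighbours of an end row are the one adjacent row: the chain reflects
    at its ends. *)
Definition lft (p : nat) : nat := if p is q.+1 then q else 1%N.
Definition rgt (M p : nat) : nat := if p == M then M.-1 else p.+1.

(** Rows decrease along the chain, except that the step into row [p] is
    reversed; the toggle of row [p] moves the reversed step from [p] to
    [p.+1], and both [p = 0] and [p = M.+1] stand for a decreasing chain. *)
Definition chain (M p : nat) (c : nat -> nat -> nat) :=
  [/\ forall e, (e < M)%N -> if e.+1 == p then interlace (c e.+1) (c e)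
                             else interlace (c e) (c e.+1),
      forall d, finsup (c d)
    & forall d, (M < d)%N -> c d = fun=> 0%N].

(** At stage [p > 0] the step weights are [y 1, ..., y p.-1], then [y 0] for the
    reversed step, then [y p, ..., y M.-1]: the first weight travels with the
    reversed step, and a full sweep turns [y] into its shift.  The sign makes
    every term of [weight] nonnegative. *)
Definition step_weight (y : nat -> nat) (p e : nat) : int :=
  if (e.+1 < p)%N then (y e.+1)%:Z else
  if e.+1 == p then - (y 0%N)%:Z else (y e)%:Z.

Definition weight (S M : nat) (y : nat -> nat) (p : nat)
    (c : nat -> nat -> nat) : int :=
  S%:Z * (psize (c M))%:Z +
  \sum_(e < M) step_weight y p e * ((psize (c e))%:Z - (psize (c e.+1))%:Z).

Definition hook (S M : nat) (y : nat -> nat) (p : nat) : nat :=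
  if p == 0%N then y 0%N else
  if p == M then (S + y 0)%N else (y 0 + y p)%N.

Definition tog M p c := upd c p (toggle (c (lft p)) (c (rgt M p)) (c p)).
Definition untog M p j c := upd c p (untoggle j (c (lft p)) (c (rgt M p)) (c p)).
Definition tog_head M p (c : nat -> nat -> nat) :=
  toggle_head (c (lft p)) (c (rgt M p)) (c p).

Lemma lft_neq p : lft p <> p. Proof. by case: p => [|p] /=; lia. Qed.

Section Chain.
Variables (M : nat) (M1 : (0 < M)%N).
Implicit Types (c : nat -> nat -> nat) (p : nat).

Lemma rgt_neq p : rgt M p <> p. Proof. by rewrite /rgt; case: eqP => //=; lia. Qed.

Lemma updE c p t d : upd c p t d = if d == p then t else c d.
Proof. by []. Qed.

Lemma chain_nb p c : (p <= M)%N -> chain M p c ->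
  interlace (c p) (c (lft p)) /\ interlace (c p) (c (rgt M p)).
Proof.
move=> pM [H _ _]; split.
  case: p pM H => [|p] pM H /=; first by have := H 0%N M1.
  by have := H p pM; rewrite eqxx.
rewrite /rgt; case: eqVneq => [pE|pM'].
  by have := H M.-1; rewrite prednK // pE eqxx; apply.
have pM2 : (p < M)%N by rewrite ltn_neqAle pM' pM.
by have := H p pM2; case: eqP => //; lia.
Qed.

Lemma chainS_nb p c : (p <= M)%N -> chain M p.+1 c ->
  interlace (c (lft p)) (c p) /\ interlace (c (rgt M p)) (c p).
Proof.
move=> pM [H _ _]; split.
  case: p pM H => [|p] pM H /=; first by have := H 0%N M1.
  by have := H p pM; case: eqP => //; lia.
rewrite /rgt; case: eqVneq => [pE|pM'].
  by have := H M.-1; rewrite prednK // pE; case: eqP; [lia | move=> _; apply].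
have pM2 : (p < M)%N by rewrite ltn_neqAle pM' pM.
by have := H p pM2; rewrite eqxx.
Qed.

(** Toggling and untoggling row [p] at once: [q] and [r] are the stages before
    and after. *)
Lemma chain_upd p q r c t : (p <= M)%N -> chain M q c ->
  ((q = p) /\ (r = p.+1) /\ interlace (c (lft p)) t /\ interlace (c (rgt M p)) t) \/
  ((q = p.+1) /\ (r = p) /\ interlace t (c (lft p)) /\ interlace t (c (rgt M p))) ->
  finsup t -> chain M r (upd c p t).
Proof.
move=> pM [H F Z] D ft; split=> [e eM|d|d dM]; last first.
- by rewrite updE; case: eqP => [?|_]; [lia | exact: Z].
- by rewrite updE; case: eqP.
rewrite !updE; have := H e eM.
have ltP1 : (e = p -> p <> M -> rgt M p = e.+1) by rewrite /rgt; case: eqP; lia.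
have ltP2 : (e.+1 = p -> lft p = e) by move=> <-.
case: (eqVneq e.+1 p) => [ep|ep]; case: (eqVneq e p) => [ep'|ep'].
- lia.
- by case: D => -[-> [-> []]]; rewrite (ltP2 ep); case: eqP; case: eqP => //; lia.
- have rE : rgt M p = e.+1 by apply: ltP1 => //; lia.
  by case: D => -[-> [-> []]]; rewrite rE ep' ?eqxx ?(gtn_eqF (ltnSn p)).
- by case: D => -[-> [-> _]]; (case: eqP; [|case: eqP]) => //; lia.
Qed.
End Chain.

Lemma sum_adjacent_terms (V : zmodType) (g : nat -> V) (M p : nat) : (p <= M)%N ->
  (forall e, (e < M)%N -> e <> p -> e.+1 <> p -> g e = 0) ->
  \sum_(e < M) g e = (if (0 < p)%N then g p.-1 else 0) +
                     (if (p < M)%N then g p else 0).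
Proof.
elim: M p => [|M IH] p pM g0.
  by rewrite big_ord0; case: p pM {g0} => //= _; rewrite addr0.
rewrite big_ord_recr /=; have [pM'|pM'] := leqP p M; last first.
  have -> : p = M.+1 by lia.
  rewrite ltnn addr0 /= big1 ?add0r // => -[i iM] _ /=.
  by apply: g0; lia.
rewrite (IH p) => [|//|e eM e1 e2]; last by apply: g0 => //; lia.
rewrite ltnS pM'; have [pM2|pM2] := ltnP p M.
  by rewrite (g0 M) ?addr0 //; lia.
by have -> : p = M by [lia]; rewrite addr0.
Qed.

Section WeightStep.
Variables (M : nat) (M1 : (0 < M)%N).
Implicit Types (c : nat -> nat -> nat) (p : nat).

(** The weight is linear in the row sizes and replacing row [p] changes only the
    two terms next to it, so [psize_toggle] gives the claim in the interior; at
    the last row the condition on [y M] is what makes the reflection work. *)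
Lemma weight_tog S y p c : (p <= M)%N -> chain M p c ->
  y M = (2 * S + y 0)%N ->
  weight S M y p c = (hook S M y p * tog_head M p c)%:Z
    + weight S M y p.+1 (tog M p c).
Proof.
move=> pM cc yM; have [il ir] := chain_nb M1 pM cc.
have [_ fin _] := cc.
have := psize_toggle (fin _) (fin _) il ir.
rewrite -/(tog_head M p c) => E.
have szE d : psize (tog M p c d) =
    if d == p then psize (toggle (c (lft p)) (c (rgt M p)) (c p)) else psize (c d).
  by rewrite /tog updE; case: eqP.
move: E szE; set t := psize (toggle _ _ _); set k := tog_head _ _ _ => E szE.
apply/eqP; rewrite eq_sym -subr_eq0 /weight opprD !addrA.
pose g e := step_weight y p.+1 e *
  ((psize (tog M p c e))%:Z - (psize (tog M p c e.+1))%:Z)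
  - step_weight y p e * ((psize (c e))%:Z - (psize (c e.+1))%:Z).
have -> : forall a b A B : int, a + b + A - B - \sum_(e < M) step_weight y p e *
    ((psize (c e))%:Z - (psize (c e.+1))%:Z) =
    a + b - B + (A - \sum_(e < M) step_weight y p e *
    ((psize (c e))%:Z - (psize (c e.+1))%:Z)) by move=> *; ring.
rewrite -sumrB (@sum_adjacent_terms _ g M p pM) => [|e eM ep e1p]; last first.
  have g1 : step_weight y p.+1 e = step_weight y p e.
    rewrite /step_weight ltnS eqSS.
    have -> : (e.+1 <= p)%N = (e.+1 < p)%N by lia.
    by case: ltnP => // _; do 2 case: eqP => //.
  by rewrite /g g1 !szE; do 2 case: eqP => // _; rewrite subrr.
rewrite /g !szE /step_weight /hook.
move: E; rewrite /lft /rgt.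
case: (posnP p) => [p0|p0].
  rewrite p0 /= M1 ?(ltn_eqF M1) ?(gtn_eqF M1) /= => E; apply/eqP.
  by rewrite PoszM; move: E => /(congr1 Posz); rewrite !PoszD => E; nia.
rewrite (prednK p0) !eqxx !ltnn.
have -> : (p.-1 == p) = false by lia.
have -> : (if p is q.+1 then q else 1%N) = p.-1 by move: p0; case: (p).
have -> : (p.+1 == p) = false by lia.
have -> : (p < p.+1)%N by [].
have -> : (p.+1 < p)%N = false by lia.
rewrite ?p0 (eq_sym M p).
have [pM2|pM2] := eqVneq p M => /(congr1 Posz) E; apply/eqP.
  by move: E; rewrite pM2 ltnn yM !PoszM !PoszD => E; nia.
have -> : (p < M)%N by lia.
by move: E; rewrite !PoszM !PoszD => E; nia.
Qed.

Lemma weight_shift S y c : y M = (2 * S + y 0)%N ->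
  weight S M y M.+1 c = weight S M (fun i => y i.+1) 0 c.
Proof.
move=> yM; rewrite /weight; congr (_ + _); apply: eq_bigr => e _.
by rewrite /step_weight /= ltnS ltn_ord.
Qed.

Lemma weight_ge0 S y p c : chain M p c -> 0 <= weight S M y p c.
Proof.
move=> [H F _]; rewrite /weight addr_ge0 //; apply: sumr_ge0 => -[e eM] _ /=.
have le_psize a b : finsup a -> finsup b -> interlace a b -> (psize b <= psize a)%N.
  move=> [L aL] [K bK] ab; rewrite (@psizeE a (maxn L K)) ?(@psizeE b (maxn L K)).
  - by apply: leq_sum => i _; case: (ab i).
  - by move=> i; rewrite geq_max => /andP[_ /bK].
  - by move=> i; rewrite geq_max => /andP[/aL].
rewrite /step_weight; have := H e eM.
case: eqP => [<-|_] il; have := le_psize _ _ (F _) (F _) il.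
  rewrite ltnn => h; rewrite mulNr -mulrN opprB mulr_ge0 // subr_ge0; lia.
by move=> h; case: ifP => _; rewrite mulr_ge0 // subr_ge0; lia.
Qed.

End WeightStep.

(** * Counting chains by sweeps of toggles *)

(** Chains form a type that is not finite, so a finite number of them is
    expressed by a list. *)
Definition counts (T : eqType) (A : T -> Prop) (n : nat) :=
  exists s : seq T, [/\ uniq s, forall x, x \in s <-> A x & size s = n].

(** The coefficients of [f] divided by [1 - z ^ h]. *)
Definition geomul (h : nat) (f : nat -> nat) : nat -> nat :=
  fun n => (\sum_(j < n.+1 | j * h <= n) f (n - j * h))%N.

Definition coefs (hs : seq nat) : nat -> nat :=
  foldr geomul (fun n => (n == 0)%N : nat) hs.

Lemma counts_geomul (T U : eqType) (A : T -> Prop) (B : nat -> U -> Prop)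
    (f : nat -> nat) (F : nat -> U -> T) (h n : nat) :
  (0 < h)%N ->
  (forall i, (i <= n)%N -> counts (B i) (f i)) ->
  (forall x, A x -> exists j u, [/\ (j * h <= n)%N, B (n - j * h)%N u & x = F j u]) ->
  (forall j u, (j * h <= n)%N -> B (n - j * h)%N u -> A (F j u)) ->
  (forall j k u v, (j * h <= n)%N -> (k * h <= n)%N ->
     B (n - j * h)%N u -> B (n - k * h)%N v -> F j u = F k v -> j = k /\ u = v) ->
  counts A (geomul h f n).
Proof.
move=> h0 cB AF FA Finj.
have /choice[s sP] : forall i, exists s : seq U, (i <= n)%N ->
    [/\ uniq s, forall x, x \in s <-> B i x & size s = f i].
  move=> i; case: (leqP i n) => [/cB[s sP]|_]; first by exists s.
  by exists [::].
pose js := [seq j <- iota 0 n.+1 | (j * h <= n)%N].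
have jsP j : (j \in js) = (j * h <= n)%N.
  rewrite mem_filter mem_iota; case: (leqP (j * h)%N n) => //= jh.
  by rewrite add0n ltnS (leq_trans _ jh) // leq_pmulr.
exists [seq F j u | j <- js, u <- s (n - j * h)%N]; split.
- apply: allpairs_uniq_dep.
  + by rewrite filter_uniq // iota_uniq.
  + by move=> j _; have [] := sP (n - j * h)%N (leq_subr _ _).
  + move=> _ _ /allpairsPdep[j [u [jj uu ->]]] /allpairsPdep[k [v [kk vv ->]]] /=.
    rewrite !jsP in jj kk.
    have [_ /(_ u)[+ _] _] := sP (n - j * h)%N (leq_subr _ _); move=> /(_ uu) Bu.
    have [_ /(_ v)[+ _] _] := sP (n - k * h)%N (leq_subr _ _); move=> /(_ vv) Bv.
    by move=> /(Finj _ _ _ _ jj kk Bu Bv)[-> ->].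
- move=> x; split.
    move=> /allpairsPdep[j [u [jj uu ->]]]; rewrite jsP in jj.
    have [_ /(_ u)[+ _] _] := sP (n - j * h)%N (leq_subr _ _).
    by move=> /(_ uu) Bu; apply: FA.
  move=> /AF[j [u [jj uu ->]]]; apply/allpairsPdep; exists j, u.
  rewrite jsP jj; split=> //.
  by have [_ /(_ u)[_ +] _] := sP (n - j * h)%N (leq_subr _ _); apply.
- rewrite size_allpairs_dep sumnE big_map /geomul big_filter.
  rewrite -(big_mkord (fun j => (j * h <= n)%N) (fun j => f (n - j * h)%N)).
  rewrite /index_iota subn0; apply: eq_bigr => j _.
  by have [] := sP (n - j * h)%N (leq_subr _ _).
Qed.

Section Sweep.
Variables (S M : nat) (M1 : (0 < M)%N).

Definition chainset y p n c := chain M p c /\ weight S M y p c = n%:Z.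

Lemma upd_upd c p t t' : upd (upd c p t) p t' = upd c p t'.
Proof. by apply/funext => d; rewrite !updE; case: eqP. Qed.

Lemma upd_id c p : upd c p (c p) = c.
Proof. by apply/funext => d; rewrite !updE; case: eqP => // ->. Qed.

Lemma upd_nb c p t : upd c p t (lft p) = c (lft p) /\
  upd c p t (rgt M p) = c (rgt M p) /\ upd c p t p = t.
Proof.
have /eqP/negbTE l := @lft_neq p; have /eqP/negbTE r := @rgt_neq M M1 p.
by rewrite !updE eqxx l r.
Qed.

Lemma chain_tog p c : (p <= M)%N -> chain M p c -> chain M p.+1 (tog M p c).
Proof.
move=> pM cc; have [il ir] := chain_nb M1 pM cc; have [_ fin _] := cc.
apply: (chain_upd M1 pM cc); last exact: toggle_finsup.
by left; do 2 (split => //); exact: toggle_interlace.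
Qed.

Lemma chain_untog p j c : (p <= M)%N -> chain M p.+1 c -> chain M p (untog M p j c).
Proof.
move=> pM cc; have [il ir] := chainS_nb M1 pM cc; have [_ fin _] := cc.
apply: (chain_upd M1 pM cc); last exact: untoggle_finsup.
by right; do 2 (split => //); exact: untoggle_interlace.
Qed.

Lemma togK p c : (p <= M)%N -> chain M p c ->
  untog M p (tog_head M p c) (tog M p c) = c.
Proof.
move=> pM cc; have [il ir] := chain_nb M1 pM cc.
rewrite /untog /tog upd_upd; set t := toggle _ _ _.
have [-> [-> ->]] := upd_nb c p t.
by rewrite /t /tog_head toggleK // upd_id.
Qed.

Lemma untogK p j c : (p <= M)%N -> chain M p.+1 c ->
  tog M p (untog M p j c) = c /\ tog_head M p (untog M p j c) = j.
Proof.
move=> pM cc; have [il ir] := chainS_nb M1 pM cc.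
rewrite /untog /tog /tog_head upd_upd; set t := untoggle _ _ _ _.
have [-> [-> ->]] := upd_nb c p t.
by have [-> ->] := untoggleK j il ir; rewrite upd_id.
Qed.

Lemma hook_gt0 y p : (0 < y 0)%N -> (0 < hook S M y p)%N.
Proof. by rewrite /hook; case: eqP => // _; case: eqP => _; lia. Qed.

(** A chain at stage [p] is the same as the excess split off by its toggle
    together with the toggled chain. *)
Lemma counts_toggle y p n f : (p <= M)%N -> y M = (2 * S + y 0)%N -> (0 < y 0)%N ->
  (forall i, (i <= n)%N -> counts (chainset y p.+1 i) (f i)) ->
  counts (chainset y p n) (geomul (hook S M y p) f n).
Proof.
move=> pM yM y0 cf; have h0 := hook_gt0 p y0.
apply: (counts_geomul (F := untog M p) h0 cf).
- move=> c [cc wc]; exists (tog_head M p c), (tog M p c).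
  have := weight_tog M1 pM cc yM; rewrite wc.
  have cc' := chain_tog pM cc; have := weight_ge0 M1 S y cc'.
  rewrite [in X in _ = X]mulnC => w0 E.
  have le : (tog_head M p c * hook S M y p <= n)%N by lia.
  split=> //; last by rewrite togK.
  by split=> //; rewrite -subzn //; lia.
- move=> j c le [cc wc]; have cc' := chain_untog j pM cc.
  split=> //; rewrite (weight_tog M1 pM cc' yM).
  by have [-> ->] := untogK j pM cc; rewrite wc -subzn // mulnC; lia.
- move=> j k u v _ _ [cu _] [cv _] E.
  have [a1 a2] := untogK j pM cu; have [b1 b2] := untogK k pM cv.
  by rewrite E in a1 a2; split; [rewrite -a2 b2 | rewrite -a1 b1].
Qed.

Definition sweep_hooks (y : nat -> nat) : seq nat := [seq hook S M y p | p <- iota 0 M.+1].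

Lemma counts_sweep y n f : y M = (2 * S + y 0)%N -> (0 < y 0)%N ->
  (forall i, (i <= n)%N -> counts (chainset (fun i => y i.+1) 0 i) (f i)) ->
  (forall i, (i <= n)%N -> counts (chainset y 0 i) (foldr geomul f (sweep_hooks y) i)).
Proof.
move=> yM y0 cf; rewrite /sweep_hooks.
have {}cf i : (i <= n)%N -> counts (chainset y M.+1 i) (f i).
  move=> /cf[s [us sP ss]]; exists s; split=> // c; rewrite sP /chainset weight_shift //.
  split=> -[[H F Z] w]; split=> //; split=> // e eM; have := H e eM.
    by rewrite eqSS ltn_eqF.
  by rewrite eqSS ltn_eqF.
suff H q p : (q + p = M.+1)%N -> forall i, (i <= n)%N ->
    counts (chainset y p i) (foldr geomul f [seq hook S M y p | p <- iota p q] i).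
  by apply: H; rewrite addn0.
elim: q p => [|q IH] p qp i iN /=; first by have -> : p = M.+1 by []; exact: cf.
apply: counts_toggle => //; first by lia.
by move=> k ki; apply: IH; lia.
Qed.

Lemma counts_sweeps N y n f :
  (forall i, y (i + M)%N = (2 * S + y i)%N) -> (forall i, 0 < y i)%N ->
  (forall i, (i <= n)%N -> counts (chainset (fun i => y (N + i)%N) 0 i) (f i)) ->
  (forall i, (i <= n)%N -> counts (chainset y 0 i)
     (foldr geomul f (flatten [seq sweep_hooks (fun i => y (s + i)%N) | s <- iota 0 N]) i)).
Proof.
elim: N y f => [|N IH] y f yM y0 cf /=; first exact: cf.
rewrite foldr_cat; apply: counts_sweep => //; first exact: (yM 0%N).
have -> : iota 1 N = [seq s.+1 | s <- iota 0 N] by rewrite -[1%N]addn0 iotaDl.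
rewrite -map_comp; apply: (IH (fun i => y i.+1)) => // i.
by rewrite -addSn yM.
Qed.

End Sweep.

(** * Coefficients of products of geometric series *)

Section GeomulTheory.
Implicit Types (f : nat -> nat) (h k n : nat).

Lemma geomulE h f n : (0 < h)%N ->
  geomul h f n = (f n + if (h <= n)%N then geomul h f (n - h) else 0)%N.
Proof.
move=> h0; rewrite /geomul big_mkcond /= big_ord_recl /= subn0.
congr (_ + _)%N; case: leqP => hn; last first.
  by rewrite big1 // => -[i iN] _ /=; rewrite /bump leq0n add1n; case: leqP => //; nia.
rewrite [RHS]big_mkcond /=.
rewrite -(big_mkord xpredT (fun i => if (i * h <= n - h)%N then f (n - h - i * h)%N else 0%N)).
rewrite -(big_mkord xpredT (fun i => if (bump 0 i * h <= n)%N then f (n - bump 0 i * h)%N else 0%N)).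
rewrite (big_cat_nat _ (n := (n - h).+1)) //=; last by lia.
rewrite [X in (_ + X)%N]big_nat [X in (_ + X)%N]big1 ?addn0 => [|i /andP[hi _]]; last first.
  by rewrite /bump leq0n add1n; case: leqP => //; nia.
apply: eq_big_nat => i _; rewrite /bump leq0n add1n mulSn.
by rewrite leq_subRL // subnDA.
Qed.

Lemma geomulC h k f : (0 < h)%N -> (0 < k)%N ->
  geomul h (geomul k f) = geomul k (geomul h f).
Proof.
move=> h0 k0; apply/funext => n; elim/ltn_ind: n => n IH.
rewrite (geomulE _ _ h0) (geomulE _ n k0) (geomulE (geomul h f) _ k0) (geomulE _ n h0).
rewrite -!addnA; congr (_ + _)%N.
case: (leqP h n) => hn; case: (leqP k n) => kn; rewrite ?addn0 //.
- rewrite (IH (n - h)%N) -?(IH (n - k)%N); try lia.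
  rewrite (geomulE (geomul h f) _ k0) (geomulE (geomul k f) _ h0) !leq_subRL //.
  rewrite addnC [(h + k)%N]addnC; case: leqP => hk; last by rewrite !addn0 addnC.
  rewrite (IH (n - k - h)%N); last by lia.
  by rewrite -!subnDA [(k + h)%N]addnC; lia.
- rewrite add0n (IH (n - h)%N); last by lia.
  by rewrite (geomulE (geomul h f) _ k0) leq_subRL // ifF ?addn0 //; lia.
- rewrite -(IH (n - k)%N); last by lia.
  by rewrite (geomulE (geomul k f) _ h0) leq_subRL // ifF ?addn0 //; lia.
Qed.

Lemma coefs_perm (s t : seq nat) : all (fun h => 0 < h)%N s -> perm_eq s t ->
  coefs s = coefs t.
Proof.
elim: s t => [|h s IH] t /= => [_|/andP[h0 s0] st].
  by rewrite perm_sym => /perm_nilP ->.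
have ht : h \in t by rewrite -(perm_mem st) mem_head.
have t0 : all (fun h => 0 < h)%N t by rewrite -(perm_all _ st) /= h0.
rewrite (IH (rem h t)) //; last first.
  by rewrite -(perm_cons h); apply: (perm_trans st); exact: perm_to_rem.
elim: t ht t0 {IH st} => //= k t IH; rewrite inE => ht /andP[k0 t0].
rewrite eq_sym; case: eqP ht => [-> //|_] /= ht.
have coefs_cons j u : coefs (j :: u) = geomul j (coefs u) by [].
by rewrite ?coefs_cons -(IH ht t0) geomulC.
Qed.

End GeomulTheory.

(** * Chains of equal rows *)

(** Partitions into at most [L] parts, each weighted by [S]. *)
Definition parts (S L n : nat) (a : nat -> nat) :=
  [/\ forall i, (a i.+1 <= a i)%N, forall i, (L <= i)%N -> a i = 0%N
    & (S * \sum_(i < L) a i)%N = n].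

Lemma parts_le (a : nat -> nat) : (forall i, (a i.+1 <= a i)%N) ->
  forall i j, (i <= j)%N -> (a j <= a i)%N.
Proof.
move=> am i j /subnK <-; elim: (j - i)%N => // d IH.
by rewrite addSn (leq_trans (am _)).
Qed.

(** Removing the columns of full height: a partition into at most [L.+1] parts
    is its last part together with a partition into at most [L] parts. *)
Lemma counts_parts S L n : (0 < S)%N ->
  counts (parts S L n) (coefs [seq (S * l)%N | l <- rev (iota 1 L)] n).
Proof.
move=> S0; elim: L n => [|L IH] n.
  case: n => [|n].
    exists [:: fun=> 0%N]; split=> // x; rewrite inE; split.
      by move=> /eqP ->; split=> //; rewrite big_ord0 muln0.
    by move=> [_ x0 _]; apply/eqP/funext => i; rewrite x0.
  exists [::]; split=> // x; split=> // -[_ _].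
  by rewrite big_ord0 muln0.
have -> : rev (iota 1 L.+1) = L.+1 :: rev (iota 1 L).
  by rewrite -rev_rcons -cats1 -{1}[L.+1]addn1 iotaD add1n.
pose F (j : nat) (u : nat -> nat) i := if (i <= L)%N then (u i + j)%N else 0%N.
have FS j u : (\sum_(i < L.+1) F j u i = \sum_(i < L) u i + u L + j * L.+1)%N.
  under eq_bigr => i _ do rewrite /F -ltnS ltn_ord.
  by rewrite big_split /= sum_nat_const card_ord big_ord_recr /= mulnC.
rewrite map_cons; apply: (counts_geomul (B := parts S L) (F := F)).
- by rewrite muln_gt0 S0.
- by move=> i _; exact: IH.
- move=> x [xm x0 xS]; exists (x L), (fun i => if (i < L)%N then x i - x L else 0)%N.
  set u := fun i => _.
  have xE : x = F (x L) u.
    apply/funext => i; rewrite /F /u; case: (leqP i L) => iL; last exact: x0.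
    case: (ltnP i L) => iL2; first by rewrite subnK // parts_le.
    by have -> : i = L by lia.
  have uL i : (L <= i)%N -> u i = 0%N by rewrite /u; case: ltnP.
  have := FS (x L) u; rewrite -xE (uL L) // => E.
  rewrite E in xS; split=> //; first by nia.
  split=> // [i|]; last by nia.
  rewrite /u; case: ltnP => iL //; rewrite (ltnW iL).
  by have := xm i; lia.
- move=> j u le [um u0 uS]; split=> [i|i Li|].
  + rewrite /F; case: ltnP => // iL; rewrite (ltnW iL); have := um i; lia.
  + by rewrite /F leqNgt Li.
  + by rewrite FS (u0 L) //; nia.
- move=> j k u v _ _ [_ u0 _] [_ v0 _] E.
  have jk : j = k.
    by have := congr1 (@^~ L) E; rewrite /F leqnn u0 // v0.
  split=> //; apply/funext => i; have := congr1 (@^~ i) E; rewrite /F jk.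
  by case: leqP => iL; [lia | rewrite u0 ?v0 //; lia].
Qed.

Section ConstantChains.
Variables (S M : nat) (M1 : (0 < M)%N) (S0 : (0 < S)%N).

Lemma le_psize_eq a b : finsup a -> finsup b -> (forall i, b i <= a i)%N ->
  (psize a <= psize b)%N -> a = b.
Proof.
move=> [L aL] [K bK] ba; rewrite (@psizeE a (maxn L K)) ?(@psizeE b (maxn L K));
  [|by move=> i; rewrite geq_max => /andP[/aL ? /bK ?]..].
move=> le; apply/funext => i.
have [iL|] := ltnP i (maxn L K); last by rewrite geq_max => /andP[/aL -> /bK ->].
apply/eqP; rewrite eqn_leq ba andbT leqNgt; apply/negP => lt.
have : (\sum_(i < maxn L K) b i < \sum_(i < maxn L K) a i)%N.
  rewrite (bigD1 (Ordinal iL)) //= [leqRHS](bigD1 (Ordinal iL)) //= -addSn leq_add //; exact: leq_sum.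
by rewrite ltnNge le.
Qed.

(** If every coefficient of the weight exceeds [n], then two consecutive rows
    of a chain of weight [n] have the same size, hence are equal. *)
Lemma counts_const_chain y n L :
  (forall i, (i < M)%N -> (n < y i)%N) -> (n < L)%N ->
  counts (chainset S M y 0 n) (coefs [seq (S * l)%N | l <- rev (iota 1 L)] n).
Proof.
move=> yn nL; have [s [us sP <-]] := counts_parts L n S0.
pose g (a : nat -> nat) : nat -> nat -> nat := fun d => if (d <= M)%N then a else fun=> 0%N.
have ginj : injective g.
  by move=> a b /(congr1 (@^~ 0%N)); rewrite /g leq0n.
exists (map g s); split; [by rewrite map_inj_uniq| |by rewrite size_map].
move=> c; split.
  move=> /mapP[a /sP [am a0 aS] ->]; split; first split.
  - by move=> e eM /=; rewrite /g eM (ltnW eM) => i; split.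
  - by move=> d; rewrite /g; case: ifP => _; [exists L | exists 0%N].
  - by move=> d dM; rewrite /g leqNgt dM.
  rewrite /weight big1 => [|i _]; last first.
    by rewrite /g (ltn_ord i) (ltnW (ltn_ord i)) subrr mulr0.
  by rewrite addr0 /g leqnn (psizeE a0) -PoszM aS.
move=> [cc wc]; have [H F Z] := cc.
have le e : (e < M)%N -> (psize (c e.+1) <= psize (c e))%N.
  move=> eM; have [K1 k1] := F e; have [K2 k2] := F e.+1.
  rewrite (@psizeE (c e) (maxn K1 K2)) ?(@psizeE (c e.+1) (maxn K1 K2)).
  - by apply: leq_sum => i _; have := H e eM; case/(_ i).
  - by move=> i; rewrite geq_max => /andP[_ /k2].
  - by move=> i; rewrite geq_max => /andP[/k1].
have eqc e : (e < M)%N -> c e = c e.+1.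
  move=> eM; apply: le_psize_eq => //; first by move=> i; have := H e eM; case/(_ i).
  rewrite leqNgt; apply/negP => lt; move: wc; rewrite /weight.
  rewrite (bigD1 (Ordinal eM)) //= /step_weight /=.
  set X := \sum_(_ < _ | _) _; have X0 : 0 <= X.
    apply: sumr_ge0 => -[i iM] _ /=; rewrite mulr_ge0 // subr_ge0.
    exact: (le i iM).
  by have := yn e eM; nia.
have cE e : (e <= M)%N -> c e = c 0%N.
  by elim: e => // e IH eM; rewrite -(eqc e eM) IH // ltnW.
have gE : c = g (c 0%N).
  by apply/funext => d; rewrite /g; case: leqP => dM; [exact: cE | exact: Z].
rewrite gE; apply/mapP; exists (c 0%N) => //; apply/sP.
have mon i : (c 0 i.+1 <= c 0 i)%N.
  by have := H 0%N M1; rewrite /= => /(_ i)[]; rewrite (cE 1%N) // => _; lia.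
have [K k0] := F 0%N.
have wS : (S * psize (c 0%N))%N = n.
  move: wc; rewrite /weight big1 => [|i _]; last first.
    by rewrite (eqc i (ltn_ord i)) subrr mulr0.
  by rewrite addr0 (cE M) // -PoszM => -[].
have cL i : (L <= i)%N -> c 0 i = 0%N.
  move=> Li; apply/eqP; rewrite -leqn0 leqNgt; apply/negP => ci.
  have : (i < psize (c 0))%N.
    rewrite (@psizeE _ (maxn K i.+1)) => [|j]; last first.
      by rewrite geq_max => /andP[/k0].
    apply: (@leq_trans (\sum_(j < i.+1) 1)%N); first by rewrite sum_nat_const card_ord muln1.
    rewrite (big_ord_widen (maxn K i.+1) (fun=> 1%N)) ?leq_maxr //.
    rewrite big_mkcond leq_sum // => j _; case: ifP => // ji.
    by apply: (leq_trans ci); apply: parts_le mon _ _ _; rewrite -ltnS.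
  by nia.
by split=> //; rewrite -(psizeE cL).
Qed.

End ConstantChains.

(** * The list of hook weights *)

Definition pair_exps (m K : nat) : seq nat :=
  flatten [seq flatten [seq [seq (2 * m * k + h + j)%N | h <- index_iota 1 j]
                       | j <- index_iota 1 m] | k <- index_iota 0 K].

(** The single exponents are cut off at [m * K], because the sweeps
    that produce the pairs with [k < K], completed by the multiples of [m] from
    the final partitions, produce exactly these ([perm_exps]). *)
Definition exps (m K : nat) : seq nat :=
  index_iota 1 (m * K).+1 ++ pair_exps m K.

Lemma exps_gt0 m K : all (fun h => 0 < h)%N (exps m K).
Proof.
rewrite all_cat; apply/andP; split.
  by apply/allP => e; rewrite mem_index_iota => /andP[].
apply/allP => e /flattenP[_ /mapP[k _ ->]] /flattenP[_ /mapP[j _ ->]] /mapP[h + ->].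
by rewrite mem_index_iota => /andP[]; lia.
Qed.

Lemma big_pair_exps (T : Type) (x : T) (op : Monoid.law x) (F : nat -> T) m K :
  \big[op/x]_(e <- pair_exps m K) F e =
  \big[op/x]_(0 <= k < K) \big[op/x]_(1 <= j < m) \big[op/x]_(1 <= h < j)
     F (2 * m * k + h + j)%N.
Proof.
rewrite /pair_exps big_flatten big_map; apply: eq_bigr => k _.
rewrite big_flatten big_map; apply: eq_bigr => j _.
by rewrite big_map.
Qed.

(** The weights [1, ..., m.-1] of the first sweep make the weight of a chain the
    sum of its rows ([weight_diagonal_sum]); each further sweep adds [2 * m]. *)
Definition row_weight (m : nat) (i : nat) : nat :=
  (2 * m * (i %/ m.-1) + i %% m.-1 + 1)%N.

Section HookList.
Variables (m : nat) (m1 : (1 < m)%N).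
Let M := m.-1.
Let y := row_weight m.

Lemma row_weightE r t : (t < M)%N -> y (M * r + t) = (2 * m * r + t + 1)%N.
Proof.
move=> tM; rewrite /y /row_weight -/M [(M * r)%N]mulnC modnMDl modn_small //.
by rewrite divnMDl ?(leq_ltn_trans _ tM) // divn_small // addn0.
Qed.

Lemma row_weight_period i : y (i + M) = (2 * m + y i)%N.
Proof.
have M0 : (0 < M)%N by rewrite /M; lia.
rewrite /y /row_weight -/M modnDr divnDr // divnn M0 mulnDr muln1; lia.
Qed.

Lemma row_weight_gt0 i : (0 < y i)%N.
Proof. by rewrite /y /row_weight addn1. Qed.

Lemma big_sweep_hooks (F : nat -> nat) s :
  (\sum_(e <- sweep_hooks m M (fun i => y (s + i))) F e =
   F (y s) + \sum_(1 <= p < M) F (y s + y (s + p)) + F (m + y s))%N.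
Proof.
have M0 : (0 < M)%N by rewrite /M; lia.
have MM : M = M.-1.+1 by rewrite prednK.
rewrite /sweep_hooks.
have -> : iota 0 M.+1 = 0%N :: rcons (iota 1 M.-1) M.
  by rewrite /= -cats1 {1}MM -[M.-1.+1]addn1 iotaD add1n -MM.
rewrite big_map big_cons /hook /= addn0 -addnA; congr (_ + _)%N.
rewrite -cats1 big_cat big_seq1 /= eqn0Ngt M0 eqxx ?addn0 /=; congr (_ + _)%N.
rewrite /index_iota subn1 big_seq_cond [RHS]big_seq_cond.
apply: eq_bigr => p; rewrite mem_iota andbT => /andP[p1 p2].
by rewrite eqn0Ngt p1 /=; case: eqP => // pM; lia.
Qed.

Lemma exchange_triangle (A : nat -> nat -> nat) (N : nat) :
  (\sum_(t < N) \sum_(1 + t <= u < N) A t u = \sum_(u < N) \sum_(t < u) A t u)%N.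
Proof.
under eq_bigr => t _ do rewrite (big_nat_widenl _ 0) // big_mkord.
rewrite (exchange_big_dep xpredT) //=; apply: eq_bigr => u _.
by rewrite (big_ord_widen N (fun t => A t u)) // ltnW.
Qed.

(** The second index of a pair of rows in a sweep wraps around after [M] rows;
    the pairs before the wrap give the even values of [k] in [pair_exps], those
    after it the odd ones. *)
Lemma sum_round_pairs (F : nat -> nat) r :
  (\sum_(t < M) \sum_(1 <= p < M) F (y (M * r + t) + y (M * r + t + p)) =
   \sum_(1 <= j < m) \sum_(1 <= h < j) F (2 * m * (2 * r) + h + j) +
   \sum_(1 <= j < m) \sum_(1 <= h < j) F (2 * m * (2 * r).+1 + h + j))%N.
Proof.
have shift (k : nat) : (\sum_(1 <= j < m) \sum_(1 <= h < j) F (2 * m * k + h + j) =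
    \sum_(u < M) \sum_(t < u) F (2 * m * k + t + u + 2))%N.
  rewrite big_add1 -/M big_mkord; apply: eq_bigr => u _.
  rewrite big_add1 /= big_mkord; apply: eq_bigr => t _.
  by congr F; lia.
rewrite !shift -(exchange_triangle (fun t u => F (2 * m * (2 * r) + t + u + 2)%N)).
rewrite -big_split /=; apply: eq_bigr => t _.
have tM := ltn_ord t.
rewrite (big_cat_nat _ (n := (M - t)%N)) //=; try lia.
congr (_ + _)%N.
  rewrite [RHS]big_addn big_nat_cond [RHS]big_nat_cond; apply: eq_bigr => p.
  rewrite andbT => /andP[p1 p2].
  rewrite -addnA !row_weightE //; last by lia.
  by congr F; lia.
rewrite -[X in (\sum_(X <= _ < _) _)%N]add0n big_addn subKn ?(ltnW tM) //.
rewrite big_mkord; apply: eq_bigr => v _; have vt := ltn_ord v.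
have -> : (M * r + t + (v + (M - t)) = (M * r + v) + M)%N by lia.
rewrite row_weight_period !row_weightE; [|lia..].
by congr F; lia.
Qed.

Lemma sum_round_singles (G : nat -> nat) :
  (\sum_(t < M) (G t.+1 + G (m + t.+1)) + (G m + G (2 * m)) =
   \sum_(1 <= i < (2 * m).+1) G i)%N.
Proof.
have mM : m = M.+1 by rewrite /M prednK // ltnW.
have M2 : (2 * m = m + m)%N by lia.
rewrite (big_cat_nat _ (n := m.+1)) //=; try lia.
rewrite big_nat_recr /=; last by lia.
rewrite M2 [X in (_ = _ + _ + X)%N]big_nat_recr /=; last by lia.
rewrite [in RHS]big_add1 -/M big_mkord.
rewrite -[X in (\sum_(X <= _ < _) _)%N]add1n -[X in (\sum_(_ <= _ < X) _)%N]addn0.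
rewrite big_split /=.
have -> : (\sum_(1 + m <= i < m + m + 0) G i = \sum_(t < M) G (m + t.+1))%N.
  rewrite big_addn addn0 addnK big_add1 -/M big_mkord.
  by apply: eq_bigr => i _; rewrite addnC.
set x1 := (\sum_(t < M) _)%N; set x2 := (\sum_(t < M) _)%N.
lia.
Qed.

(** By induction on the number of rounds: a round of [m.-1] sweeps and two
    multiples of [m] from the final partitions yield the pairs of two values of
    [k] and [2 * m] consecutive single exponents. *)
Lemma perm_exps (R : nat) :
  perm_eq (flatten [seq sweep_hooks m M (fun i => y (s + i)) | s <- iota 0 (M * R)]
           ++ [seq (m * l)%N | l <- rev (iota 1 (2 * R))])
          (exps m (2 * R)).
Proof.
apply/permP => a; pose F e := nat_of_bool (a e).
have cE s : count a s = (\sum_(e <- s) F e)%N.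
  by rewrite -sumn_count sumnE big_map.
rewrite !cE big_cat /= /exps big_cat /= big_flatten /= big_map.
rewrite (eq_bigr _ (fun s _ => big_sweep_hooks F s)) big_map.
rewrite [X in (_ + X = _)%N](perm_big (iota 1 (2 * R))) ?perm_rev //= big_pair_exps.
have -> : iota 0 (M * R) = index_iota 0 (M * R) by rewrite /index_iota subn0.
have -> : iota 1 (2 * R) = index_iota 1 (2 * R).+1 by rewrite /index_iota subn1.
elim: R => [|R IH]; first by rewrite !muln0 !big_geq.
have -> : (M * R.+1 = M + M * R)%N by rewrite mulnS.
have -> : (2 * R.+1 = (2 * R).+2)%N by lia.
rewrite [X in (X + _ = _)%N](big_cat_nat _ (n := (M * R)%N)) ?leq_addl //=.
rewrite [in X in (_ + X = _)%N]big_nat_recr //= [in X in (_ + X = _)%N]big_nat_recr //=.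
have -> : (m * (2 * R).+2 = m * (2 * R) + 2 * m)%N by lia.
rewrite [X in (_ = X + _)%N](big_cat_nat _ (n := (m * (2 * R)).+1)) //=; last by lia.
rewrite [in X in (_ = _ + X)%N]big_nat_recr //= [in X in (_ = _ + X)%N]big_nat_recr //=.
rewrite -[X in (\sum_(X <= _ < M + _) _)%N]add0n big_addn addnK.
rewrite -[X in (\sum_(X <= _ < (m * (2 * R) + 2 * m).+1) _)%N]add1n big_addn.
have -> : ((m * (2 * R) + 2 * m).+1 - m * (2 * R) = (2 * m).+1)%N by lia.
rewrite -(sum_round_singles (fun i => F (i + m * (2 * R))%N)).
rewrite [X in (_ + X + _ = _)%N](_ : _ =
   \sum_(t < M) (F (t.+1 + m * (2 * R)) + F (m + t.+1 + m * (2 * R))) +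
   \sum_(t < M) \sum_(1 <= p < M) F (y (M * R + t) + y (M * R + t + p)))%N; last first.
  rewrite big_mkord -big_split /=; apply: eq_bigr => t _.
  rewrite addnAC [(t + M * R)%N]addnC; congr (_ + _)%N.
  by rewrite row_weightE //; congr (F _ + F _)%N; lia.
rewrite sum_round_pairs.
have -> : (m * (2 * R).+1 = m + m * (2 * R))%N by lia.
rewrite [(m * (2 * R) + 2 * m)%N]addnC.
move: IH.
set x1 := (\sum_(0 <= i < M * R) _)%N; set x2 := (\sum_(t < M) _)%N.
set x3 := (\sum_(1 <= i < (2 * R).+1) _)%N; set x4 := (\sum_(0 <= k < 2 * R) _)%N.
set x5 := (\sum_(1 <= j < m) _)%N; set x6 := (\sum_(1 <= j < m) _)%N.
set x7 := (\sum_(1 <= i < (m * (2 * R)).+1) _)%N.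
lia.
Qed.

End HookList.

(** * Band arrays as chains of diagonals *)

Lemma bandP (m : nat) (d : 'I_m) (j : nat) : in_band m ((j + d)%N, j).
Proof. by rewrite /in_band /= leq_addr ltn_add2l ltn_ord. Qed.

Definition band_point (m : nat) (d : 'I_m) (j : nat) : band m :=
  exist _ ((j + d)%N, j) (bandP d j).

Definition diagonals (m : nat) (f : {fsfun band m -> nat with 0%N}) :
    nat -> nat -> nat :=
  fun d i => if insub d is Some d' then f (band_point (d' : 'I_m) i) else 0%N.

Section Diagonals.
Variable m : nat.
Implicit Types (f : {fsfun band m -> nat with 0%N}).

Lemma diagonalsE f (d : 'I_m) i : diagonals f d i = f (band_point d i).
Proof. by rewrite /diagonals valK. Qed.

Lemma diagonals_out f d i : (m <= d)%N -> diagonals f d i = 0%N.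
Proof. by move=> md; rewrite /diagonals insubN // -leqNgt. Qed.

Lemma band_pointP (p : band m) : exists d : 'I_m, p = band_point d (val p).2.
Proof.
case: p => -[i j] /= ij; have dm : (i - j < m)%N by move: ij; rewrite /in_band /=; lia.
exists (Ordinal dm); apply: val_inj => /=; congr (_, _).
by move: ij; rewrite /in_band /=; lia.
Qed.

Lemma band_point_inj (d e : 'I_m) i j : band_point d i = band_point e j -> d = e /\ i = j.
Proof.
move=> /(congr1 val) /= [dij ij]; split=> //; apply: val_inj.
by move: dij; rewrite ij; exact: addnI.
Qed.

Lemma diagonals_inj : injective (@diagonals m).
Proof.
move=> f g fg; apply/fsfunP => p; have [d ->] := band_pointP p.
by rewrite -!diagonalsE fg.
Qed.

Lemma fsfun_bound f : exists L, forall p : band m, (L <= (val p).2)%N -> f p = 0%N.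
Proof.
exists (\max_(p <- finsupp f) (val p).2).+1 => p Lp.
apply: fsfun_dflt; apply/negP => pf.
by move: Lp; rewrite ltnNge (leq_bigmax_seq p).
Qed.

Lemma sum_diagonals f :
  (\sum_(p <- finsupp f) f p = \sum_(d < m) psize (diagonals f d))%N.
Proof.
have [L fL] := fsfun_bound f.
rewrite [RHS](eq_bigr (fun d => \sum_(j < L) f (band_point d j))%N); last first.
  move=> d _; rewrite (@psizeE _ L) => [|i Li]; last by rewrite diagonalsE fL.
  by apply: eq_bigr => i _; rewrite diagonalsE.
rewrite pair_big /=.
pose E := [seq band_point x.1 (nat_of_ord x.2) | x <- enum {: 'I_m * 'I_L}].
have uE : uniq E.
  rewrite map_inj_uniq ?enum_uniq // => -[d i] [e j] /band_point_inj[/= -> ij].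
  by congr (_, _); exact: val_inj.
have -> : (\sum_(p : 'I_m * 'I_L) f (band_point p.1 p.2) = \sum_(p <- E) f p)%N.
  by rewrite big_map big_enum.
rewrite [RHS](bigID (mem (finsupp f))) /= [X in (_ = _ + X)%N]big1 ?addn0; last first.
  by move=> p; exact: fsfun_dflt.
rewrite -[RHS]big_filter; apply: perm_big; apply: uniq_perm; rewrite ?fset_uniq ?filter_uniq //.
move=> p; rewrite mem_filter; case: (boolP (p \in finsupp f)) => //= pf.
have [d pE] := band_pointP p; apply/esym/mapP.
have iL : ((val p).2 < L)%N.
  by rewrite ltnNge; apply/negP => /fL; apply/eqP; rewrite -mem_finsupp.
by exists (d, Ordinal iL); rewrite ?mem_enum.
Qed.

Lemma banded_chain f n : (0 < m)%N ->
  banded_plane_partition m n f <->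
  chain m.-1 0 (diagonals f) /\ (\sum_(d < m) psize (diagonals f d))%N = n.
Proof.
move=> m0; rewrite /banded_plane_partition /= sum_diagonals; split.
  move=> [H1 H2 ->]; split=> //; split.
  - move=> e eM /= i; have e1 : (e < m)%N by lia.
    have e2 : (e.+1 < m)%N by lia.
    have -> : diagonals f e = fun j => f (band_point (Ordinal e1) j).
      by apply/funext => j; rewrite -diagonalsE.
    have -> : diagonals f e.+1 = fun j => f (band_point (Ordinal e2) j).
      by apply/funext => j; rewrite -diagonalsE.
    split; [apply: H2 | apply: H1] => /=.
      by rewrite addnS.
    by rewrite addSn addnS.
  - move=> d; have [L fL] := fsfun_bound f; exists L => i Li.
    by rewrite /diagonals; case: insubP => // u _ _; apply: fL.
  - by move=> d md; apply/funext => i; rewrite diagonals_out //; lia.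
move=> [[H _ _] ->]; split=> // p q.
  have [d ->] := band_pointP p; have [e ->] := band_pointP q => /= -[eij ij].
  have em : (e < m.-1)%N by have := ltn_ord d; lia.
  have := H e em; rewrite /= => /(_ (val p).2)[_]; rewrite diagonalsE.
  have -> : e.+1 = d by lia.
  by rewrite diagonalsE ij.
have [d ->] := band_pointP p; have [e ->] := band_pointP q => /= -[eij ij].
have em : (d < m.-1)%N by have := ltn_ord e; lia.
have := H d em; rewrite /= => /(_ (val p).2)[+ _]; rewrite diagonalsE.
have -> : d.+1 = e by lia.
by rewrite diagonalsE ij.
Qed.

Lemma chain_diagonals c : (0 < m)%N -> chain m.-1 0 c -> exists f, diagonals f = c.
Proof.
move=> m0 [_ F Z].
have [L cL] : exists L, forall d i, (L <= i)%N -> c d i = 0%N.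
  have /choice[l lP] : forall d, exists l, forall i, (l <= i)%N -> c d i = 0%N.
    by move=> d; have [l] := F d; exists l.
  exists (\max_(d < m) l d) => d i; have [dm|dm] := ltnP d m.
    by move=> li; apply: lP; apply: leq_trans li; rewrite (leq_bigmax (Ordinal dm)).
  by rewrite Z //; lia.
pose E := [seq band_point x.1 (nat_of_ord x.2) | x <- enum {: 'I_m * 'I_L}].
pose g (p : band m) := c ((val p).1 - (val p).2)%N (val p).2.
pose f : {fsfun band m -> nat with 0%N} := [fsfun p in [fset p | p in E]%fset => g p | 0%N].
exists f; apply/funext => d; apply/funext => i.
have [dm|dm] := ltnP d m; last by rewrite diagonals_out // Z //; lia.
rewrite -[d]/(nat_of_ord (Ordinal dm)) diagonalsE /f fsfunE.
have gE : g (band_point (Ordinal dm) i) = c d i by rewrite /g /= addKn.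
rewrite ?gE; case: ifPn => //= nE; rewrite cL // leqNgt; apply: contra nE => iL.
rewrite !inE; apply/mapP; exists (Ordinal dm, Ordinal iL); by rewrite ?mem_enum.
Qed.

End Diagonals.

(** Summation by parts. *)
Lemma weight_diagonal_sum m c : (1 < m)%N ->
  weight m m.-1 (row_weight m) 0 c = (\sum_(d < m) psize (c d))%N%:Z.
Proof.
move=> m1; have mM : m = m.-1.+1 by lia.
rewrite /weight [in RHS]mM big_ord_recr /=.
have H k : (k <= m.-1)%N -> (\sum_(d < k) psize (c d))%N%:Z =
    (k * psize (c k))%N%:Z + \sum_(e < k) step_weight (row_weight m) 0 e *
      ((psize (c e))%:Z - (psize (c e.+1))%:Z).
  elim: k => [|k IH] kM; first by rewrite !big_ord0.
  rewrite !big_ord_recr /= PoszD IH 1?ltnW // /step_weight /=.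
  rewrite /row_weight divn_small // modn_small // muln0 add0n !PoszM; ring.
have -> : m%:Z * (psize (c m.-1))%:Z = (m.-1 * psize (c m.-1))%N%:Z + (psize (c m.-1))%:Z.
  by rewrite -PoszM -PoszD -[X in (_ + X)%N]mul1n -mulnDl addn1 -mM.
by rewrite PoszD H //; ring.
Qed.

(** The theorem of Han and Xiong, for each coefficient separately: after
    [m.-1 * R] sweeps all row weights exceed [n]. *)
Theorem card_banded_plane_partition m n R : (2 < m)%N -> (n < R)%N ->
  #|` fset_set (banded_plane_partition m n)| = coefs (exps m (2 * R)) n.
Proof.
move=> m2 nR; have m1 : (1 < m)%N by lia.
have M0 : (0 < m.-1)%N by lia.
have [s [us sP ss]] : counts (chainset m m.-1 (row_weight m) 0 n) (coefs (exps m (2 * R)) n).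
  have pe := perm_exps m1 R.
  rewrite -(coefs_perm _ pe); last by rewrite (perm_all _ pe) exps_gt0.
  rewrite /coefs foldr_cat -/(coefs _).
  apply: (@counts_sweeps m m.-1 M0 _ _ n) => // [i|i|i iN].
  - by rewrite row_weight_period.
  - exact: row_weight_gt0.
  - apply: counts_const_chain => //; [by lia| |by lia] => j jM.
    by rewrite row_weightE //; nia.
have /choice[g gP] : forall c, exists f : {fsfun band m -> nat with 0%N},
    c \in s -> diagonals f = c.
  move=> c; have [/sP[cc _]|_] := boolP (c \in s); last by exists [fsfun].
  by have [f fc] := chain_diagonals (ltnW m1) cc; exists f.
have sE : banded_plane_partition m n = [set` [fset f | f in map g s]%fset]%classic.
  apply/seteqP; split=> f /=.
    move=> /(banded_chain f n (ltnW m1))[cf nf]; rewrite !inE.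
    have fs : diagonals f \in s by apply/sP; split=> //; rewrite weight_diagonal_sum // nf.
    by apply/mapP; exists (diagonals f) => //; apply: diagonals_inj; rewrite gP.
  rewrite !inE => /mapP[c cs ->]; apply/(banded_chain _ n (ltnW m1)); rewrite gP //.
  by move/sP: cs => [cc]; rewrite weight_diagonal_sum // => -[].
rewrite sE set_fsetK card_fseq undup_id ?size_map // map_inj_in_uniq // => a b sa sb gab.
by rewrite -(gP a sa) -(gP b sb) gab.
Qed.

(** * The product on a circle, as amplitude and phase *)

Section Wave.
Variable R : realType.
Implicit Types (w phi gamma q theta : R) (h : nat) (hs : seq nat).

(** The squared distance of [1] and [w e^(i phi)]; [amp] and [pha] are modulus
    and argument of [(1 - w) / (1 - w e^(i phi))]. *)
Definition sqdist w phi : R := (1 - w) ^+ 2 + 2 * w * (1 - cos phi).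
Definition amp w phi : R := (1 - w) / Num.sqrt (sqdist w phi).
Definition pha w phi : R := atan (w * sin phi / (1 - w * cos phi)).

Lemma sqdistE w phi : sqdist w phi = (1 - w * cos phi) ^+ 2 + (w * sin phi) ^+ 2.
Proof.
rewrite /sqdist; have := cos2Dsin2 phi.
set c := cos phi; set s := sin phi => cs.
have -> : (w * s) ^+ 2 = w ^+ 2 * (1 - c ^+ 2) by rewrite -cs exprMn; ring.
by ring.
Qed.

Lemma sqdist_ge w phi : 0 <= w -> (1 - w) ^+ 2 <= sqdist w phi.
Proof. by move=> w0; rewrite /sqdist lerDl !mulr_ge0 // subr_ge0 cos_le1. Qed.

Lemma sqdist_gt0 w phi : 0 <= w -> w < 1 -> 0 < sqdist w phi.
Proof. by move=> w0 w1; rewrite (lt_le_trans _ (sqdist_ge phi w0)) // exprn_gt0 // subr_gt0. Qed.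

Lemma onemMcos_gt0 w phi : 0 <= w -> w < 1 -> 0 < 1 - w * cos phi.
Proof. by move=> w0 w1; have := cos_le1 phi; have := cos_geN1 phi; nra. Qed.

Lemma amp_gt0 w phi : 0 <= w -> w < 1 -> 0 < amp w phi.
Proof. by move=> w0 w1; rewrite /amp divr_gt0 ?subr_gt0 // sqrtr_gt0 sqdist_gt0. Qed.

Lemma amp_le1 w phi : 0 <= w -> w < 1 -> amp w phi <= 1.
Proof.
move=> w0 w1; rewrite /amp ler_pdivrMr ?sqrtr_gt0 ?sqdist_gt0 // mul1r.
have e : 1 - w = Num.sqrt ((1 - w) ^+ 2).
  by rewrite sqrtr_sqr ger0_norm // subr_ge0 ltW.
by rewrite [leLHS]e ler_sqrt ?sqdist_ge // ltW // sqdist_gt0.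
Qed.

(** The real part of [(1 - w e^(i phi)) * ((1 - w) / (1 - w e^(i phi))) = 1 - w],
    turned by the angle [gamma]. *)
Lemma amp_pha w phi gamma : 0 <= w -> w < 1 ->
  amp w phi * (cos (pha w phi + gamma) - w * cos (pha w phi + gamma + phi)) =
  (1 - w) * cos gamma.
Proof.
move=> w0 w1; have d0 := sqdist_gt0 phi w0 w1; have c0 := onemMcos_gt0 phi w0 w1.
have dE := sqdistE w phi.
set u := w * sin phi / (1 - w * cos phi).
have cE : cos (pha w phi) = (1 - w * cos phi) / Num.sqrt (sqdist w phi).
  rewrite /pha cos_atan -/u.
  have -> : 1 + u ^+ 2 = sqdist w phi / (1 - w * cos phi) ^+ 2.
    by rewrite dE /u; field; rewrite gt_eqF.
  rewrite sqrtrM ?ltW // sqrtrV ?exprn_ge0 // ?ltW // sqrtr_sqr gtr0_norm //.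
  by rewrite invfM invrK mulrC.
have sE : sin (pha w phi) = w * sin phi / Num.sqrt (sqdist w phi).
  have := atanK u; rewrite /tan -/(pha w phi) => /(congr1 (fun x => x * cos (pha w phi))).
  rewrite divfK; last first.
    by rewrite cE mulf_neq0 ?invr_neq0 // ?gt_eqF // sqrtr_gt0.
  by move=> ->; rewrite cE /u; field; rewrite !gt_eqF // sqrtr_gt0.
rewrite !cosD !sinD cE sE /amp.
have s2 : Num.sqrt (sqdist w phi) ^+ 2 = (1 - w * cos phi) ^+ 2 + (w * sin phi) ^+ 2.
  by rewrite sqr_sqrtr ?ltW.
have s0 : Num.sqrt (sqdist w phi) != 0 by rewrite gt_eqF // sqrtr_gt0.
move: s2 s0; set s := Num.sqrt _ => s2 s0.
have sV : s^-1 * s^-1 * ((1 - w * cos phi) ^+ 2 + (w * sin phi) ^+ 2) = 1.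
  by rewrite -s2; field.
rewrite -[RHS]mulr1 -[X in _ = _ * X]sV; ring.
Qed.

Definition wave_amp q hs theta : R := \prod_(h <- hs) amp (q ^+ h) (h%:R * theta).
Definition wave_pha q hs theta : R := \sum_(h <- hs) pha (q ^+ h) (h%:R * theta).

(** The real part of the normalised product at [q e^(i theta)], divided by
    [e^(i n theta)]. *)
Definition wave q hs (n : int) theta : R :=
  wave_amp q hs theta * cos (wave_pha q hs theta - n%:~R * theta).

Section Radius.
Variable q : R.
Hypotheses (q0 : 0 < q) (q1 : q < 1).

Lemma qX_ge0 h : 0 <= q ^+ h. Proof. by rewrite exprn_ge0 // ltW. Qed.
Lemma qX_lt1 h : (0 < h)%N -> q ^+ h < 1.
Proof. by move=> h0; rewrite exprn_ilt1 // ?ltW // -lt0n. Qed.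

Lemma wave_cons h hs n theta : (0 < h)%N ->
  wave q (h :: hs) n theta - q ^+ h * wave q (h :: hs) (n - h%:Z) theta =
  (1 - q ^+ h) * wave q hs n theta.
Proof.
move=> h0; rewrite /wave /wave_amp /wave_pha !big_cons.
have := amp_pha (h%:R * theta) (wave_pha q hs theta - n%:~R * theta)
  (qX_ge0 h) (qX_lt1 h0).
rewrite /wave_pha => E; rewrite [RHS]mulrCA -E.
have -> : forall a b : R, a + b - (n - h%:Z)%:~R * theta =
  a + (b - n%:~R * theta) + h%:R * theta by move=> a b; rewrite intrB; ring.
by rewrite -addrA; ring.
Qed.

Lemma wave_amp_le1 hs theta : all (fun h => 0 < h)%N hs -> 0 <= wave_amp q hs theta <= 1.
Proof.
rewrite /wave_amp; elim: hs => [|h hs IH] /=; first by rewrite big_nil ler01 lexx.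
move=> /andP[h0 /IH/andP[a0 a1]]; rewrite big_cons.
have b0 := amp_gt0 (h%:R * theta) (qX_ge0 h) (qX_lt1 h0).
have b1 := amp_le1 (h%:R * theta) (qX_ge0 h) (qX_lt1 h0).
by rewrite mulr_ge0 ?(ltW b0) //= mulr_ile1 // ltW.
Qed.

Lemma continuous_amp h : (0 < h)%N -> continuous (fun t : R => amp (q ^+ h) (h%:R * t)).
Proof.
move=> h0 t; apply: cvgM; first exact: cvg_cst.
apply: cvgV; first by rewrite gt_eqF // sqrtr_gt0 sqdist_gt0 ?qX_ge0 ?qX_lt1.
apply: (cvg_comp (fun t => sqdist (q ^+ h) (h%:R * t)) (@Num.sqrt R)); last exact: sqrt_continuous.
apply: cvgD; first exact: cvg_cst.
apply: cvgM; first exact: cvg_cst.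
apply: cvgB; first exact: cvg_cst.
apply: (cvg_comp (fun t => h%:R * t) (@cos R)); last exact: continuous_cos.
by apply: cvgM; [exact: cvg_cst | exact: cvg_id].
Qed.

Lemma continuous_pha h : (0 < h)%N -> continuous (fun t : R => pha (q ^+ h) (h%:R * t)).
Proof.
move=> h0 t.
apply: (cvg_comp (fun t => q ^+ h * sin (h%:R * t) / (1 - q ^+ h * cos (h%:R * t)))
  (@atan R)); last exact: continuous_atan.
have lin : (fun t : R => h%:R * t) x @[x --> t] --> h%:R * t.
  by apply: cvgM; [exact: cvg_cst | exact: cvg_id].
apply: cvgM.
  apply: cvgM; first exact: cvg_cst.
  by apply: (cvg_comp _ (@sin R) lin); exact: continuous_sin.
apply: cvgV; first by rewrite gt_eqF // onemMcos_gt0 ?qX_ge0 ?qX_lt1.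
apply: cvgB; first exact: cvg_cst.
apply: cvgM; first exact: cvg_cst.
by apply: (cvg_comp _ (@cos R) lin); exact: continuous_cos.
Qed.

Lemma continuous_wave hs n : all (fun h => 0 < h)%N hs -> continuous (wave q hs n).
Proof.
move=> hs0 t; apply: cvgM.
  rewrite /wave_amp; elim: hs hs0 => [_|h hs IH /= /andP[h0 hs0]].
    by under eq_fun do rewrite big_nil; rewrite big_nil; exact: cvg_cst.
  under eq_fun do rewrite big_cons; rewrite big_cons.
  by apply: cvgM; [exact: continuous_amp | exact: IH].
apply: (cvg_comp (fun t => wave_pha q hs t - n%:~R * t) (@cos R)); last exact: continuous_cos.
apply: cvgB; last by apply: cvgM; [exact: cvg_cst | exact: cvg_id].
rewrite /wave_pha; elim: hs hs0 => [_|h hs IH /= /andP[h0 hs0]].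
  by under eq_fun do rewrite big_nil; rewrite big_nil; exact: cvg_cst.
under eq_fun do rewrite big_cons; rewrite big_cons.
by apply: cvgD; [exact: continuous_pha | exact: IH].
Qed.

End Radius.
End Wave.

(** * Fourier inversion *)

Section WaveIntegral.
Variable R : realType.
Local Notation mu := (@lebesgue_measure R).
Implicit Types (q : R) (h : nat) (hs : seq nat).

Definition circ (f : R -> R) : R := \int[mu]_(x in `[- pi, pi]) f x.

Lemma integrable_circ (f : R -> R) : continuous f ->
  mu.-integrable `[- pi, pi] (EFin \o f).
Proof.
move=> cf; apply: continuous_compact_integrable; first exact: segment_compact.
exact: continuous_subspaceT.
Qed.

Lemma circ_cst (c : R) : circ (fun=> c) = 2 * pi * c.
Proof.
have p0 := pi_gt0 R.
have E : mu `[- pi, pi] = (2 * pi : R)%:E.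
  have := lebesgue_measure_itv (`[- pi, pi] : interval R).
  by rewrite /= lte_fin ifT => [->|]; [congr (_%:E) | ]; lra.
by rewrite /circ Rintegral_cst // [RHS]mulrC; congr (_ * _); apply: (congr1 fine E).
Qed.

Lemma circ_cos (n : int) : circ (fun x => cos (- (n%:~R * x))) = if n == 0 then 2 * pi else 0.
Proof.
have p0 := pi_gt0 R.
case: eqP => [-> |/eqP n0].
  under [X in circ X]eq_fun do rewrite mul0r oppr0 cos0.
  by rewrite circ_cst mulr1.
have sk (k : nat) : sin (k%:R * pi) = 0 :> R.
  by elim: k => [|k IH]; rewrite ?mul0r ?sin0 // -natr1 mulrDl mul1r sinDpi IH oppr0.
have sn : sin (n%:~R * pi) = 0 :> R.
  by case: n {n0} => k; rewrite ?NegzE ?mulrNz ?mulNr ?sinN -pmulrn sk ?oppr0.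
have nR0 : n%:~R != 0 :> R by rewrite intr_eq0.
have isd (x : R) : is_derive x (1 : R) (fun x => - ((n%:~R)^-1 * sin (- (n%:~R * x)))) (cos (- (n%:~R * x))).
  apply: is_derive_eq; rewrite /GRing.scale /=. by field.
have lin (x : R) : - (n%:~R * t) @[t --> x] --> - (n%:~R * x).
  by apply: cvgN; apply: cvgM; [exact: cvg_cst | exact: cvg_id].
have cF : continuous (fun x : R => - ((n%:~R)^-1 * sin (- (n%:~R * x)))).
  move=> x; apply: cvgN; apply: cvgM; first exact: cvg_cst.
  by apply: (cvg_comp _ (@sin R) (lin x)); exact: continuous_sin.
rewrite /circ /Rintegral (@continuous_FTC2 _ _ (fun x => - ((n%:~R)^-1 * sin (- (n%:~R * x))))).
- by rewrite /= !(mulrN, opprK, sinN) sn !(oppr0, mulr0, addr0).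
- by lra.
- apply: continuous_subspaceT => x.
  by apply: (cvg_comp _ (@cos R) (lin x)); exact: continuous_cos.
- split.
  + by move=> x _; apply: ex_derive.
  + by apply: cvg_at_right_filter; exact: cF.
  + by apply: cvg_at_left_filter; exact: cF.
- by move=> x _; rewrite derive1E derive_val.
Qed.

(** Iterating the recursion of [circ_wave_cons] at negative frequencies only
    gains powers of [w], which forces the integral to vanish. *)
Lemma le_geometric0 (a b w : R) : 0 <= w -> w < 1 ->
  (forall j, a <= b * w ^+ j) -> a <= 0.
Proof.
move=> w0 w1 H.
have c0 : b * w ^+ j @[j --> \oo] --> b * 0.
  by apply: cvgM; [exact: cvg_cst | apply: cvg_expr; rewrite ger0_norm].
rewrite mulr0 in c0; apply: (ler_cvg_to (cvg_cst a) c0).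
by apply: nearW => j; exact: H.
Qed.

Section Radius.
Variable q : R.
Hypotheses (q0 : 0 < q) (q1 : q < 1).

Lemma circ_wave_le hs n : all (fun h => 0 < h)%N hs -> `|circ (wave q hs n)| <= 2 * pi.
Proof.
move=> hs0; have cw := continuous_wave (n := n) q0 q1 hs0.
apply: (le_trans (le_normr_Rintegral _ (integrable_circ cw))) => //.
rewrite -[leRHS]mulr1 -circ_cst; apply: le_Rintegral => //.
- apply: (@integrable_circ (fun t => `|wave q hs n t|)) => t.
  by apply: (cvg_comp _ _ (cw t)); exact: norm_continuous.
- by apply: (@integrable_circ (fun=> 1)) => t; exact: cvg_cst.
- move=> t _; rewrite /wave normrM; have /andP[a0 a1] := wave_amp_le1 q0 q1 t hs0.
  by rewrite (ger0_norm a0) mulr_ile1 // ler_norml cos_geN1 cos_le1.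
Qed.

Lemma circ_wave_cons h hs n : (0 < h)%N -> all (fun h => 0 < h)%N hs ->
  circ (wave q (h :: hs) n) = q ^+ h * circ (wave q (h :: hs) (n - h%:Z)) +
    (1 - q ^+ h) * circ (wave q hs n).
Proof.
move=> h0 hs0; have hhs0 : all (fun h => 0 < h)%N (h :: hs) by rewrite /= h0.
have i1 := integrable_circ (continuous_wave (n := n) q0 q1 hhs0).
have i2 := integrable_circ (continuous_wave (n := n - h%:Z) q0 q1 hhs0).
have i3 := integrable_circ (continuous_wave (n := n) q0 q1 hs0).
rewrite /circ -!RintegralZl // -RintegralD //; first last.
- by apply: (@integrable_circ (fun t => (1 - q ^+ h) * wave q hs n t)) => t;
    apply: cvgM; [exact: cvg_cst | exact: continuous_wave].
- by apply: (@integrable_circ (fun t => q ^+ h * wave q (h :: hs) (n - h%:Z) t)) => t;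
    apply: cvgM; [exact: cvg_cst | exact: continuous_wave].
by apply: eq_Rintegral => t _; rewrite -wave_cons //; ring.
Qed.

(** Both sides satisfy the recursion of [geomulE] in the list of exponents; the
    vanishing at negative frequencies makes its solution unique. *)
Lemma circ_wave hs (n : int) : all (fun h => 0 < h)%N hs ->
  circ (wave q hs n) = if n is Posz k then
    2 * pi * (coefs hs k)%:R * q ^+ k * \prod_(h <- hs) (1 - q ^+ h) else 0.
Proof.
elim: hs n => [|h hs IH] n /= hs0.
  rewrite (_ : wave q [::] n = fun x => cos (- (n%:~R * x))); last first.
    by apply/funext => t; rewrite /wave /wave_amp /wave_pha !big_nil mul1r sub0r.
  rewrite circ_cos; case: n => [[|k]|k] //=; rewrite big_nil ?expr0 ?mulr1 //.
  by rewrite mulr0 mul0r.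
have /andP[h0 hs0'] := hs0.
have w0 : 0 <= q ^+ h by rewrite qX_ge0.
have w1 : q ^+ h < 1 by rewrite qX_lt1.
have neg (k : int) : k < 0 -> circ (wave q (h :: hs) k) = 0.
  move=> k0; apply/eqP; rewrite -normr_le0; apply: (@le_geometric0 _ (2 * pi) (q ^+ h)) => // j.
  elim: j k k0 => [|j IHj] k k0; first by rewrite mulr1; exact: circ_wave_le.
  rewrite circ_wave_cons // IH //; case: k k0 => // k k0; rewrite mulr0 addr0.
  rewrite normrM (ger0_norm w0) exprS mulrCA ler_wpM2l //; apply: IHj; lia.
case: n => [k|k]; last exact: neg.
(* For a fixed list, induction on the frequency, which drops by [h]. *)
elim/ltn_ind: k => k IHk.
rewrite circ_wave_cons // IH // big_cons geomulE //.
case: leqP => hk; last by rewrite neg ?addn0; [ring | lia].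
rewrite subzn // IHk; last by lia.
have -> : q ^+ k = q ^+ (k - h) * q ^+ h by rewrite -exprD subnK.
by rewrite ?big_cons natrD; ring.
Qed.

End Radius.
End WaveIntegral.

(** * Taylor bounds for amplitude and phase *)

Section TaylorBounds.
Variable R : realType.
Implicit Types (x w phi : R).

Lemma ge0_of_derive (f df : R -> R) : f 0 = 0 ->
  (forall x, 0 <= x -> is_derive x (1 : R) f (df x)) -> (forall x, 0 <= x -> 0 <= df x) ->
  forall x, 0 <= x -> 0 <= f x.
Proof.
move=> f0 fd d0 x x0.
have [|y yx| c + E] := @MVT_segment R f df 0 x x0.
- by move=> y; rewrite in_itv /= => /andP[/ltW y0 _]; exact: fd.
- apply: derivable_within_continuous => z; rewrite in_itv /= => /andP[z0 _].
  by have fz := fd z z0; apply: ex_derive.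
rewrite in_itv /= => /andP[c0 _]; move: E; rewrite f0 !subr0 => ->.
by rewrite mulr_ge0 // d0.
Qed.

Lemma sin_le_id x : 0 <= x -> sin x <= x.
Proof.
move=> x0; rewrite -subr_ge0.
apply: (@ge0_of_derive (fun x => x - sin x) (fun x => 1 - cos x)) x0.
- by rewrite sin0 subrr.
- by move=> y _; rewrite subr_ge0 cos_le1.
Qed.

Lemma cos_ge2 x : 0 <= x -> 1 - x ^+ 2 / 2 <= cos x.
Proof.
move=> x0; rewrite -subr_ge0.
apply: (@ge0_of_derive (fun x => cos x - (1 - x ^+ 2 / 2)) (fun x => x - sin x)) x0.
- by rewrite cos0; ring.
- by move=> y _ /=; apply: is_derive_eq; rewrite /GRing.scale /=; field.
- by move=> y y0; rewrite subr_ge0 sin_le_id.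
Qed.

Lemma sin_ge3 x : 0 <= x -> x - x ^+ 3 / 6 <= sin x.
Proof.
move=> x0; rewrite -subr_ge0.
apply: (@ge0_of_derive (fun x => sin x - (x - x ^+ 3 / 6)) (fun x => cos x - (1 - x ^+ 2 / 2))) x0.
- by rewrite sin0; ring.
- by move=> y _ /=; apply: is_derive_eq; rewrite /GRing.scale /=; field.
- by move=> y y0; rewrite subr_ge0 cos_ge2.
Qed.

Lemma cos_le4 x : 0 <= x -> cos x <= 1 - x ^+ 2 / 2 + x ^+ 4 / 24.
Proof.
move=> x0; rewrite -subr_ge0.
apply: (@ge0_of_derive (fun x => 1 - x ^+ 2 / 2 + x ^+ 4 / 24 - cos x)
  (fun x => sin x - (x - x ^+ 3 / 6))) x0.
- by rewrite cos0; ring.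
- by move=> y _ /=; apply: is_derive_eq; rewrite /GRing.scale /=; field.
- by move=> y y0; rewrite subr_ge0 sin_ge3.
Qed.

Lemma atan_bound x : 0 <= x -> x - x ^+ 3 / 3 <= atan x <= x.
Proof.
move=> x0; apply/andP; split; rewrite -subr_ge0.
  apply: (@ge0_of_derive (fun x => atan x - (x - x ^+ 3 / 3))
    (fun x => (1 + x ^+ 2)^-1 - (1 - x ^+ 2))) x0.
  - by rewrite atan0; ring.
  - move=> y _ /=; have h : 1 + y ^+ 2 != 0 by rewrite gt_eqF // ltr_pwDl // sqr_ge0.
    by apply: is_derive_eq; rewrite /GRing.scale /=; field.
  - move=> y _; have h : 0 < 1 + y ^+ 2 by rewrite ltr_pwDl // sqr_ge0.
    have -> : (1 + y ^+ 2)^-1 - (1 - y ^+ 2) = y ^+ 4 / (1 + y ^+ 2) by field; rewrite gt_eqF.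
    by rewrite divr_ge0 ?exprn_even_ge0 // ltW.
apply: (@ge0_of_derive (fun x => x - atan x) (fun x => 1 - (1 + x ^+ 2)^-1)) x0.
- by rewrite atan0; ring.
- by move=> y _; rewrite subr_ge0 invf_le1 ?lerDl ?ltr_pwDl ?sqr_ge0.
Qed.

Lemma ln1D_bound x : 0 <= x -> x - x ^+ 2 / 2 <= ln (1 + x) <= x.
Proof.
move=> x0; rewrite le_ln1Dx ?andbT; last by lra.
rewrite -subr_ge0; apply: (@ge0_of_derive (fun x => ln (1 + x) - (x - x ^+ 2 / 2))
    (fun x => (1 + x)^-1 - (1 - x))) x0.
- by rewrite addr0 ln1; ring.
- move=> y y0; have h : 0 < 1 + y by lra.
  have h1 : is_derive y (1 : R) (fun x : R => 1 + x) 1 by apply: is_derive_eq; rewrite add0r mulr1.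
  have hc : is_derive y (1 : R) (fun x : R => ln (1 + x)) ((1 + y)^-1 * 1).
    by apply: (is_derive1_comp _ h1); exact: is_derive1_ln.
  by apply: is_derive_eq; rewrite /GRing.scale /=; field; rewrite gt_eqF.
- move=> y y0; have h : 0 < 1 + y by lra.
  have -> : (1 + y)^-1 - (1 - y) = y ^+ 2 / (1 + y) by field; rewrite gt_eqF.
  by rewrite divr_ge0 ?exprn_ge0 // ltW.
Qed.

Definition damp w phi : R := ln (1 + 2 * w * (1 - cos phi) / (1 - w) ^+ 2) / 2.

Lemma amp_damp w phi : 0 <= w -> w < 1 -> amp w phi = expR (- damp w phi).
Proof.
move=> w0 w1; have w1' : 0 < 1 - w by rewrite subr_gt0.
have d0 := sqdist_gt0 phi w0 w1.
have -> : damp w phi = ln (Num.sqrt (sqdist w phi) / (1 - w)).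
  rewrite /damp; have -> : 1 + 2 * w * (1 - cos phi) / (1 - w) ^+ 2 =
      (Num.sqrt (sqdist w phi) / (1 - w)) ^+ 2.
    by rewrite exprMn sqr_sqrtr ?ltW // /sqdist; field; rewrite gt_eqF.
  by rewrite lnXn ?divr_gt0 ?sqrtr_gt0 //; field.
by rewrite expRN lnK ?posrE ?divr_gt0 ?sqrtr_gt0 // invf_div.
Qed.

Lemma cos_bounds phi : phi ^+ 2 / 2 - phi ^+ 4 / 24 <= 1 - cos phi <= phi ^+ 2 / 2.
Proof.
wlog p0 : phi / 0 <= phi => [H|].
  have [|/ltW n0] := leP 0 phi; first exact: H.
  have -> : phi ^+ 2 = (- phi) ^+ 2 by rewrite sqrrN.
  have -> : phi ^+ 4 = (- phi) ^+ 4 by ring.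
  by rewrite -cosN; apply: H; rewrite oppr_ge0.
by have := cos_ge2 p0; have := cos_le4 p0; lra.
Qed.

(** Both estimates are Taylor expansions of [- ln (1 - w e^(i phi))] at
    [phi = 0], with remainders valid for every real [phi]. *)
Lemma damp_bound w phi : 0 <= w -> w < 1 ->
  `|damp w phi - w * phi ^+ 2 / (1 - w) ^+ 2 / 2| <= w * phi ^+ 4 / (1 - w) ^+ 4.
Proof.
move=> w0 w1; have w1' : 0 < 1 - w by rewrite subr_gt0.
have /andP[c1 c2] := cos_bounds phi.
have [v v0 vE] : exists2 v, 1 <= v & v = (1 - w)^-1.
  by exists (1 - w)^-1 => //; rewrite invf_ge1 //; lra.
have u0 : 0 <= 1 - cos phi by rewrite subr_ge0 cos_le1.
rewrite /damp -!exprVn -vE; set u := 1 - cos phi in c1 c2 u0 *.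
have p2 : 0 <= phi ^+ 2 by rewrite sqr_ge0.
have p4 : phi ^+ 4 = phi ^+ 2 * phi ^+ 2 by rewrite -exprD.
have v4 : v ^+ 4 = v ^+ 2 * v ^+ 2 by rewrite -exprD.
have v2 : 1 <= v ^+ 2 by rewrite exprn_ege1.
move: c1 c2; rewrite p4 v4; move: (phi ^+ 2) (v ^+ 2) p2 v2 => p V p2 v2 c1 c2.
have s0 : 0 <= 2 * w * u * V by rewrite !mulr_ge0 //; lra.
have /andP[l1 l2] := ln1D_bound s0.
move: l1 l2; set L := ln _ => l1 l2.
have a1 : w * V * u <= w * V * (p / 2) by rewrite ler_wpM2l // mulr_ge0 //; lra.
have a2 : w * V * (p / 2 - p * p / 24) <= w * V * u by rewrite ler_wpM2l // mulr_ge0 //; lra.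
have pp : 0 <= p * p by rewrite mulr_ge0.
have a3 : (2 * w * u * V) ^+ 2 <= (w * V * p) ^+ 2.
  by rewrite lerXn2r ?nnegrE //; [rewrite !mulr_ge0 //; lra | lra].
have a4 : (w * V * p) ^+ 2 <= w * (p * p) * (V * V).
  have -> : (w * V * p) ^+ 2 = w * (w * (p * p) * (V * V)) by ring.
  by rewrite ler_piMl ?(ltW w1) // !mulr_ge0 //; lra.
have a5 : w * V * (p * p) <= w * (p * p) * (V * V).
  have -> : w * (p * p) * (V * V) = w * V * (p * p) * V by ring.
  by rewrite ler_peMr // !mulr_ge0 //; lra.
by rewrite ler_norml; apply/andP; split; nra.
Qed.

Lemma pha_bound w phi : 0 <= w -> w < 1 ->
  `|pha w phi - w * phi / (1 - w)| <= w * `|phi| ^+ 3 / (1 - w) ^+ 3.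
Proof.
move=> w0 w1; have w1' : 0 < 1 - w by rewrite subr_gt0.
wlog p0 : phi / 0 <= phi => [H|].
  have [|/ltW n0] := leP 0 phi; first exact: H.
  have := H (- phi); rewrite oppr_ge0 normrN => /(_ n0); rewrite /pha sinN cosN.
  by rewrite !(mulrN, mulNr) atanN -opprD normrN.
rewrite (ger0_norm p0).
have /andP[c1 c2] := cos_bounds phi; have s1 := sin_le_id p0; have s2 := sin_ge3 p0.
have u0 : 0 <= 1 - cos phi by rewrite subr_ge0 cos_le1.
have d0 := onemMcos_gt0 phi w0 w1.
have dV : (1 - w * cos phi)^-1 <= (1 - w)^-1.
  by rewrite lef_pV2 ?posrE //; have := cos_le1 phi; nra.
have Vw : (1 - w) * (1 - w)^-1 = 1 by rewrite divff // gt_eqF.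
have dD : (1 - w * cos phi) * (1 - w * cos phi)^-1 = 1 by rewrite divff // gt_eqF.
have d1 : 0 < (1 - w * cos phi)^-1 by rewrite invr_gt0.
have V1 : 1 <= (1 - w)^-1 by rewrite invf_ge1 //; lra.
rewrite /pha -exprVn; set v := w * sin phi / (1 - w * cos phi).
have [d dE] : exists d, d = (1 - w * cos phi)^-1 by eexists.
have [V VE] : exists V, V = (1 - w)^-1 by eexists.
rewrite -!VE in dV Vw V1 *; rewrite -!dE in dV dD d1.
have vE : v = w * sin phi * d by rewrite dE.
have p3 : 0 <= phi ^+ 3 by rewrite exprn_ge0.
have u1 : 0 <= phi * (1 - cos phi) <= phi ^+ 3 / 2.
  rewrite mulr_ge0 //= (_ : phi ^+ 3 / 2 = phi * (phi ^+ 2 / 2)); last by ring.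
  by rewrite ler_wpM2l.
have sl : `|sin phi| <= phi.
  rewrite ler_norml s1 andbT -subr_ge0 opprK.
  apply: (@ge0_of_derive (fun x => sin x + x) (fun x => cos x + 1)) p0.
  - by rewrite sin0 addr0.
  - by move=> y _; rewrite -[1]opprK subr_ge0 cos_geN1.
have vb : `|v| <= w * phi * V.
  rewrite vE !normrM (ger0_norm w0) (gtr0_norm d1).
  by apply: ler_pM => //; [rewrite mulr_ge0 | exact: ltW | rewrite ler_wpM2l].
have at1 : `|atan v - v| <= `|v| ^+ 3 / 3.
  have [v0|v0] := leP 0 v.
    by have := atan_bound v0; rewrite (ger0_norm v0) ler_norml => /andP[]; have := exprn_ge0 3 v0; lra.
  have nv : 0 <= - v by lra.
  have := atan_bound nv; rewrite atanN (ltr0_norm v0) ler_norml => /andP[].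
  by have := exprn_ge0 3 nv; lra.
have at2 : `|v| ^+ 3 <= w * phi ^+ 3 * V ^+ 3.
  have : `|v| ^+ 3 <= (w * phi * V) ^+ 3 by rewrite lerXn2r ?nnegrE // !mulr_ge0 //; lra.
  move=> /le_trans; apply; rewrite !exprMn ler_wpM2r ?exprn_ge0 //; first lra.
  by rewrite ler_wpM2r // exprS ler_piMr // exprn_ile1 // ltW.
have at3 : `|v - w * phi * V| <= w * phi ^+ 3 * V ^+ 3 * (2 / 3).
  have -> : v - w * phi * V =
      - (w * (d * V) * ((phi - sin phi) * (1 - w) + w * (phi * (1 - cos phi)))).
    rewrite vE; transitivity (w * sin phi * d * ((1 - w) * V) -
      w * phi * V * ((1 - w * cos phi) * d)); last by ring.
    by rewrite Vw dD !mulr1.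
  rewrite normrN.
  have V0 : 0 <= V by lra.
  have B1 : 0 <= (phi - sin phi) * (1 - w) + w * (phi * (1 - cos phi)).
    by case/andP: u1 => u1 _; rewrite addr_ge0 // mulr_ge0 //; lra.
  have B2 : (phi - sin phi) * (1 - w) + w * (phi * (1 - cos phi)) <= phi ^+ 3 * (2 / 3).
    have : (phi - sin phi) * (1 - w) <= (phi ^+ 3 / 6) * 1.
      by apply: ler_pM; lra.
    have : w * (phi * (1 - cos phi)) <= 1 * (phi ^+ 3 / 2).
      by case/andP: u1 => u1 u2; apply: ler_pM; lra.
    lra.
  rewrite ger0_norm; last by rewrite !mulr_ge0 // ltW.
  have -> : w * phi ^+ 3 * V ^+ 3 * (2 / 3) = w * V ^+ 3 * (phi ^+ 3 * (2 / 3)) by ring.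
  apply: ler_pM => //; first by rewrite !mulr_ge0 // ltW.
  rewrite ler_wpM2l // exprS expr2; apply: ler_pM => //; first exact: ltW.
  by rewrite ler_peMr.
have -> : atan v - w * phi * V = (atan v - v) + (v - w * phi * V) by ring.
by apply: (le_trans (ler_normD _ _)); lra.
Qed.

End TaylorBounds.

(** * Exponential sums over the exponents *)

Section Moments.
Variable R : realType.
Implicit Types (x q r rho : R) (m K N : nat) (hs : seq nat).

Lemma sum_nat_le (F : nat -> R) (a b c d : nat) : (forall i, 0 <= F i) ->
  (a <= b)%N -> (c <= d)%N -> \sum_(b <= i < c) F i <= \sum_(a <= i < d) F i.
Proof.
move=> F0 ab cd; have [bc|cb] := leqP b c; last by rewrite big_geq ?sumr_ge0 // ltnW.
rewrite (big_cat_nat ab (leq_trans bc cd)) /=.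
rewrite [X in _ + X](big_cat_nat bc cd) /= addrCA.
by rewrite lerDl addr_ge0 // sumr_ge0.
Qed.

(** The first two elementary symmetric polynomials of [q, q ^ 2, ..., q ^ m.-1]. *)
Definition geo_sum m q : R := \sum_(1 <= j < m) q ^+ j.
Definition geo_pairs m q : R := \sum_(1 <= j < m) \sum_(1 <= h < j) q ^+ (h + j).

Lemma geo_sum_ge0 m q : 0 <= q -> 0 <= geo_sum m q.
Proof. by move=> q0; apply: sumr_ge0 => j _; exact: exprn_ge0. Qed.

Lemma geo_pairs_ge0 m q : 0 <= q -> 0 <= geo_pairs m q.
Proof. by move=> q0; apply: sumr_ge0 => j _; apply: sumr_ge0 => h _; exact: exprn_ge0. Qed.

Lemma geo_sum_sqr m q : geo_sum m q ^+ 2 = 2 * geo_pairs m q + \sum_(1 <= j < m) q ^+ j ^+ 2.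
Proof.
rewrite /geo_sum /geo_pairs; elim: m => [|[|m] IH]; [by rewrite !big_geq //; ring..|].
rewrite !(big_nat_recr m.+1) //= sqrrD IH.
under [X in _ = 2 * (_ + X) + _]eq_bigr do rewrite exprD.
by rewrite -mulr_suml; ring.
Qed.

Lemma geo_sum_sqrt m r : 0 <= r -> r <= 1 -> geo_sum m r <= 1 + 2 * geo_sum m (r ^+ 2).
Proof.
move=> r0 r1; case: m => [|m]; first by rewrite /geo_sum !big_geq //; lra.
apply: (@le_trans _ _ (\sum_(1 <= j < 2 * m.+1) r ^+ j)).
  by apply: sum_nat_le => // [j|]; [exact: exprn_ge0 | lia].
elim: m => [|m IH]; first by rewrite /geo_sum big_nat1 expr1 big_geq //; lra.
have -> : (2 * m.+2 = (2 * m.+1).+2)%N by lia.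
rewrite big_nat_recr //= big_nat_recr //= /geo_sum [in leRHS]big_nat_recr //= -exprM.
have : r ^+ (2 * m.+1).+1 <= r ^+ (2 * m.+1) by rewrite ler_wiXn2l.
move: IH; rewrite /geo_sum; lra.
Qed.

Lemma geo_pairs_sqrt m r : 0 <= r -> r <= 1 -> geo_pairs m r <= 2^-1 + 4 * geo_sum m (r ^+ 2) + 4 * geo_pairs m (r ^+ 2).
Proof.
move=> r0 r1; have r2 : 0 <= r ^+ 2 by rewrite exprn_ge0.
have h1 := geo_sum_sqrt m r0 r1; have h2 := geo_sum_sqr m r; have h3 := geo_sum_sqr m (r ^+ 2).
have s0 : 0 <= \sum_(1 <= j < m) r ^+ j ^+ 2 by apply: sumr_ge0 => j _; rewrite sqr_ge0.
have s1 : \sum_(1 <= j < m) r ^+ 2 ^+ j ^+ 2 <= geo_sum m (r ^+ 2).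
  apply: ler_sum => j _; rewrite expr2 ler_piMr ?exprn_ge0 //.
  by rewrite exprn_ile1 // exprn_ile1.
have a0 := geo_sum_ge0 m r0; have b0 := geo_sum_ge0 m r2.
have h4 : geo_sum m r ^+ 2 <= (1 + 2 * geo_sum m (r ^+ 2)) ^+ 2 by rewrite lerXn2r ?nnegrE //; lra.
by move: h4; rewrite sqrrD; nra.
Qed.

Definition expsum q hs : R := \sum_(h <- hs) q ^+ h.

Lemma expsum_exps m K q : expsum q (exps m K) =
  \sum_(1 <= e < (m * K).+1) q ^+ e + (\sum_(0 <= k < K) q ^+ (2 * m * k)) * geo_pairs m q.
Proof.
rewrite /expsum /exps big_cat big_pair_exps /=; congr (_ + _).
rewrite mulr_suml; apply: eq_bigr => k _; rewrite /geo_pairs mulr_sumr; apply: eq_bigr => j _.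
by rewrite mulr_sumr; apply: eq_bigr => h _; rewrite -exprD addnA.
Qed.

(** With [q = r ^ 2], grouping [r ^ (2 * i).-1] with [r ^ (2 * i)] bounds the
    geometric sums in [r] by twice those in [q]; as [geo_pairs] is half the square
    of [geo_sum] up to the diagonal ([geo_sum_sqr]), it at most quadruples, up to
    smaller terms.  So halving the saddle point changes the exponential sum
    only by a constant factor that does not depend on [m]. *)
Lemma expsum_double m N r : (0 < m)%N -> (0 < N)%N -> 2^-1 <= r -> r <= 1 ->
  expsum r (exps m (2 * N)) <= 16 * expsum (r ^+ 2) (exps m (2 * N)).
Proof.
move=> m0 N0 rh r1; have r0 : 0 <= r by lra.
set q := r ^+ 2; have q0 : 0 <= q by rewrite exprn_ge0.
have q1 : q <= 1 by rewrite exprn_ile1.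
have qh : 4^-1 <= q by rewrite /q; nra.
have qX e : 0 <= q ^+ e by exact: exprn_ge0.
rewrite !expsum_exps mulnA (mulnC m 2).
set s1 := \sum_(1 <= e < (2 * m * N).+1) q ^+ e.
set T := \sum_(0 <= k < 2 * N) q ^+ _.
pose T' := \sum_(0 <= k < N) q ^+ (2 * m * k).
have TT : T' <= T by apply: sum_nat_le => //; lia.
have s1q : q <= s1.
  by rewrite /s1 big_ltn ?expr1 ?lerDl ?sumr_ge0 //; lia.
have single : \sum_(1 <= e < (2 * m * N).+1) r ^+ e <= 3 * s1.
  apply: (@le_trans _ _ (3 * \sum_(1 <= e < (m * N).+1) q ^+ e)); last first.
    by rewrite ler_pM2l //; apply: sum_nat_le => //; lia.
  rewrite -mulnA; elim: (m * N)%N => [|n IH]; first by rewrite !big_geq // mulr0.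
  have -> : (2 * n.+1 = (2 * n).+2)%N by lia.
  rewrite big_nat_recr //= big_nat_recr //= [in leRHS]big_nat_recr //= mulrDr.
  have -> : q ^+ n.+1 = r ^+ (2 * n).+2 by rewrite /q -exprM; congr (_ ^+ _); lia.
  have : r ^+ (2 * n).+1 <= 2 * r ^+ (2 * n).+2.
    by rewrite (exprS r (2 * n).+1) mulrA ler_peMl ?exprn_ge0 //; lra.
  by lra.
have tsum : \sum_(0 <= k < 2 * N) r ^+ (2 * m * k) <= 2 * T'.
  rewrite /T'; elim: N {N0 s1 T T' TT s1q single} => [|n IH].
    by rewrite muln0 !big_geq // mulr0.
  have -> : (2 * n.+1 = (2 * n).+2)%N by lia.
  rewrite !big_nat_recr //= mulrDr.
  have -> : q ^+ (2 * m * n) = r ^+ (2 * m * (2 * n)) by rewrite /q -exprM; congr (_ ^+ _); lia.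
  have : r ^+ (2 * m * (2 * n).+1) <= r ^+ (2 * m * (2 * n)) by rewrite ler_wiXn2l //; lia.
  by lra.
have T'1 : T' <= 1 + s1.
  apply: (@le_trans _ _ (1 + \sum_(1 <= e < (2 * m * N.-1).+1) q ^+ e)); last first.
    by rewrite lerD2l; apply: sum_nat_le => //; rewrite ltnS leq_mul2l leq_pred orbT.
  rewrite /T' -[in X in X <= _](prednK N0); elim: (N.-1) => [|n IH].
    by rewrite big_nat1 muln0 expr0 big_geq // addr0.
  rewrite big_nat_recr //= [in leRHS](big_cat_nat _ (n := (2 * m * n).+1)) //=; last by nia.
  rewrite [leRHS]addrA lerD //.
  rewrite (_ : (2 * m * n.+1) = (2 * m * n + (2 * m).-1).+1)%N; last by nia.
  rewrite big_nat_recr /=; last by lia.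
  by rewrite lerDr sumr_ge0.
have T'p : T' * geo_sum m q <= s1.
  rewrite /T' /s1 mulr_suml; elim: N {N0 s1 T T' TT s1q single tsum T'1} => [|n IH].
    by rewrite muln0 !big_geq.
  rewrite big_nat_recr //= [leRHS](big_cat_nat _ (n := (2 * m * n).+1)) //=; last by nia.
  rewrite lerD // /geo_sum mulr_sumr.
  rewrite -[(2 * m * n).+1]add1n [leRHS]big_addn.
  apply: (@le_trans _ _ (\sum_(1 <= i < m) q ^+ (i + 2 * m * n))).
    by apply: ler_sum => i _; rewrite -exprD addnC.
  by apply: sum_nat_le => //; nia.
have E2 := geo_pairs_sqrt m r0 r1; rewrite -/q in E2.
have T0 : 0 <= T' by apply: sumr_ge0.
have e0 := geo_pairs_ge0 m q0; have p0 := geo_sum_ge0 m q0; have er0 := geo_pairs_ge0 m r0.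
have X1 : (\sum_(0 <= k < 2 * N) r ^+ (2 * m * k)) * geo_pairs m r <=
    2 * T' * (2^-1 + 4 * geo_sum m q + 4 * geo_pairs m q).
  by apply: ler_pM => //; apply: sumr_ge0 => k _; exact: exprn_ge0.
have X2 : T' * geo_pairs m q <= T * geo_pairs m q by rewrite ler_wpM2r.
have XE : 2 * T' * (2^-1 + 4 * geo_sum m q + 4 * geo_pairs m q) =
    T' + 8 * (T' * geo_sum m q) + 8 * (T' * geo_pairs m q) by field.
rewrite XE in X1.
have s10 : 0 <= s1 by apply: sumr_ge0.
have Te : 0 <= T * geo_pairs m q by rewrite mulr_ge0 // (le_trans T0).
lra.
Qed.

Lemma exps_double m N rho : (0 < m)%N -> (0 < N)%N -> 0 < rho -> rho <= 1 ->
  expsum (expR (- (rho / 2))) (exps m (2 * N)) <= 16 * expsum (expR (- rho)) (exps m (2 * N)).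
Proof.
move=> m0 N0 r0 r1.
have -> : expR (- rho) = expR (- (rho / 2)) ^+ 2 by rewrite -expRM_natl; congr expR; field.
apply: expsum_double => //; first by have := expR_ge1Dx (- (rho / 2)); lra.
by rewrite expR_le1 oppr_le0 divr_ge0 // ltW.
Qed.

Lemma geom_le (q : R) N : 0 <= q -> q < 1 -> \sum_(0 <= e < N) q ^+ e <= (1 - q)^-1.
Proof.
move=> q0 q1; have h : 0 < 1 - q by lra.
rewrite -[leRHS]mul1r ler_pdivlMr // mulrC.
have -> : (1 - q) * \sum_(0 <= e < N) q ^+ e = 1 - q ^+ N.
  elim: N => [|n IH]; first by rewrite big_geq // expr0 mulr0 subrr.
  by rewrite big_nat_recr //= mulrDr IH exprS; ring.
by rewrite gerBl exprn_ge0.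
Qed.

(** The partition factor contributes a geometric series, the pairs at
    most a product of three. *)
Lemma expsum_cubic m K q : 0 <= q -> q < 1 -> (0 < m)%N ->
  expsum q (exps m K) <= 2 * ((1 - q)^-1) ^+ 3.
Proof.
move=> q0 q1 m0; rewrite expsum_exps.
have V1 : 1 <= (1 - q)^-1 by rewrite invf_ge1; lra.
have P n : \sum_(1 <= e < n) q ^+ e <= (1 - q)^-1.
  by apply: le_trans (geom_le n q0 q1); apply: sum_nat_le => // i; exact: exprn_ge0.
have T : \sum_(0 <= k < K) q ^+ (2 * m * k) <= (1 - q)^-1.
  apply: le_trans (geom_le K q0 q1); apply: ler_sum => k _.
  apply: ler_wiXn2l => //; first exact: ltW.
  by rewrite -[leqLHS]mul1n leq_mul2r; lia.
have E : geo_pairs m q <= (1 - q)^-1 ^+ 2.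
  have := geo_sum_sqr m q; have s0 : 0 <= \sum_(1 <= j < m) q ^+ j ^+ 2.
    by apply: sumr_ge0 => j _; rewrite sqr_ge0.
  have : geo_sum m q ^+ 2 <= (1 - q)^-1 ^+ 2 by rewrite lerXn2r ?nnegrE ?geo_sum_ge0 ?(P m) //; lra.
  by have := geo_pairs_ge0 m q0; lra.
have TE : (\sum_(0 <= k < K) q ^+ (2 * m * k)) * geo_pairs m q <= (1 - q)^-1 * (1 - q)^-1 ^+ 2.
  by apply: ler_pM => //; [apply: sumr_ge0 => k _; exact: exprn_ge0 | exact: geo_pairs_ge0].
have := P (m * K).+1; move: TE; move: ((1 - q)^-1) V1 => V V1.
have : V <= V ^+ 3 by rewrite exprS ler_peMr ?exprn_ege1 //; lra.
by rewrite -exprS; lra.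
Qed.

End Moments.

(** * The wave near the saddle point *)

Section NearSaddle.
Variable R : realType.
Implicit Types (x rho theta : R) (hs : seq nat).

Lemma expR_ge_pow x n : 0 <= x -> x ^+ n <= n`!%:R * expR x.
Proof.
move=> x0; case: n => [|n].
  by rewrite expr0 fact0 mul1r; apply: le_trans (expR_ge1Dx x); rewrite lerDl.
rewrite mulrC -ler_pdivrMr ?ltr0n ?fact_gt0 //.
by apply: le_trans (expR_ge1Dxn n x0); rewrite lerDr.
Qed.

(** As [x / (1 - expR (- x)) <= 1 + x], it suffices that [(1 + x) ^ 4] is
    dominated by [expR (x / 2)]. *)
Lemma moment_le x j : 0 < x -> (j <= 4)%N ->
  x ^+ j * expR (- x) / (1 - expR (- x)) ^+ j <= 4096 * expR (- (x / 2)).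
Proof.
move=> x0 j4; have e1 := expR_ge1Dx x.
have w0 := expR_gt0 (- x); have xw : expR x * expR (- x) = 1 by rewrite -expRD subrr expR0.
have w1 : 0 < 1 - expR (- x) by rewrite subr_gt0 expR_lt1 oppr_lt0.
have h0 : 0 <= x / (1 - expR (- x)) by rewrite divr_ge0 // ltW.
have h1 : x / (1 - expR (- x)) <= 1 + x.
  by rewrite ler_pdivrMr //; nra.
rewrite -mulrA [expR (- x) / _]mulrC mulrA -expr_div_n.
have h2 : (x / (1 - expR (- x))) ^+ j <= 4096 * expR (x / 2).
  apply: (@le_trans _ _ ((1 + x) ^+ 4)).
    apply: (@le_trans _ _ ((1 + x) ^+ j)); last by rewrite ler_weXn2l //; lra.
    by rewrite lerXn2r ?nnegrE //; lra.
  have -> : expR (x / 2) = expR (x / 8) ^+ 4 by rewrite -expRM_natl; congr expR; field.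
  have -> : 4096 = 8 ^+ 4 :> R by ring.
  rewrite -exprMn; have E8 := expR_ge1Dx (x / 8).
  by apply: lerXn2r; rewrite ?nnegrE; lra.
have -> : expR (- (x / 2)) = expR (x / 2) * expR (- x) by rewrite -expRD; congr expR; field.
by rewrite mulrA ler_wpM2r // ltW.
Qed.

(** That [4 * kappa] is a square turns [1 <= 4 * kappa * t ^ 2] into a lower
    bound on [|t|]. *)
Lemma kappa_subproof :
  {k : R | [/\ 1 <= k, 16 * 4096 <= k & exists2 f : R, 1 <= f & f ^+ 2 = 4 * k]}.
Proof.
exists (16 * 4096); split; [lra | exact: lexx|].
by exists 512; [lra | ring].
Qed.

(** The constant is sealed: unfolding the numeral would only burden
    conversion. *)
Definition kappa : R := sval kappa_subproof.

Lemma kappa_ge1 : 1 <= kappa.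
Proof. by rewrite /kappa; case: kappa_subproof => k []. Qed.

Lemma kappa_ge : 16 * 4096 <= kappa.
Proof. by rewrite /kappa; case: kappa_subproof => k []. Qed.

Lemma kappa_sqr : exists2 f : R, 1 <= f & f ^+ 2 = 4 * kappa.
Proof. by rewrite /kappa; case: kappa_subproof => k []. Qed.

(** Mean and variance of the size of a random object whose generating function
    is the product over [hs], when size [n] has weight [q ^ n]. *)
Definition mean_sum q hs : R := \sum_(h <- hs) h%:R * q ^+ h / (1 - q ^+ h).
Definition var_sum q hs : R := \sum_(h <- hs) h%:R ^+ 2 * q ^+ h / (1 - q ^+ h) ^+ 2.

Section ExponentList.
Variables (hs : seq nat) (rho : R).
Hypotheses (hs0 : all (fun h => 0 < h)%N hs) (rho0 : 0 < rho).
Let q := expR (- rho).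
(* The only property of the list that the estimates need to be uniform. *)
Hypothesis double : expsum (expR (- (rho / 2))) hs <= 16 * expsum q hs.
Let L := rho ^+ 2 * var_sum q hs.
Let K : R := kappa.

Let q0 : 0 < q. Proof. exact: expR_gt0. Qed.
Let q1 : q < 1. Proof. by rewrite /q expR_lt1 oppr_lt0. Qed.

Lemma expR_pow h : expR (- rho) ^+ h = expR (- (h%:R * rho)).
Proof. by rewrite -expRM_natl mulrN. Qed.

Lemma ler_sum_hs (f g : nat -> R) : (forall h, (0 < h)%N -> f h <= g h) ->
  \sum_(h <- hs) f h <= \sum_(h <- hs) g h.
Proof.
move=> fg; elim: hs hs0 => [|h s IH] /=; first by rewrite !big_nil.
by move=> /andP[h0 s0]; rewrite !big_cons lerD ?fg ?IH.
Qed.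

Lemma expsum_le_var : expsum q hs <= L.
Proof.
rewrite /L /var_sum mulr_sumr; apply: ler_sum_hs => h h0.
have w1 := qX_lt1 q0 q1 h0; have w0 := qX_ge0 q0 h.
rewrite -[X in X <= _]mulr1.
have -> : rho ^+ 2 * (h%:R ^+ 2 * q ^+ h / (1 - q ^+ h) ^+ 2) =
  q ^+ h * ((h%:R * rho) / (1 - q ^+ h)) ^+ 2.
  by field; rewrite gt_eqF // subr_gt0.
rewrite ler_wpM2l // exprn_ege1 // ler_pdivlMr ?subr_gt0 // mul1r.
by have := expR_ge1Dx (- (h%:R * rho)); rewrite /q expR_pow; lra.
Qed.

Lemma moment_sum_half j : (j <= 4)%N ->
  \sum_(h <- hs) (h%:R * rho) ^+ j * q ^+ h / (1 - q ^+ h) ^+ j <=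
  4096 * expsum (expR (- (rho / 2))) hs.
Proof.
move=> j4; rewrite /expsum mulr_sumr; apply: ler_sum_hs => h h0.
have x0 : 0 < h%:R * rho by rewrite mulr_gt0 // ltr0n.
have := moment_le x0 j4; rewrite /q !expR_pow.
by rewrite -expRM_natl; congr (_ <= _ * expR _); field.
Qed.

Lemma moment_sum j : (j <= 4)%N ->
  \sum_(h <- hs) (h%:R * rho) ^+ j * q ^+ h / (1 - q ^+ h) ^+ j <= K * L.
Proof.
move=> j4; apply: (le_trans (moment_sum_half j4)).
have L1 := expsum_le_var; have e0 : 0 <= expsum q hs.
  by apply: sumr_ge0 => h _; rewrite exprn_ge0 // ltW.
apply: (@le_trans _ _ (16 * 4096 * L)); first by move: double; lra.
by rewrite ler_wpM2r ?kappa_ge //; lra.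
Qed.

Definition damping theta : R := \sum_(h <- hs) damp (q ^+ h) (h%:R * theta).

Lemma wave_ampE theta : wave_amp q hs theta = expR (- damping theta).
Proof.
rewrite /wave_amp /damping; elim: hs hs0 => [|h s IH] /=.
  by rewrite !big_nil oppr0 expR0.
move=> /andP[h0 s0]; rewrite !big_cons opprD expRD IH // amp_damp //.
  exact: qX_ge0.
exact: qX_lt1.
Qed.

Lemma norm_sum_hs (f g : nat -> R) : (forall h, (0 < h)%N -> `|f h| <= g h) ->
  `|\sum_(h <- hs) f h| <= \sum_(h <- hs) g h.
Proof.
move=> fg; elim: hs hs0 => [|h s IH] /=; first by rewrite !big_nil normr0.
move=> /andP[h0 s0]; rewrite !big_cons; apply: (le_trans (ler_normD _ _)).
by rewrite lerD ?fg ?IH.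
Qed.

Lemma damping_near theta :
  `|damping theta - L * (theta / rho) ^+ 2 / 2| <= K * L * (theta / rho) ^+ 4.
Proof.
have -> : L * (theta / rho) ^+ 2 / 2 =
    \sum_(h <- hs) q ^+ h * (h%:R * theta) ^+ 2 / (1 - q ^+ h) ^+ 2 / 2.
  rewrite /L /var_sum -mulr_suml; congr (_ / 2).
  rewrite mulrAC mulr_sumr; apply: eq_bigr => h _.
  have -> : rho ^+ 2 * (theta / rho) ^+ 2 = theta ^+ 2 by field; rewrite gt_eqF.
  by rewrite exprMn; ring.
rewrite /damping -sumrB.
apply: le_trans (norm_sum_hs (g := fun h => q ^+ h * (h%:R * theta) ^+ 4 / (1 - q ^+ h) ^+ 4) _) _.
  by move=> h h0; apply: damp_bound; [exact: qX_ge0 | exact: qX_lt1].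
have t4 : 0 <= (theta / rho) ^+ 4 by rewrite exprn_even_ge0.
apply: le_trans (ler_wpM2r t4 (moment_sum (leqnn 4))).
rewrite mulr_suml le_eqVlt; apply/orP; left; apply/eqP; apply: eq_bigr => h _.
have rt : rho * (theta / rho) = theta by field; rewrite gt_eqF.
by rewrite -[in LHS]rt; ring.
Qed.

Lemma phase_near theta :
  `|wave_pha q hs theta - mean_sum q hs * theta| <= K * L * `|theta / rho| ^+ 3.
Proof.
rewrite /mean_sum mulr_suml /wave_pha -sumrB.
apply: le_trans (norm_sum_hs (g := fun h => q ^+ h * `|h%:R * theta| ^+ 3 / (1 - q ^+ h) ^+ 3) _) _.
  move=> h h0; have -> : h%:R * q ^+ h / (1 - q ^+ h) * theta = q ^+ h * (h%:R * theta) / (1 - q ^+ h) by ring.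
  by apply: pha_bound; [exact: qX_ge0 | exact: qX_lt1].
have t3 : 0 <= `|theta / rho| ^+ 3 by rewrite exprn_ge0.
apply: le_trans (ler_wpM2r t3 (moment_sum (isT : (3 <= 4)%N))).
rewrite mulr_suml le_eqVlt; apply/orP; left; apply/eqP; apply: eq_bigr => h _.
have rt : `|h%:R * theta| = (h%:R * rho) * `|theta / rho|.
  by rewrite !normrM normfV (gtr0_norm rho0) normr_nat; field; rewrite gt_eqF.
by rewrite rt; ring.
Qed.

Lemma expR_lip (a b c : R) : c <= a -> c <= b ->
  `|expR (- a) - expR (- b)| <= expR (- c) * `|a - b|.
Proof.
wlog ab : a b / a <= b => [H|] ca cb.
  have [ab|/ltW ba] := leP a b; first exact: H.
  by rewrite (distrC (expR _)) (distrC a); apply: H.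
have eab : expR (- b) = expR (- a) * expR (a - b) by rewrite -expRD; congr expR; ring.
have h1 := expR_ge1Dx (a - b); have h2 : expR (- a) <= expR (- c) by rewrite ler_expR lerN2.
have h3 : expR (a - b) <= 1 by rewrite -expR0 ler_expR subr_le0.
have a0 := expR_gt0 (- a).
rewrite ger0_norm ?eab; last by nra.
rewrite ler0_norm ?subr_le0 //.
have -> : expR (- a) - expR (- a) * expR (a - b) = expR (- a) * (1 - expR (a - b)) by ring.
by apply: ler_pM; lra.
Qed.

Hypothesis L0 : 0 < L.

Let C2 := 3072 * (K ^+ 2 + K).

Let K1 : 1 <= K. Proof. exact: kappa_ge1. Qed.

(** Close to the saddle point the wave is a Gaussian up to a relative error of
    order [1 / L]: taking the real part removes the cubic term of the phase to
    first order. *)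
Lemma wave_near (n : nat) theta (t := theta / rho) : 4 * K * t ^+ 2 <= 1 ->
  `|wave q hs n%:Z theta - expR (- (L * t ^+ 2 / 2))| <=
   C2 / L * expR (- (L * t ^+ 2 / 8)) + ((mean_sum q hs - n%:R) * theta) ^+ 2.
Proof.
move=> tK; set y := L * t ^+ 2.
have y0 : 0 <= y by rewrite mulr_ge0 ?sqr_ge0 // ltW.
have dn := damping_near theta; have pn := phase_near theta.
rewrite -/t in dn pn; rewrite -/y in dn.
have t2 : 0 <= t ^+ 2 by rewrite sqr_ge0.
have t4E : K * L * t ^+ 4 = K * y ^+ 2 / L by rewrite /y; field; rewrite gt_eqF.
have Ay : y / 4 <= damping theta.
  have : K * L * t ^+ 4 <= y / 4.
    have -> : K * L * t ^+ 4 = y * (4 * K * t ^+ 2) / 4 by rewrite /y; field.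
    by rewrite ler_pM2r // ler_piMr.
  by move: dn; rewrite ler_norml => /andP[]; lra.
set B := wave_pha q hs theta - n%:~R * theta.
have cosB : 1 - cos B <= B ^+ 2 / 2 by have /andP[] := cos_bounds B.
have cosB0 : 0 <= 1 - cos B by rewrite subr_ge0 cos_le1.
set d := (mean_sum q hs - n%:R) * theta.
have B2 : B ^+ 2 / 2 <= (K * L * `|t| ^+ 3) ^+ 2 + d ^+ 2.
  have BE : B = (wave_pha q hs theta - mean_sum q hs * theta) + d.
    by rewrite /B /d -pmulrn; ring.
  have u2 : (wave_pha q hs theta - mean_sum q hs * theta) ^+ 2 <= (K * L * `|t| ^+ 3) ^+ 2.
    by rewrite -real_normK ?num_real // lerXn2r ?nnegrE // (le_trans _ pn).
  move: u2; rewrite BE; move: (wave_pha _ _ _ - _) => u u2.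
  by have := sqr_ge0 (u - d); rewrite sqrrB sqrrD; lra.
have t6E : (K * L * `|t| ^+ 3) ^+ 2 = K ^+ 2 * y ^+ 3 / L.
  have -> : (K * L * `|t| ^+ 3) ^+ 2 = K ^+ 2 * L ^+ 2 * (`|t| ^+ 2) ^+ 3 by ring.
  by rewrite real_normK ?num_real // /y; field; rewrite gt_eqF.
have y8 : 0 <= y / 8 by lra.
(* Half of the decay pays for the powers of [y]. *)
have e8 : expR (- (y / 4)) * expR (y / 8) = expR (- (y / 8)).
  by rewrite -expRD; congr expR; field.
have y2 : expR (- (y / 4)) * y ^+ 2 <= 3072 * expR (- (y / 8)).
  rewrite -e8 [leRHS]mulrCA ler_wpM2l ?expR_ge0 //.
  have := expR_ge_pow 2 y8; have := expR_gt0 (y / 8); have -> : 2`!%:R = 2 :> R by [].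
  by have -> : (y / 8) ^+ 2 = y ^+ 2 / 64 by [field]; lra.
have y3 : expR (- (y / 4)) * y ^+ 3 <= 3072 * expR (- (y / 8)).
  rewrite -e8 [leRHS]mulrCA ler_wpM2l ?expR_ge0 //.
  have := expR_ge_pow 3 y8; have -> : 3`!%:R = 6 :> R by [].
  by have -> : (y / 8) ^+ 3 = y ^+ 3 / 512 by [field]; lra.
rewrite /wave wave_ampE -/B.
have -> : expR (- damping theta) * cos B - expR (- (y / 2)) =
  (expR (- damping theta) - expR (- (y / 2))) - expR (- damping theta) * (1 - cos B) by ring.
apply: (le_trans (ler_normB _ _)).
have A1 : `|expR (- damping theta) - expR (- (y / 2))| <= expR (- (y / 4)) * (K * y ^+ 2 / L).
  apply: (@le_trans _ _ (expR (- (y / 4)) * `|damping theta - y / 2|)).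
    by apply: expR_lip => //; lra.
  by rewrite ler_wpM2l ?expR_ge0 // -t4E.
have A2 : `|expR (- damping theta) * (1 - cos B)| <=
    expR (- (y / 4)) * (K ^+ 2 * y ^+ 3 / L) + d ^+ 2.
  rewrite ger0_norm ?mulr_ge0 ?expR_ge0 //.
  apply: (@le_trans _ _ (expR (- (y / 4)) * (K ^+ 2 * y ^+ 3 / L + d ^+ 2))).
    apply: ler_pM => //.
      by rewrite ler_expR lerN2.
    by rewrite -t6E; exact: le_trans cosB B2.
  rewrite mulrDr lerD2l ler_piMl ?sqr_ge0 // expR_le1; lra.
apply: (le_trans (lerD A1 A2)); rewrite addrA lerD2r.
have Li : 0 < L^-1 by rewrite invr_gt0.
have -> : expR (- (y / 4)) * (K * y ^+ 2 / L) + expR (- (y / 4)) * (K ^+ 2 * y ^+ 3 / L) =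
  (K * (expR (- (y / 4)) * y ^+ 2) + K ^+ 2 * (expR (- (y / 4)) * y ^+ 3)) * L^-1 by ring.
have -> : C2 / L * expR (- (y / 8)) = (K * (3072 * expR (- (y / 8))) +
   K ^+ 2 * (3072 * expR (- (y / 8)))) * L^-1 by rewrite /C2; ring.
have K0 : 0 <= K by apply: le_trans K1.
by rewrite ler_wpM2r ?(ltW Li) // lerD // ler_wpM2l ?sqr_ge0.
Qed.

(** Here [L t ^ 2] is at least of order [L], so part of the Gaussian pays for the
    factor [1 / L]. *)
Lemma gauss_far t : 1 <= 4 * K * t ^+ 2 ->
  expR (- (L * t ^+ 2 / 2)) <= C2 / L * expR (- (L * t ^+ 2 / 8)).
Proof.
move=> tK; set y := L * t ^+ 2.
have yL : L <= 4 * K * y by rewrite /y mulrCA ler_peMr // ltW.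
have t0 : 0 < t ^+ 2.
  by rewrite lt0r sqr_ge0 andbT; apply: contraTneq tK => ->; rewrite mulr0 ler10.
have y0 : 0 < y by rewrite mulr_gt0.
have K0 : 0 <= K by apply: le_trans K1.
have Ky : 0 <= K * y by rewrite mulr_ge0 // ltW.
have KKy : 0 <= K ^+ 2 * y by rewrite mulr_ge0 ?sqr_ge0 // ltW.
have -> : expR (- (y / 2)) = expR (- (y * 3 / 8)) * expR (- (y / 8)).
  by rewrite -expRD; congr expR; field.
rewrite ler_wpM2r ?expR_ge0 // expRN.
have e1 : y * 3 / 8 <= expR (y * 3 / 8) by apply: le_trans (expR_ge1Dx _); lra.
apply: (@le_trans _ _ (y * 3 / 8)^-1); first by rewrite lef_pV2 ?posrE ?expR_gt0 //; lra.
rewrite ler_pdivlMr // mulrC ler_pdivrMr; last by lra.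
rewrite (_ : C2 * _ = 1152 * (K ^+ 2 * y) + 1152 * (K * y)); first lra.
by rewrite /C2; field.
Qed.

Lemma wave_gauss (n : nat) theta E (t := theta / rho) :
  0 <= E -> (1 <= 4 * K * t ^+ 2 -> wave_amp q hs theta <= E) ->
  `|wave q hs n%:Z theta - expR (- (L * t ^+ 2 / 2))| <=
   C2 / L * expR (- (L * t ^+ 2 / 8)) + ((mean_sum q hs - n%:R) * theta) ^+ 2 + E.
Proof.
move=> E0 HE; have [tK|/ltW tK] := leP (4 * K * t ^+ 2) 1.
  by apply: le_trans (wave_near n tK) _; rewrite lerDl.
apply: (le_trans (ler_normB _ _)).
rewrite [X in _ + X]ger0_norm ?expR_ge0 //.
have := gauss_far tK; have := HE tK; have := sqr_ge0 ((mean_sum q hs - n%:R) * theta).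
have : `|wave q hs n%:Z theta| <= wave_amp q hs theta.
  have /andP[a0 _] := wave_amp_le1 q0 q1 theta hs0.
  by rewrite /wave normrM (ger0_norm a0) ler_piMr // ler_norml cos_geN1 cos_le1.
lra.
Qed.

End ExponentList.
End NearSaddle.

(** * The wave far from the saddle point *)

Section Tail.
Variable R : realType.
Implicit Types (w phi q theta rho : R).

Lemma amp_le_exp w phi : 0 <= w -> w < 1 ->
  amp w phi <= expR (- (w * (1 - cos phi) / 5)).
Proof.
move=> w0 w1; rewrite amp_damp // ler_expR lerN2 /damp.
have u0 : 0 <= 1 - cos phi by rewrite subr_ge0 cos_le1.
have u2 : 1 - cos phi <= 2 by have := cos_geN1 phi; lra.
set u := 1 - cos phi in u0 u2 *.
have wu0 : 0 <= w * u by rewrite mulr_ge0.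
have wu2 : w * u <= 2 by nra.
have d0 : 0 < (1 - w) ^+ 2 by rewrite exprn_gt0 // subr_gt0.
have d1 : (1 - w) ^+ 2 <= 1 by rewrite exprn_ile1; lra.
set s := 2 * w * u / (1 - w) ^+ 2.
have sy : 2 * (w * u) <= s by rewrite /s ler_pdivlMr //; nra.
have y1 : 0 < 1 + 2 * (w * u) by lra.
have ls : ln (1 + 2 * (w * u)) <= ln (1 + s) by rewrite ler_ln ?posrE //; lra.
(* [ln (1 + y) >= y / (1 + y)] and [y = 2 w u <= 4] give the constant 5. *)
have ly : - ln (1 + 2 * (w * u)) <= - (2 * (w * u) / 5).
  rewrite -lnV ?posrE //.
  have e : (1 + 2 * (w * u))^-1 = 1 + (- (2 * (w * u) / (1 + 2 * (w * u)))).
    by field; rewrite gt_eqF.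
  rewrite e; apply: (le_trans (le_ln1Dx _)).
    by rewrite ltrN2 ltr_pdivrMr //; lra.
  by rewrite lerN2; apply: ler_wpM2l; [lra | rewrite lef_pV2 ?posrE //; lra].
by lra.
Qed.

Lemma sum_cos q theta N :
  (1 - 2 * q * cos theta + q ^+ 2) * \sum_(1 <= k < N.+1) q ^+ k * cos (k%:R * theta) =
  q * cos theta - q ^+ 2 - q ^+ N.+1 * cos (N.+1%:R * theta)
    + q ^+ N.+2 * cos (N%:R * theta).
Proof.
elim: N => [|N IH].
  by rewrite big_geq // mulr0 mul1r mul0r cos0 expr1; ring.
rewrite big_nat_recr //= mulrDr IH.
have E : cos (N.+2%:R * theta) + cos (N%:R * theta) = 2 * cos theta * cos (N.+1%:R * theta).
  have -> : N.+2%:R * theta = N.+1%:R * theta + theta by rewrite -(natr1 N.+1); ring.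
  have -> : N%:R * theta = N.+1%:R * theta - theta by rewrite -(natr1 N); ring.
  by rewrite cosB cosD; ring.
have -> : cos (N.+2%:R * theta) = 2 * cos theta * cos (N.+1%:R * theta) - cos (N%:R * theta).
  by rewrite -E; ring.
by rewrite !exprS; ring.
Qed.

(** The infinite sum is the real part of a difference of geometric series, the
    first term of the bound; the second one bounds the terms beyond [N]. *)
Lemma sum_onemcos q theta N : 0 < q -> q < 1 ->
  q * (1 + q) * (1 - cos theta) / ((1 - q) * sqdist q theta) - 3 * q ^+ N.+1 / (1 - q) ^+ 2 <=
  \sum_(1 <= k < N.+1) q ^+ k * (1 - cos (k%:R * theta)).
Proof.
move=> q0 q1; have D0 := sqdist_gt0 theta (ltW q0) q1.
have p0 : 0 < 1 - q by rewrite subr_gt0.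
have DE : 1 - 2 * q * cos theta + q ^+ 2 = sqdist q theta by rewrite /sqdist; ring.
have C := sum_cos q theta N; rewrite DE in C.
have G : (1 - q) * \sum_(1 <= k < N.+1) q ^+ k = q - q ^+ N.+1.
  elim: N {C} => [|N IH]; first by rewrite big_geq // mulr0 expr1 subrr.
  by rewrite big_nat_recr //= mulrDr IH (exprS _ N.+1); ring.
have -> : \sum_(1 <= k < N.+1) q ^+ k * (1 - cos (k%:R * theta)) =
    \sum_(1 <= k < N.+1) q ^+ k - \sum_(1 <= k < N.+1) q ^+ k * cos (k%:R * theta).
  by rewrite -sumrB; apply: eq_bigr => k _; ring.
move: C G; set SC := \sum_(1 <= k < N.+1) q ^+ k * _; set SG := \sum_(1 <= k < N.+1) _ => C G.
have SGE : SG = (q - q ^+ N.+1) / (1 - q) by rewrite -G; field; rewrite gt_eqF.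
set r := q ^+ N.+2 * cos (N%:R * theta) - q ^+ N.+1 * cos (N.+1%:R * theta).
have SCE : SC = (q * cos theta - q ^+ 2 + r) / sqdist q theta.
  by rewrite (_ : _ + r = sqdist q theta * SC); [field; rewrite gt_eqF | rewrite C /r; ring].
have Q0 : 0 <= q ^+ N.+1 by rewrite exprn_ge0 // ltW.
have rb : r <= 2 * q ^+ N.+1.
  rewrite /r; have h1 : q ^+ N.+2 * cos (N%:R * theta) <= q ^+ N.+1.
    have := cos_le1 (N%:R * theta); have : q ^+ N.+2 <= q ^+ N.+1 by rewrite ler_wiXn2l // ltW.
    have : 0 <= q ^+ N.+2 by rewrite exprn_ge0 // ltW.
    nra.
  have h2 : - (q ^+ N.+1 * cos (N.+1%:R * theta)) <= q ^+ N.+1.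
    by have := cos_geN1 (N.+1%:R * theta); nra.
  lra.
have -> : q * (1 + q) * (1 - cos theta) / ((1 - q) * sqdist q theta) =
    q / (1 - q) - (q * cos theta - q ^+ 2) / sqdist q theta.
  have : sqdist q theta != 0 by rewrite gt_eqF.
  by rewrite /sqdist => d0; field; rewrite d0 gt_eqF.
have b1 : q ^+ N.+1 / (1 - q) <= q ^+ N.+1 / (1 - q) ^+ 2.
  rewrite ler_wpM2l // lef_pV2 ?posrE ?exprn_gt0 // expr2 ler_piMr // ?ltW //; lra.
have b2 : r / sqdist q theta <= 2 * q ^+ N.+1 / (1 - q) ^+ 2.
  apply: (@le_trans _ _ (2 * q ^+ N.+1 / sqdist q theta)).
    by rewrite ler_wpM2r // invr_ge0 ltW.
  rewrite ler_wpM2l ?mulr_ge0 // lef_pV2 ?posrE ?exprn_gt0 //.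
  by apply: sqdist_ge; exact: ltW.
rewrite SGE SCE; move: b1 b2.
have -> : (q - q ^+ N.+1) / (1 - q) = q / (1 - q) - q ^+ N.+1 / (1 - q) by ring.
have -> : (q * cos theta - q ^+ 2 + r) / sqdist q theta =
  (q * cos theta - q ^+ 2) / sqdist q theta + r / sqdist q theta by ring.
have -> : 2 * q ^+ N.+1 / (1 - q) ^+ 2 = 2 * (q ^+ N.+1 / (1 - q) ^+ 2) by ring.
have -> : 3 * q ^+ N.+1 / (1 - q) ^+ 2 = 3 * (q ^+ N.+1 / (1 - q) ^+ 2) by ring.
move: (q ^+ N.+1 / (1 - q) ^+ 2) (q ^+ N.+1 / (1 - q)) (r / sqdist q theta) => X Y Z.
by move: (q / (1 - q)) ((q * cos theta - q ^+ 2) / sqdist q theta) => U V; lra.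
Qed.

Lemma onemcos_ge theta theta0 : 0 <= theta0 -> theta0 <= 1 -> theta0 <= `|theta| ->
  `|theta| <= pi -> theta0 ^+ 2 / 3 <= 1 - cos theta.
Proof.
move=> t0 t1 tt tpi; have -> : cos theta = cos `|theta|.
  by have [_|_] := ger0P theta; rewrite ?cosN.
have h1 : cos `|theta| <= cos theta0.
  have := tt; rewrite le_eqVlt => /orP[/eqP <- //|lt].
  apply: ltW; rewrite ltr_cos // in_itv /= ?normr_ge0 ?tpi // t0 /=.
  exact: le_trans tt tpi.
have := cos_le4 t0; have h2 : theta0 ^+ 4 <= theta0 ^+ 2 by rewrite ler_wiXn2l.
by have := sqr_ge0 theta0; lra.
Qed.

Definition tail_rate : R := (48 * kappa R + 8)^-1.

Lemma tail_rate_gt0 : 0 < tail_rate.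
Proof. by have := @kappa_ge1 R; rewrite /tail_rate invr_gt0; lra. Qed.

(** Only the exponents [1, ..., m * K] are used, the other factors having
    amplitude at most [1].  Where [|theta|] is at least of order [rho], [sqdist]
    is of the order of [1 - cos theta], and [sum_onemcos] is of order [1 / rho]. *)
Lemma wave_tail m K rho theta (q := expR (- rho)) : (0 < m)%N -> 0 < rho -> rho <= 1 ->
  `|theta| <= pi -> 1 <= 4 * kappa R * (theta / rho) ^+ 2 ->
  wave_amp q (exps m K) theta <=
    expR (- ((tail_rate / rho - 3 * q ^+ (m * K).+1 / (1 - q) ^+ 2) / 5)).
Proof.
move=> m0 r0 r1 tpi tK.
have q0 : 0 < q by exact: expR_gt0.
have q1 : q < 1 by rewrite /q expR_lt1 oppr_lt0.
have hs0 := exps_gt0 m K.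
have X1 : wave_amp q (exps m K) theta <=
    \prod_(1 <= h < (m * K).+1) amp (q ^+ h) (h%:R * theta).
  move: hs0; rewrite /wave_amp /exps all_cat big_cat /= => /andP[hs1 hs2].
  have /andP[a0 _] := wave_amp_le1 q0 q1 theta hs1.
  by have /andP[_ b1] := wave_amp_le1 q0 q1 theta hs2; rewrite ler_piMr.
apply: (le_trans X1); move: (m * K)%N => N.
have X2 : \prod_(1 <= h < N.+1) amp (q ^+ h) (h%:R * theta) <=
    expR (- ((\sum_(1 <= h < N.+1) q ^+ h * (1 - cos (h%:R * theta))) / 5)).
  elim: N => [|N IH]; first by rewrite !big_geq // mul0r oppr0 expR0.
  rewrite !(big_nat_recr N.+1) //= mulrDl opprD expRD.
  have w0 := qX_ge0 q0 N.+1; have w1 := qX_lt1 q0 q1 (ltn0Sn N).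
  apply: ler_pM => //; last exact: amp_le_exp.
  - rewrite big_nat; apply: prodr_ge0 => h /andP[h0 _]; apply: ltW.
    by apply: amp_gt0; [exact: qX_ge0 | exact: qX_lt1].
  - by apply: ltW; apply: amp_gt0.
apply: (le_trans X2); rewrite ler_expR lerN2 ler_pM2r ?invr_gt0 //.
apply: le_trans (sum_onemcos theta N q0 q1); rewrite lerD2r.
set u := 1 - cos theta.
have [f f1 fE] := @kappa_sqr R.
have f0 : 0 < f by lra.
have ur : rho ^+ 2 <= 12 * kappa R * u.
  have -> : 12 * kappa R = 3 * f ^+ 2 by rewrite fE; ring.
  suff : (rho / f) ^+ 2 / 3 <= u.
    by rewrite ler_pdivrMr // expr_div_n ler_pdivrMr ?exprn_gt0 // -mulrA mulrC.
  have fr : rho / f <= rho by rewrite ler_pdivrMr // ler_peMr // ltW.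
  apply: onemcos_ge => //; [by rewrite divr_ge0 // ltW | lra |].
  have : 1 <= (f * `|theta| / rho) ^+ 2.
    have -> : (f * `|theta| / rho) ^+ 2 = 4 * kappa R * (`|theta| ^+ 2 / rho ^+ 2).
      by rewrite -fE; field; rewrite gt_eqF.
    by rewrite real_normK ?num_real // -expr_div_n.
  have p0 : 0 <= f * `|theta| / rho by rewrite divr_ge0 ?mulr_ge0 // ltW.
  rewrite -[X in X <= _](expr1n _ 2) ler_pXn2r ?nnegrE // ler_pdivlMr // mul1r => h.
  by rewrite ler_pdivrMr // mulrC.
have k1 := @kappa_ge1 R.
have u0 : 0 < u.
  have r2 : 0 < rho ^+ 2 by rewrite exprn_gt0.
  by have := lt_le_trans r2 ur; rewrite pmulr_rgt0 //; lra.
have qr : 1 - q <= rho by have := expR_ge1Dx (- rho); rewrite -/q; lra.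
have qh : 4^-1 <= q.
  have -> : q = expR (- (rho / 2)) ^+ 2 by rewrite -expRM_natl; congr expR; field.
  have := expR_ge1Dx (- (rho / 2)) => h; have h2 : 2^-1 <= expR (- (rho / 2)) by lra.
  have -> : 4^-1 = 2^-1 ^+ 2 :> R by field.
  by rewrite lerXn2r ?nnegrE //; lra.
have p0 : 0 < 1 - q by lra.
have Du : sqdist q theta <= (12 * kappa R + 2) * u.
  rewrite /sqdist -/u; have : (1 - q) ^+ 2 <= rho ^+ 2 by rewrite lerXn2r ?nnegrE //; lra.
  have : q * u <= 1 * u by rewrite ler_wpM2r // ltW.
  lra.
have D0 := sqdist_gt0 theta (ltW q0) q1.
apply: (@le_trans _ _ (q * u / (rho * ((12 * kappa R + 2) * u)))).
  have -> : q * u / (rho * ((12 * kappa R + 2) * u)) = 4 * q * (tail_rate / rho).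
    rewrite /tail_rate (_ : 48 * kappa R + 8 = 4 * (12 * kappa R + 2)); last by ring.
    by field; rewrite !gt_eqF //; lra.
  by apply: ler_peMl; [rewrite divr_ge0 // ltW // tail_rate_gt0 | lra].
apply: ler_pM.
- by rewrite mulr_ge0 // ltW.
- by rewrite invr_ge0 mulr_ge0 ?(ltW r0) // mulr_ge0 ?(ltW u0) //; lra.
- by rewrite ler_wpM2r ?(ltW u0) // ler_peMr ?(ltW q0) //; lra.
- have kp : 0 < 12 * kappa R + 2 by lra.
  rewrite lef_pV2 ?posrE ?mulr_gt0 //.
  by apply: ler_pM => //; exact: ltW.
Qed.

End Tail.

(** * Comparison with the Gaussian integral *)

Section Integrate.
Variable R : realType.
Local Notation mu := (@lebesgue_measure R).

Lemma gauss_Rintegral (a : R) : 0 < a ->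
  mu.-integrable setT (EFin \o (fun x : R => expR (- (a * x ^+ 2)))) /\
  \int[mu]_x expR (- (a * x ^+ 2)) = Num.sqrt (pi / a).
Proof.
move=> a0; pose s : R := Num.sqrt (2 * a)^-1.
have s2 : s ^+ 2 = (2 * a)^-1 by rewrite sqr_sqrtr // invr_ge0 mulr_ge0 // ltW.
have s0 : s != 0 by rewrite gt_eqF // sqrtr_gt0 invr_gt0 mulr_gt0.
pose p : R := normal_peak s.
have p0 : 0 < p by exact: normal_peak_gt0.
have pdfE x : normal_pdf 0 s x = p * expR (- (a * x ^+ 2)).
  rewrite normal_pdfE // /p /normal_fun subr0; congr (_ * expR _).
  by rewrite s2; field; rewrite gt_eqF.
have ig := @integrable_normal_pdf R 0 s.
have eg : EFin \o (fun x : R => expR (- (a * x ^+ 2))) =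
    (fun x => ((p^-1)%:E * (normal_pdf 0 s x)%:E)%E).
  by apply/funext => x /=; rewrite pdfE -EFinM mulKf // gt_eqF.
have i2 : mu.-integrable setT (EFin \o (fun x : R => expR (- (a * x ^+ 2)))).
  by rewrite eg; apply: integrableZl.
split=> //; have := integral_normal_pdf 0 s.
rewrite /Rintegral; have -> : (fun x => (expR (- (a * x ^+ 2)))%:E) =
  EFin \o (fun x : R => expR (- (a * x ^+ 2))) by [].
move=> I1; rewrite eg integralZl // I1 mule1 /= /p /normal_peak invrK s2.
by congr Num.sqrt; field; rewrite gt_eqF.
Qed.

(** Outside [[- pi, pi]] the whole Gaussian [g1] counts as an error; it is bounded
    by the same [c * g2] as the error inside. *)
Lemma saddle_compare (f g1 g2 : R -> R) (c e : R) :
  continuous f ->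
  mu.-integrable setT (EFin \o g1) -> mu.-integrable setT (EFin \o g2) ->
  (forall x, 0 <= g1 x) -> (forall x, 0 <= g2 x) ->
  (forall x, - pi <= x <= pi -> `|f x - g1 x| <= c * g2 x + e) ->
  (forall x, ~~ (- pi <= x <= pi) -> g1 x <= c * g2 x) ->
  `|circ f - \int[mu]_x g1 x| <= c * \int[mu]_x g2 x + 2 * pi * e.
Proof.
move=> cf i1 i2 g10 g20 fin fout.
pose D : set (measurableTypeR R) := `[- pi, pi]%classic.
have mD : measurable D by exact: measurable_itv.
have mC : measurable (~` D) by exact: measurableC.
have DT : D `|` ~` D = setT by rewrite setUv.
have dis : [disjoint D & ~` D] by apply/disj_setPS; rewrite setICr.
have split_int g : mu.-integrable setT (EFin \o g) ->
    \int[mu]_x g x = \int[mu]_(x in D) g x + \int[mu]_(x in ~` D) g x.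
  by move=> ig; rewrite -Rintegral_setU // DT.
have sub A g : measurable A -> mu.-integrable setT (EFin \o g) -> mu.-integrable A (EFin \o g).
  by move=> mA; apply: integrableS.
have scale (A : set (measurableTypeR R)) g : measurable A -> mu.-integrable A (EFin \o g) ->
    mu.-integrable A (EFin \o (fun x => c * g x)).
  move=> mA ig; rewrite (_ : EFin \o _ = (fun x => (c%:E * (EFin \o g) x)%E)) //.
  exact: integrableZl.
have fD := integrable_circ cf.
have g1D := sub D _ mD i1; have g2D := sub D _ mD i2.
have g1C := sub (~` D) _ mC i1; have g2C := sub (~` D) _ mC i2.
have cst (A : set (measurableTypeR R)) : A = D -> mu.-integrable A (EFin \o (fun=> e)).
  by move=> ->; apply: (@integrable_circ R (fun=> e)) => x; exact: cvg_cst.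
have E1 : `|circ f - \int[mu]_(x in D) g1 x| <= c * \int[mu]_(x in D) g2 x + 2 * pi * e.
  rewrite /circ -RintegralB // -(circ_cst e) /circ -RintegralZl // -RintegralD //; last 2 first.
  - exact: scale.
  - exact: cst.
  have i3 : mu.-integrable D (EFin \o (fun x => f x - g1 x)) by rewrite (_ : EFin \o _ = (EFin \o f) \- (EFin \o g1))%E //; exact: integrableB.
  have h := le_normr_Rintegral mD i3; rewrite /comp /= in h.
  apply: (le_trans h); apply: le_Rintegral => //.
  - by have := integrable_abse i3.
  - rewrite (_ : EFin \o _ = (EFin \o (fun x => c * g2 x)%R) \+ (EFin \o (fun=> e)))%E //.
    by apply: integrableD => //; [exact: scale | exact: cst].
have E2 : \int[mu]_(x in ~` D) g1 x <= c * \int[mu]_(x in ~` D) g2 x.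
  rewrite -RintegralZl //; apply: le_Rintegral => //.
  - exact: scale.
  - by move=> x; rewrite /D /= in_itv /= => /negP xD; exact: fout.
have E3 : 0 <= \int[mu]_(x in ~` D) g1 x by apply: Rintegral_ge0 => x _.
rewrite (split_int _ i1) (split_int _ i2).
move: E1 E2 E3; rewrite !ler_norml => /andP[]; move: (\int[mu]_(x in D) g1 x).
move: (\int[mu]_(x in D) g2 x) (\int[mu]_(x in ~` D) g1 x) (\int[mu]_(x in ~` D) g2 x) (circ f).
by move=> a b c' d a'; rewrite mulrDr; lra.
Qed.

End Integrate.

Section Truncated.
Variable R : realType.

(** The saddle-point formula for the product truncated to the exponents in
    [exps m (2 * N)]; [n - mean_sum] is the defect of the truncated
    saddle-point equation, and both it and the last power of [q] vanish as [N] grows.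
    The factor 16 bounds [pi ^ 2]. *)
Lemma saddle_truncated (m N n : nat) (rho : R) (q := expR (- rho))
    (hs := exps m (2 * N)) (L := rho ^+ 2 * var_sum q hs) :
  (0 < m)%N -> (0 < N)%N -> 0 < rho -> rho <= 1 ->
  `|2 * pi * ((coefs hs n)%:R * q ^+ n * \prod_(h <- hs) (1 - q ^+ h))
     - Num.sqrt (2 * pi / L) * rho| <=
  6144 * (kappa R ^+ 2 + kappa R) / L * (Num.sqrt (2 * pi / L) * rho) +
  2 * pi * (16 * (mean_sum q hs - n%:R) ^+ 2 +
    expR (- ((tail_rate R / rho - 3 * q ^+ (m * (2 * N)).+1 / (1 - q) ^+ 2) / 5))).
Proof.
move=> m0 N0 r0 r1; set K := kappa R.
have q0 : 0 < q by exact: expR_gt0.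
have q1 : q < 1 by rewrite /q expR_lt1 oppr_lt0.
have hs0 : all (fun h => 0 < h)%N hs by exact: exps_gt0.
have dbl : expsum (expR (- (rho / 2))) hs <= 16 * expsum q hs by exact: exps_double.
have L0 : 0 < L.
  apply: lt_le_trans (expsum_le_var hs0 r0).
  rewrite expsum_exps big_ltn; last by rewrite ltnS muln_gt0 m0 /= muln_gt0.
  rewrite expr1 -addrA; apply: ltr_pwDl => //; apply: addr_ge0.
    by apply: sumr_ge0 => h _; rewrite exprn_ge0 // ltW.
  by apply: mulr_ge0; [apply: sumr_ge0 => h _; rewrite exprn_ge0 // ltW | apply: geo_pairs_ge0; exact: ltW].
set E := expR (- (_ / 5)); have E0 : 0 <= E by exact: expR_ge0.
have p4 : pi <= 4 :> R by have := pihalf_lt2 R; lra.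
pose C2 := 3072 * (K ^+ 2 + K).
have a2 : 0 < L / (2 * rho ^+ 2) by rewrite divr_gt0 // mulr_gt0 // exprn_gt0.
have a8 : 0 < L / (8 * rho ^+ 2) by rewrite divr_gt0 // mulr_gt0 // exprn_gt0.
have [i2 I2] := gauss_Rintegral a2; have [i8 I8] := gauss_Rintegral a8.
have e2 x : L / (2 * rho ^+ 2) * x ^+ 2 = L * (x / rho) ^+ 2 / 2 by field; rewrite gt_eqF.
have e8 x : L / (8 * rho ^+ 2) * x ^+ 2 = L * (x / rho) ^+ 2 / 8 by field; rewrite gt_eqF.
have b0 : 0 <= 2 * pi / L.
  by apply: divr_ge0; [rewrite mulr_ge0 // pi_ge0 | exact: ltW].
have s2 : Num.sqrt (pi / (L / (2 * rho ^+ 2))) = Num.sqrt (2 * pi / L) * rho.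
  transitivity (Num.sqrt (2 * pi / L * rho ^+ 2)).
    by congr Num.sqrt; field; rewrite !gt_eqF.
  by rewrite sqrtrM // sqrtr_sqr ger0_norm // ltW.
have s8 : Num.sqrt (pi / (L / (8 * rho ^+ 2))) = 2 * (Num.sqrt (2 * pi / L) * rho).
  transitivity (Num.sqrt (2 * pi / L * (2 * rho) ^+ 2)).
    by congr Num.sqrt; field; rewrite !gt_eqF.
  by rewrite sqrtrM // sqrtr_sqr ger0_norm ?mulr_ge0 // ?ltW // mulrCA.
(* The main term has width [rho / sqrt L] and the error term twice this width. *)
have := @saddle_compare R (wave q hs n%:Z) _ _ (C2 / L) (16 * (mean_sum q hs - n%:R) ^+ 2 + E)
  (continuous_wave q0 q1 hs0) i2 i8 (fun x => expR_ge0 _) (fun x => expR_ge0 _).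
rewrite I2 I8 s2 s8 circ_wave //.
have -> : C2 / L * (2 * (Num.sqrt (2 * pi / L) * rho)) =
  6144 * (K ^+ 2 + K) / L * (Num.sqrt (2 * pi / L) * rho) by rewrite /C2; ring.
have -> : forall a b c : R, 2 * pi * (a * b * c) = 2 * pi * a * b * c.
  by move=> a b c; ring.
apply.
- move=> x xpi /=; rewrite e2 e8.
  have nx : `|x| <= pi by rewrite ler_norml.
  have := @wave_gauss R hs rho hs0 r0 dbl L0 n x E E0.
  rewrite -/q -/L => /(_ (fun h => wave_tail _ m0 r0 r1 nx h)) /le_trans; apply.
  rewrite -/K -/C2 -!addrA lerD2l lerD2r exprMn mulrC.
  rewrite ler_wpM2r ?sqr_ge0 // -[x ^+ 2]real_normK ?num_real //.
  have -> : 16 = 4 ^+ 2 :> R by ring.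
  by rewrite lerXn2r ?nnegrE //; exact: le_trans nx p4.
- move=> x xpi /=; rewrite e2 e8; apply: gauss_far => //; rewrite -/K.
  have [f f1 fE] := @kappa_sqr R.
  rewrite -fE -exprMn -real_normK ?num_real // exprn_ege1 //.
  have px : pi < `|x| by rewrite ltNge ler_norml.
  rewrite normrM normrM normfV (gtr0_norm r0) (ger0_norm (le_trans ler01 f1)).
  have : 1 <= `|x| / rho.
    by rewrite ler_pdivlMr // mul1r (le_trans r1) // ltW // (le_lt_trans _ px) //; have := pihalf_ge1 R; lra.
  by move=> h; have := ler_pM ler01 ler01 f1 h; rewrite mulr1.
Qed.

End Truncated.

(** * Power series with the coefficients of a product *)

Section CoefsTheory.
Implicit Types (s t : seq nat) (n h : nat).

Lemma geomul_local h (f g : nat -> nat) n : (forall i, (i <= n)%N -> f i = g i) ->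
  forall i, (i <= n)%N -> geomul h f i = geomul h g i.
Proof.
move=> fg i iN; apply: eq_bigr => j _; apply: fg; exact: leq_trans (leq_subr _ _) iN.
Qed.

Lemma coefs_big t n : all (fun h => n < h)%N t -> forall i, (i <= n)%N -> coefs t i = (i == 0)%N.
Proof.
elim: t => //= h t IH /andP[hn tn] i iN.
rewrite geomulE ?(leq_ltn_trans _ hn) // leqNgt (leq_ltn_trans iN hn) /= addn0.
exact: IH.
Qed.

Lemma coefs_cat_big s t n : all (fun h => n < h)%N t -> coefs (s ++ t) n = coefs s n.
Proof.
move=> tn; rewrite /coefs foldr_cat.
have: forall i, (i <= n)%N -> foldr geomul (foldr geomul (fun n => (n == 0)%N : nat) t) s i =
    foldr geomul (fun n => (n == 0)%N : nat) s i; last by apply.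
elim: s => [|h s IH] /= i iN; first exact: (coefs_big tn).
exact: (geomul_local h IH iN).
Qed.

Lemma coefs_cat_ge s t n : all (fun h => 0 < h)%N t -> (coefs s n <= coefs (s ++ t) n)%N.
Proof.
move=> t0; rewrite /coefs foldr_cat.
have t1 i : ((i == 0)%N <= foldr geomul (fun n => (n == 0)%N : nat) t i)%N.
  elim: t t0 => //= h t IH /andP[h0 /IH ti].
  by rewrite geomulE // (leq_trans ti) // leq_addr.
move: (foldr geomul _ t) t1 => f; elim: s n => //= h s IH n f1.
by apply: leq_sum => j _; apply: IH.
Qed.

Lemma coefs0 s : coefs s 0 = 1%N.
Proof.
elim: s => //= h s IH; rewrite /geomul big_mkcond big_ord_recl big_ord0 /=.
by rewrite mul0n subn0 IH.
Qed.

End CoefsTheory.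

Section PowerSeries.
Variable R : realType.
Implicit Types (z r : R) (a : nat -> R).

Lemma nondecreasing_series_nneg (u : nat -> R) : (forall n, 0 <= u n) ->
  {homo series u : n p / (n <= p)%N >-> n <= p}.
Proof.
move=> u0; apply/nondecreasing_seqP => n.
by rewrite /series /= big_nat_recr //= lerDl.
Qed.

Lemma cvg_series_bounded_nneg (u : nat -> R) B : (forall n, 0 <= u n) ->
  (forall n, series u n <= B) -> cvgn (series u).
Proof.
move=> u0 uB; apply: nondecreasing_is_cvgn; first exact: nondecreasing_series_nneg.
by exists B => _ [n _ <-].
Qed.

Lemma series_le_lim (u : nat -> R) n : (forall n, 0 <= u n) -> cvgn (series u) ->
  series u n <= limn (series u).
Proof. by move=> u0 cu; apply: nondecreasing_cvgn_le => //; exact: nondecreasing_series_nneg. Qed.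

Lemma cvg_pseries_norm a z : (forall n, 0 <= a n) -> cvgn (pseries a `|z|) -> cvgn (pseries a z).
Proof.
move=> a0 ca; apply: normed_cvg; rewrite /normed_series_of /=.
rewrite (_ : (fun n => _) = (fun n => a n * `|z| ^+ n)) //.
by apply/funext => n; rewrite normrM normrX (ger0_norm (a0 n)).
Qed.

Definition ncoefs (s : seq nat) (n : nat) : R := (coefs s n)%:R.

Lemma ncoefs_ge0 s n : 0 <= ncoefs s n. Proof. exact: ler0n. Qed.

Lemma series_geomul h (f : nat -> nat) z M : (0 < h)%N ->
  series (fun n => (geomul h f n)%:R * z ^+ n) (M + h)%N =
  series (fun n => (f n)%:R * z ^+ n) (M + h)%N +
  z ^+ h * series (fun n => (geomul h f n)%:R * z ^+ n) M.
Proof.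
move=> h0; rewrite /series /=.
have -> : \sum_(0 <= k < M + h) (geomul h f k)%:R * z ^+ k =
  \sum_(0 <= k < M + h) ((f k)%:R * z ^+ k +
    (if (h <= k)%N then (geomul h f (k - h))%:R * z ^+ k else 0)).
  apply: eq_bigr => k _; rewrite geomulE // natrD mulrDl.
  by case: ifP => // _; rewrite mul0r.
rewrite big_split /=; congr (_ + _).
rewrite (big_cat_nat (n := h)) ?leq_addl //= big_nat big1 ?add0r; last first.
  by move=> i /andP[_ ih]; rewrite leqNgt ih.
rewrite -{1}[h]add0n big_addn addnK mulr_sumr; apply: eq_bigr => i _.
by rewrite leq_addl addnK exprD; ring.
Qed.

(** By induction on the list: [series_geomul] bounds the partial sums of the
    longer product by the sum of the shorter one divided by [1 - |z| ^ h], and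
    then determines the limit. *)
Lemma cvg_ncoefs s z : all (fun h => 0 < h)%N s -> `|z| < 1 ->
  cvgn (pseries (ncoefs s) `|z|) /\
  pseries (ncoefs s) z @ \oo --> \prod_(h <- s) (1 - z ^+ h)^-1.
Proof.
elim: s => [|h s IH] /= => [_ z1|/andP[h0 s0] z1].
  have H (x : R) : pseries (ncoefs [::]) x @ \oo --> (1 : R).
    rewrite -(cvg_shiftn 1) /=; apply: cvg_near_cst; apply: nearW => n.
    rewrite /pseries /series /= addn1 big_nat_recl //= big1 ?addr0 => [|i _].
      by rewrite expr0 mulr1.
    by rewrite /ncoefs /= mul0r.
  by split; [apply/cvg_ex; exists 1; exact: H | rewrite big_nil; exact: H].
have [c1 c2] := IH s0 z1.
have zh : `|z| ^+ h < 1 by rewrite exprn_ilt1 // -lt0n.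
have cv : cvgn (pseries (ncoefs (h :: s)) `|z|).
  have nn n : 0 <= ncoefs (h :: s) n * `|z| ^+ n by rewrite mulr_ge0 ?ncoefs_ge0 // exprn_ge0.
  have nn' n : 0 <= ncoefs s n * `|z| ^+ n by rewrite mulr_ge0 ?ncoefs_ge0 // exprn_ge0.
  apply: (@cvg_series_bounded_nneg _ ((1 - `|z| ^+ h)^-1 * limn (pseries (ncoefs s) `|z|))) => // n.
  rewrite mulrC ler_pdivlMr ?subr_gt0 //.
  have := series_geomul (coefs s) `|z| n h0; rewrite -/(coefs (h :: s)) => E.
  have L1 := series_le_lim (n + h) nn' c1.
  have L2 := nondecreasing_series_nneg nn (leq_addr h n).
  by move: E L1 L2; rewrite /ncoefs /= /pseries; lra.
split=> //; rewrite big_cons.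
have cz : cvgn (pseries (ncoefs (h :: s)) z).
  by apply: cvg_pseries_norm => // n; exact: ncoefs_ge0.
move: cz => /cvg_ex[l lP].
have e1 : 1 - z ^+ h != 0.
  by rewrite subr_eq0 eq_sym; apply: contraTneq zh => e; rewrite -normrX e normr1 ltxx.
suff -> : (1 - z ^+ h)^-1 * \prod_(j <- s) (1 - z ^+ j)^-1 = l by exact: lP.
have lE : l = \prod_(j <- s) (1 - z ^+ j)^-1 + z ^+ h * l.
  have l2 : pseries (ncoefs (h :: s)) z (n + h)%N @[n --> \oo] --> l.
    by rewrite (cvg_shiftn h (pseries (ncoefs (h :: s)) z)).
  have l3 : pseries (ncoefs s) z (n + h)%N + z ^+ h * pseries (ncoefs (h :: s)) z n @[n --> \oo]
      --> \prod_(j <- s) (1 - z ^+ j)^-1 + z ^+ h * l.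
    apply: cvgD; first by rewrite (cvg_shiftn h (pseries (ncoefs s) z)).
    by apply: cvgM => //; exact: cvg_cst.
  have E : (fun n => pseries (ncoefs (h :: s)) z (n + h)%N) =
      (fun n => pseries (ncoefs s) z (n + h)%N + z ^+ h * pseries (ncoefs (h :: s)) z n).
    by apply/funext => n; exact: series_geomul.
  rewrite E in l2; exact: (cvg_unique (@Rhausdorff R) l2 l3).
by apply: (mulfI e1); rewrite mulrA divff // mul1r mulrBl mul1r {1}lE addrK.
Qed.

(** Tannery's theorem, for terms that become stationary. *)
Lemma tannery (f : nat -> nat -> R) (g b : nat -> R) :
  (forall N n, `|f N n| <= b n) -> (forall N n, (n <= N)%N -> f N n = g n) ->
  cvgn (series b) ->
  limn (series (f N)) @[N --> \oo] --> limn (series g).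
Proof.
move=> fb fg cb.
have gb n : `|g n| <= b n by rewrite -(fg n n).
have b0 n : 0 <= b n by apply: le_trans (gb n).
have cf N : cvgn (series (f N)).
  by apply: normed_cvg; apply: (series_le_cvg _ b0 (fb N) cb) => n /=.
have cg : cvgn (series g).
  by apply: normed_cvg; apply: (series_le_cvg _ b0 gb cb) => n /=.
have bd N : `|limn (series (f N)) - limn (series g)| <= 2 * (limn (series b) - series b N).
  have T (u : nat -> R) : (forall n, `|u n| <= b n) -> cvgn (series u) ->
      `|limn (series u) - series u N| <= limn (series b) - series b N.
    move=> ub cu.
    have l1 : `|series u n - series u N| @[n --> \oo] --> `|limn (series u) - series u N|.
      by apply: cvg_norm; apply: cvgB => //; exact: cvg_cst.
    have l2 : series b n - series b N @[n --> \oo] --> limn (series b) - series b N.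
      by apply: cvgB => //; exact: cvg_cst.
    apply: (ler_cvg_to l1 l2); near=> n.
    have Nn : (N <= n)%N by near: n; exact: nbhs_infty_ge.
    rewrite !sub_series_geq //; apply: (le_trans (ler_norm_sum _ _ _)).
    by apply: ler_sum => i _.
  have e : series (f N) N = series g N.
    by rewrite /series /= big_nat [RHS]big_nat; apply: eq_bigr => i /andP[_ /ltnW iN]; exact: fg.
  have := T _ (fb N) (cf N); have := T _ gb cg; rewrite e.
  have -> : limn (series (f N)) - limn (series g) =
    (limn (series (f N)) - series g N) - (limn (series g) - series g N) by ring.
  by move=> h1 h2; apply: (le_trans (ler_normB _ _)); lra.
have l0 : 2 * (limn (series b) - series b N) @[N --> \oo] --> (0 : R).
  rewrite -[X in _ --> X](mulr0 2); apply: cvgM; first exact: cvg_cst.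
  by rewrite -(subrr (limn (series b))); apply: cvgB => //; exact: cvg_cst.
apply/cvgrPdist_le => e e0; have /cvgrPdist_le /(_ e e0) := l0.
apply: filterS => N; rewrite sub0r normrN distrC => h.
by apply: le_trans (bd N) _; apply: le_trans h; exact: ler_norm.
Unshelve. all: by end_near.
Qed.

Lemma natX_le (x : R) n : 0 <= x -> x < 1 -> n.+1%:R * x ^+ n <= (1 - x)^-1.
Proof.
move=> x0 x1; apply: le_trans (geom_le n.+1 x0 x1).
rewrite mulr_natl -[X in _ *+ X](subn0) -sumr_const_nat; apply: ler_sum_nat => i /andP[_ iN].
by rewrite ler_wiXn2l // ltW.
Qed.

(** Differentiation multiplies the terms by at most [n.+1], which
    [(r / s) ^ n] absorbs ([natX_le]). *)
Lemma cvg_pseries_diffs a r s : (forall n, 0 <= a n) -> 0 <= r -> r < s ->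
  cvgn (pseries a s) -> cvgn (pseries (pseries_diffs a) r).
Proof.
move=> a0 r0 rs cs; have s0 : 0 < s by exact: le_lt_trans rs.
have x0 : 0 <= r / s by rewrite divr_ge0 // ltW.
have x1 : r / s < 1 by rewrite ltr_pdivrMr // mul1r.
have V0 : 0 < (1 - r / s)^-1 by rewrite invr_gt0 subr_gt0.
have nn n : 0 <= a n * s ^+ n by rewrite mulr_ge0 // exprn_ge0 // ltW.
apply: (@cvg_series_bounded_nneg _ ((1 - r / s)^-1 / s * limn (pseries a s))) => n.
  by rewrite /pseries_diffs !mulr_ge0 // exprn_ge0.
apply: (@le_trans _ _ ((1 - r / s)^-1 / s * series (fun i => a i * s ^+ i) n.+1)); last first.
  by rewrite ler_wpM2l ?series_le_lim // divr_ge0 // ltW.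
rewrite /series /= big_nat_recl //= mulrDr.
apply: ler_wpDl; first by rewrite mulr_ge0 // divr_ge0 // ltW.
rewrite mulr_sumr; apply: ler_sum => i _; rewrite /pseries_diffs.
have -> : i.+1%:R * a i.+1 * r ^+ i = i.+1%:R * (r / s) ^+ i * (a i.+1 * s ^+ i).
  have : s ^+ i != 0 by rewrite expf_neq0 // gt_eqF.
  by rewrite expr_div_n => si; field.
have -> : (1 - r / s)^-1 / s * (a i.+1 * s ^+ i.+1) = (1 - r / s)^-1 * (a i.+1 * s ^+ i).
  by rewrite exprS; field; rewrite gt_eqF ?gt_eqF // subr_gt0.
by rewrite ler_wpM2r ?natX_le // mulr_ge0 // exprn_ge0 // ltW.
Qed.

End PowerSeries.

(** * Products over growing lists of exponents *)

Section FiniteProduct.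
Variable R : realType.
Implicit Types (z : R) (s : seq nat) (h : nat).

Definition euler s z : R := \prod_(h <- s) (1 - z ^+ h)^-1.

Lemma euler_gt0 s z : all (fun h => 0 < h)%N s -> 0 <= z -> z < 1 -> 0 < euler s z.
Proof.
move=> s0 z0 z1; rewrite /euler; elim: s s0 => [|h s IH] /=; first by rewrite big_nil.
by move=> /andP[h0 /IH p]; rewrite big_cons mulr_gt0 // invr_gt0 subr_gt0 exprn_ilt1 // -lt0n.
Qed.

Lemma is_derive_pow z h : (0 < h)%N -> z != 0 ->
  is_derive z (1 : R) (fun z => z ^+ h) (h%:R * z ^+ h / z).
Proof.
move=> h0 z0; have -> : (fun z : R => z ^+ h) = (fun z : R => z) ^+ h.
  by apply/funext => x; rewrite exprfctE.
apply: (is_derive_eq (is_deriveX h (is_derive_id z (1 : R)))).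
rewrite /GRing.scale /= mulr1.
by case: h h0 => // h _; rewrite exprS; field.
Qed.

Lemma onem_pow_neq0 z h : (0 < h)%N -> 0 < z -> z < 1 -> 1 - z ^+ h != 0.
Proof. by move=> h0 z0 z1; rewrite subr_eq0 eq_sym lt_eqF // exprn_ilt1 ?ltW // -lt0n. Qed.

Lemma is_derive_onem_pow z h : (0 < h)%N -> z != 0 ->
  is_derive z (1 : R) (fun z => 1 - z ^+ h) (- (h%:R * z ^+ h / z)).
Proof.
move=> h0 z0; have d := is_derive_pow h0 z0.
by apply: is_derive_eq; rewrite add0r mul1r.
Qed.

Lemma is_derive_factor z h : (0 < h)%N -> 0 < z -> z < 1 ->
  is_derive z (1 : R) (fun z => (1 - z ^+ h)^-1)
    ((1 - z ^+ h)^-1 * (h%:R * z ^+ h / (1 - z ^+ h)) / z).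
Proof.
move=> h0 z0 z1; have u := onem_pow_neq0 h0 z0 z1.
have d := is_derive_onem_pow h0 (lt0r_neq0 z0).
have k := @is_deriveV R (fun z => 1 - z ^+ h) z _ 1 u d; apply: (is_derive_eq k); rewrite /GRing.scale /=.
by field; rewrite u gt_eqF.
Qed.

Lemma is_derive_euler s z : all (fun h => 0 < h)%N s -> 0 < z -> z < 1 ->
  is_derive z (1 : R) (euler s) (euler s z * mean_sum z s / z).
Proof.
move=> s0 z0 z1; elim: s s0 => [_|h s IH /= /andP[h0 /IH d]].
  rewrite /mean_sum big_nil mulr0 mul0r.
  rewrite (_ : euler [::] = fun=> 1) //; last by apply/funext => x; rewrite /euler big_nil.
  exact: is_derive_cst.
have e : euler (h :: s) = fun x => (1 - x ^+ h)^-1 * euler s x.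
  by apply/funext => x; rewrite /euler big_cons.
rewrite e; have f := is_derive_factor h0 z0 z1.
apply: is_derive_eq; rewrite /GRing.scale /= /mean_sum big_cons.
by ring.
Qed.

Lemma is_derive_mean_sum s z : all (fun h => 0 < h)%N s -> 0 < z -> z < 1 ->
  is_derive z (1 : R) (fun z => mean_sum z s) (var_sum z s / z).
Proof.
move=> s0 z0 z1; elim: s s0 => [_|h s IH /= /andP[h0 /IH d]].
  rewrite /var_sum big_nil mul0r (_ : (fun z => mean_sum z [::]) = fun=> 0); first exact: is_derive_cst.
  by apply/funext => x; rewrite /mean_sum big_nil.
have e : (fun z => mean_sum z (h :: s)) = fun x => h%:R * x ^+ h * (1 - x ^+ h)^-1 + mean_sum x s.
  by apply/funext => x; rewrite /mean_sum big_cons.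
rewrite e; have f := is_derive_factor h0 z0 z1.
have zn := lt0r_neq0 z0; have g := is_derive_pow h0 zn.
have u := onem_pow_neq0 h0 z0 z1.
apply: is_derive_eq; rewrite /GRing.scale /= /var_sum big_cons.
by field; rewrite u zn.
Qed.

Lemma is_derive_uniq (f g : R -> R) z (a b : R) : (\near z, f z = g z) ->
  is_derive z (1 : R) f a -> is_derive z (1 : R) g b -> a = b.
Proof.
move=> fg fa gb; have := @derive_val _ _ _ _ _ _ _ fa.
rewrite (near_eq_derive (1 : R) fg) => <-; exact: derive_val.
Qed.

End FiniteProduct.

(** Lists that grow, up to order, by exponents larger than their index: the
    coefficients up to [N] of the product over [hs N] are final, and the bound on
    the exponential sums makes the limit series converge. *)
Section Family.
Variable R : realType.
Variable hs : nat -> seq nat.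
Hypothesis hs0 : forall N, all (fun h => 0 < h)%N (hs N).
Hypothesis hsS : forall N, exists2 ext, perm_eq (hs N.+1) (hs N ++ ext) & all (fun h => N < h)%N ext.
Hypothesis hsB : forall r : R, 0 <= r -> r < 1 -> exists B, forall N, expsum r (hs N) <= B.

Definition lim_coefs (n : nat) : R := ncoefs R (hs n) n.
Let a := lim_coefs.

Lemma hs_ext N N' : (N <= N')%N ->
  exists2 ext, perm_eq (hs N') (hs N ++ ext) & all (fun h => N < h)%N ext.
Proof.
move=> /subnK <-; elim: (N' - N)%N => [|d [ext p e]]; first by exists [::]; rewrite ?cats0.
rewrite addSn; have [ext' p' e'] := hsS (d + N); exists (ext ++ ext').
  by apply: (perm_trans p'); rewrite catA perm_cat2r.
rewrite all_cat e; apply: sub_all e' => h; exact: leq_ltn_trans (leq_addl _ _).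
Qed.

Lemma fam_agree N n : (n <= N)%N -> ncoefs R (hs N) n = a n.
Proof.
move=> nN; have [ext p e] := hs_ext nN; rewrite /a /lim_coefs /ncoefs.
by rewrite (coefs_perm (hs0 N) p) coefs_cat_big.
Qed.

Lemma fam_le N n : ncoefs R (hs N) n <= a n.
Proof.
have [/fam_agree -> //|nN] := leqP n N.
have [ext p e] := hs_ext (ltnW nN); rewrite /a /lim_coefs /ncoefs ler_nat.
rewrite (coefs_perm (hs0 n) p); apply: coefs_cat_ge.
by apply: sub_all e => h; exact: leq_ltn_trans.
Qed.

Lemma fam_ge0 n : 0 <= a n. Proof. exact: ler0n. Qed.

Lemma fam_coef0 : a 0 = 1.
Proof. by rewrite /a /lim_coefs /ncoefs coefs0. Qed.

Lemma fam_cvg r : 0 <= r -> r < 1 -> cvgn (pseries a r).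
Proof.
move=> r0 r1; have [B HB] := hsB r0 r1.
have p0 : 0 < 1 - r by rewrite subr_gt0.
have nn n : 0 <= a n * r ^+ n by rewrite mulr_ge0 ?fam_ge0 // exprn_ge0.
apply: (@cvg_series_bounded_nneg _ _ (expR (B / (1 - r)))) => // M.
have -> : series (fun n => a n * r ^+ n) M = pseries (ncoefs R (hs M)) r M.
  rewrite /pseries /series /= big_nat [RHS]big_nat; apply: eq_bigr => n /andP[_ /ltnW nM].
  by rewrite fam_agree.
have nr : `|r| < 1 by rewrite ger0_norm.
have [c1 c2] := cvg_ncoefs (hs0 M) nr.
rewrite (ger0_norm r0) in c1.
apply: (@le_trans _ _ (euler (hs M) r)).
  rewrite /euler -(cvg_lim (@Rhausdorff R) c2); apply: series_le_lim => // n.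
  by rewrite mulr_ge0 ?ncoefs_ge0 // exprn_ge0.
have H s : all (fun h => 0 < h)%N s -> euler s r <= expR (expsum r s / (1 - r)).
  elim: s => [|h s IH] /=; first by rewrite /euler /expsum !big_nil mul0r expR0.
  move=> /andP[h0 s0]; rewrite /euler /expsum !big_cons mulrDl expRD -/(euler s r).
  have rh : r ^+ h <= r by rewrite -[leRHS]expr1 ler_wiXn2l // ltW.
  have rh0 : 0 <= r ^+ h by rewrite exprn_ge0.
  apply: ler_pM => //; last exact: IH.
  - by rewrite invr_ge0; lra.
  - exact/ltW/euler_gt0.
  - apply: le_trans (expR_ge1Dx _).
    have -> : (1 - r ^+ h)^-1 = 1 + r ^+ h / (1 - r ^+ h) by field; lra.
    by rewrite lerD2l ler_wpM2l // lef_pV2 ?posrE; lra.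
apply: (le_trans (H _ (hs0 M))); rewrite ler_expR ler_pM2r ?invr_gt0 //.
Qed.

Definition gen0 z : R := limn (pseries a z).
Definition gen1 z : R := limn (pseries (pseries_diffs a) z).
Definition gen2 z : R := limn (pseries (pseries_diffs (pseries_diffs a)) z).

Let d1_ge0 (c : nat -> R) : (forall n, 0 <= c n) -> forall n, 0 <= pseries_diffs c n.
Proof. by move=> c0 n; rewrite /pseries_diffs mulr_ge0. Qed.

Lemma between_lt1 r : 0 <= r -> r < 1 -> exists2 t : R, r < t & t < 1.
Proof. by move=> r0 r1; exists ((r + 1) / 2); lra. Qed.

Lemma fam_cvg1 r : 0 <= r -> r < 1 -> cvgn (pseries (pseries_diffs a) r).
Proof.
move=> r0 r1; have [t rt t1] := between_lt1 r0 r1.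
apply: (cvg_pseries_diffs fam_ge0 r0 rt); apply: fam_cvg => //.
by rewrite (le_trans r0) // ltW.
Qed.

Lemma fam_cvg2 r : 0 <= r -> r < 1 -> cvgn (pseries (pseries_diffs (pseries_diffs a)) r).
Proof.
move=> r0 r1; have [t rt t1] := between_lt1 r0 r1.
apply: (cvg_pseries_diffs (d1_ge0 fam_ge0) r0 rt); apply: fam_cvg1 => //.
by rewrite (le_trans r0) // ltW.
Qed.

Lemma pseries_derive (c : nat -> R) z : (forall n, 0 <= c n) ->
  (forall r, 0 <= r -> r < 1 -> cvgn (pseries c r)) -> `|z| < 1 ->
  is_derive z (1 : R) (fun x => limn (pseries c x)) (limn (pseries (pseries_diffs c) z)).
Proof.
move=> c0 cc z1; have [t zt t1] := between_lt1 (normr_ge0 z) z1.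
have t0 : 0 <= t by rewrite (le_trans (normr_ge0 z)) // ltW.
have [t' tt' t'1] := between_lt1 t0 t1.
have t'0 : 0 <= t' by rewrite (le_trans t0) // ltW.
have [t'' tt'' t''1] := between_lt1 t'0 t'1.
have t''0 : 0 <= t'' by rewrite (le_trans t'0) // ltW.
have c1 r r' : 0 <= r -> r < r' -> r' < 1 -> cvgn (pseries (pseries_diffs c) r).
  move=> r0 rr r1; apply: (cvg_pseries_diffs c0 r0 rr); apply: cc => //.
  by rewrite (le_trans r0) // ltW.
apply: (@pseries_snd_diffs _ c t) => //.
- exact: cc.
- exact: (c1 _ t').
- by apply: (cvg_pseries_diffs (d1_ge0 c0) t0 tt'); exact: (c1 _ t'').
- by rewrite (ger0_norm t0).
Qed.

Lemma fam_derive0 z : `|z| < 1 -> is_derive z (1 : R) gen0 (gen1 z).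
Proof. by apply: pseries_derive => [|r]; [exact: fam_ge0 | exact: fam_cvg]. Qed.

Lemma fam_derive1 z : `|z| < 1 -> is_derive z (1 : R) gen1 (gen2 z).
Proof. by apply: pseries_derive => [|r]; [exact: (d1_ge0 fam_ge0) | exact: fam_cvg1]. Qed.

Lemma fam_tannery (c : nat -> nat -> R) (b : nat -> R) z :
  (forall N n, 0 <= c N n <= b n) -> (forall N n, (n <= N)%N -> c N n = b n) ->
  cvgn (pseries b `|z|) ->
  limn (pseries (c N) z) @[N --> \oo] --> limn (pseries b z).
Proof.
move=> cb ce cv.
apply: (@tannery _ (fun N n => c N n * z ^+ n) (fun n => b n * z ^+ n) (fun n => b n * `|z| ^+ n)) => //.
- move=> N n; have /andP[c0 c1] := cb N n.
  by rewrite normrM normrX (ger0_norm c0) ler_wpM2r // exprn_ge0.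
- by move=> N n nN; rewrite ce.
Qed.

Lemma fam_lim0 z : `|z| < 1 -> euler (hs N) z @[N --> \oo] --> gen0 z.
Proof.
move=> z1; have := @fam_tannery (fun N => ncoefs R (hs N)) a z.
have -> : (fun N => limn (pseries (ncoefs R (hs N)) z)) = (fun N => euler (hs N) z).
  apply/funext => N; have [_ c2] := cvg_ncoefs (hs0 N) z1.
  exact: (cvg_lim (@Rhausdorff R) c2).
apply => [N n|N n|]; [by rewrite ncoefs_ge0 fam_le | exact: fam_agree | exact: fam_cvg].
Qed.

Lemma fam_lim1 z : `|z| < 1 ->
  limn (pseries (pseries_diffs (ncoefs R (hs N))) z) @[N --> \oo] --> gen1 z.
Proof.
move=> z1; rewrite -(cvg_shiftn 1).
apply: (@fam_tannery (fun N => pseries_diffs (ncoefs R (hs (N + 1)%N))) (pseries_diffs a) z).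
- move=> N n; rewrite d1_ge0 /=; last exact: ncoefs_ge0.
  by rewrite /pseries_diffs ler_wpM2l // fam_le.
- by move=> N n nN; rewrite /pseries_diffs fam_agree // addn1.
- exact: fam_cvg1.
Qed.

Lemma fam_lim2 z : `|z| < 1 ->
  limn (pseries (pseries_diffs (pseries_diffs (ncoefs R (hs N)))) z) @[N --> \oo] --> gen2 z.
Proof.
move=> z1; rewrite -(cvg_shiftn 2).
apply: (@fam_tannery (fun N => pseries_diffs (pseries_diffs (ncoefs R (hs (N + 2)%N))))
  (pseries_diffs (pseries_diffs a)) z).
- move=> N n; rewrite d1_ge0 /=; last by move=> k; apply: d1_ge0 => j; exact: ncoefs_ge0.
  by rewrite /pseries_diffs !ler_wpM2l // fam_le.
- by move=> N n nN; rewrite /pseries_diffs fam_agree // addn2.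
- exact: fam_cvg2.
Qed.

Lemma itv01_norm (z : R) : 0 < z -> z < 1 -> `|z| < 1.
Proof. by move=> z0 z1; rewrite gtr0_norm. Qed.

Lemma near_itv01 (z : R) : 0 < z -> z < 1 -> \forall x \near z, 0 < x < 1.
Proof.
move=> z0 z1; have zi : z \in `]0, 1[ by rewrite in_itv /= z0.
by have := near_in_itvoo zi; apply: filterS => x; rewrite in_itv.
Qed.

Section FiniteDerivatives.
Variable s : seq nat.
Hypothesis s0 : all (fun h => 0 < h)%N s.

Let cvs r : 0 <= r -> r < 1 -> cvgn (pseries (ncoefs R s) r).
Proof.
move=> r0 r1; have r1' : `|r| < 1 by rewrite ger0_norm.
by have [+ _] := cvg_ncoefs s0 r1'; rewrite ger0_norm.
Qed.

Let cvs1 r : 0 <= r -> r < 1 -> cvgn (pseries (pseries_diffs (ncoefs R s)) r).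
Proof.
move=> r0 r1; have [t rt t1] := between_lt1 r0 r1.
apply: (cvg_pseries_diffs (@ncoefs_ge0 R s) r0 rt); apply: cvs => //.
by rewrite (le_trans r0) // ltW.
Qed.

Lemma finite_derive1 (z : R) : 0 < z -> z < 1 ->
  limn (pseries (pseries_diffs (ncoefs R s)) z) = euler s z * mean_sum z s / z.
Proof.
move=> z0 z1; have d1 := pseries_derive (@ncoefs_ge0 R s) cvs (itv01_norm z0 z1).
apply: (is_derive_uniq _ d1 (is_derive_euler s0 z0 z1)).
apply: filterS (near_itv01 z0 z1) => x /andP[x0 x1].
have [_ c2] := cvg_ncoefs s0 (itv01_norm x0 x1).
exact: (cvg_lim (@Rhausdorff R) c2).
Qed.

Lemma finite_derive2 (z : R) : 0 < z -> z < 1 ->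
  limn (pseries (pseries_diffs (pseries_diffs (ncoefs R s))) z) =
  euler s z * (var_sum z s + mean_sum z s ^+ 2 - mean_sum z s) / z ^+ 2.
Proof.
move=> z0 z1; have zn := lt0r_neq0 z0.
have d2 := pseries_derive (d1_ge0 (@ncoefs_ge0 R s)) cvs1 (itv01_norm z0 z1).
have e := is_derive_euler s0 z0 z1; have f := is_derive_mean_sum s0 z0 z1.
have v := @is_deriveV R (fun x => x) z _ 1 zn (is_derive_id z (1 : R)).
have g : is_derive z (1 : R) (fun x => euler s x * mean_sum x s * x^-1)
    (euler s z * (var_sum z s + mean_sum z s ^+ 2 - mean_sum z s) / z ^+ 2).
  by apply: is_derive_eq; rewrite /GRing.scale /=; field.
apply: (is_derive_uniq _ d2 g).
by apply: filterS (near_itv01 z0 z1) => x /andP[x0 x1]; exact: finite_derive1.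
Qed.

End FiniteDerivatives.

Lemma gen0_ge1 (z : R) : 0 <= z -> z < 1 -> 1 <= gen0 z.
Proof.
move=> z0 z1; have nn n : 0 <= a n * z ^+ n by rewrite mulr_ge0 ?fam_ge0 // exprn_ge0.
have := series_le_lim 1 nn (fam_cvg z0 z1).
by rewrite /series /= big_nat1 fam_coef0 expr0 mulr1.
Qed.

(** The operator [z d/dz] applied once and twice to [ln gen0]. *)
Definition logd1 z : R := z * gen1 z / gen0 z.
Definition logd2 z : R := z ^+ 2 * gen2 z / gen0 z + logd1 z - logd1 z ^+ 2.

(** [mean_sum] is the logarithmic derivative of a finite product, and numerator
    and denominator converge separately. *)
Lemma lim_mean_sum (z : R) : 0 < z -> z < 1 -> mean_sum z (hs N) @[N --> \oo] --> logd1 z.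
Proof.
move=> z0 z1; have zn := itv01_norm z0 z1.
have g0 : gen0 z != 0 by rewrite gt_eqF // (lt_le_trans _ (gen0_ge1 (ltW z0) z1)).
have -> : (fun N => mean_sum z (hs N)) = (fun N =>
    z * limn (pseries (pseries_diffs (ncoefs R (hs N))) z) / euler (hs N) z).
  apply/funext => N; rewrite finite_derive1 //.
  have := euler_gt0 (hs0 N) (ltW z0) z1 => e0.
  by field; rewrite !gt_eqF.
apply: cvgM; last by apply: cvgV => //; exact: fam_lim0.
by apply: cvgM; [exact: cvg_cst | exact: fam_lim1].
Qed.

Lemma lim_var_sum (z : R) : 0 < z -> z < 1 -> var_sum z (hs N) @[N --> \oo] --> logd2 z.
Proof.
move=> z0 z1; have zn := itv01_norm z0 z1.
have g0 : gen0 z != 0 by rewrite gt_eqF // (lt_le_trans _ (gen0_ge1 (ltW z0) z1)).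
have -> : (fun N => var_sum z (hs N)) = (fun N =>
    z ^+ 2 * limn (pseries (pseries_diffs (pseries_diffs (ncoefs R (hs N)))) z) / euler (hs N) z
    + mean_sum z (hs N) - mean_sum z (hs N) * mean_sum z (hs N)).
  apply/funext => N; rewrite finite_derive2 //.
  have := euler_gt0 (hs0 N) (ltW z0) z1 => e0.
  by field; rewrite !gt_eqF.
have l1 := lim_mean_sum z0 z1.
rewrite (_ : logd2 z = z ^+ 2 * gen2 z / gen0 z + logd1 z - logd1 z * logd1 z) //.
apply: cvgB; last exact: cvgM.
apply: cvgD => //; apply: cvgM; last by apply: cvgV => //; exact: fam_lim0.
by apply: cvgM; [exact: cvg_cst | exact: fam_lim2].
Qed.

Lemma is_derive_log (z : R) : 0 < z -> z < 1 ->
  is_derive z (1 : R) (fun x => ln (gen0 x)) (gen1 z / gen0 z).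
Proof.
move=> z0 z1; have d := fam_derive0 (itv01_norm z0 z1).
have g0 : 0 < gen0 z by rewrite (lt_le_trans _ (gen0_ge1 (ltW z0) z1)).
apply: (is_derive_eq (is_derive1_comp (is_derive1_ln g0) d)).
by rewrite mulrC.
Qed.

Lemma derive1_log (z : R) : 0 < z -> z < 1 ->
  z * (fun x => ln (gen0 x))^`()%classic z = logd1 z.
Proof.
move=> z0 z1; have d := is_derive_log z0 z1.
by rewrite derive1E derive_val /logd1; ring.
Qed.

Lemma derive2_log (z : R) : 0 < z -> z < 1 ->
  z * (fun x => ln (gen0 x))^`()%classic z + z ^+ 2 * (fun x => ln (gen0 x))^`(2)%classic z
  = logd2 z.
Proof.
move=> z0 z1; have zn := itv01_norm z0 z1.
have g0 : gen0 z != 0 by rewrite gt_eqF // (lt_le_trans _ (gen0_ge1 (ltW z0) z1)).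
have d0 := fam_derive0 zn; have d1 := fam_derive1 zn.
have v := @is_deriveV R gen0 z _ 1 g0 d0.
have g : is_derive z (1 : R) (fun x => gen1 x * (gen0 x)^-1)
    (gen2 z / gen0 z - (gen1 z / gen0 z) ^+ 2).
  by apply: is_derive_eq; rewrite /GRing.scale /=; field.
rewrite derive1_log // derive1nS derive1n1.
have -> : ((fun x => ln (gen0 x))^`())^`()%classic z = gen2 z / gen0 z - (gen1 z / gen0 z) ^+ 2.
  rewrite derive1E (@near_eq_derive _ _ _ _ (fun x => gen1 x * (gen0 x)^-1)) ?derive_val //.
  apply: filterS (near_itv01 z0 z1) => x /andP[x0 x1].
  by have d := is_derive_log x0 x1; rewrite derive1E derive_val.
by rewrite /logd2 /logd1; field.
Qed.

End Family.

(** * The exponents of the generating function *)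

Section Families.
Variable R : realType.

Definition single_family (N : nat) : seq nat := index_iota 1 N.+1.
Definition exps_family (m N : nat) : seq nat := exps m (2 * N).

Lemma single_family_gt0 N : all (fun h => 0 < h)%N (single_family N).
Proof. by apply/allP => e; rewrite mem_index_iota => /andP[]. Qed.

Lemma pair_exps_gt0 m N : all (fun h => 0 < h)%N (pair_exps m N).
Proof. by have := exps_gt0 m N; rewrite /exps all_cat => /andP[]. Qed.

Lemma index_iota_cat a b c : (a <= b)%N -> (b <= c)%N ->
  index_iota a c = index_iota a b ++ index_iota b c.
Proof.
move=> ab bc; rewrite /index_iota -[X in _ ++ iota X _](subnKC ab) -iotaD.
by congr iota; lia.
Qed.

Lemma pair_exps_ext m N N' : (N <= N')%N ->
  exists2 ext, pair_exps m N' = pair_exps m N ++ ext & all (fun h => N < h)%N ext.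
Proof.
move=> NN; rewrite /pair_exps (index_iota_cat (leq0n N) NN) map_cat flatten_cat.
eexists; first by reflexivity.
apply/allP => e /flattenP[_ /mapP[k + ->]] /flattenP[_ /mapP[j jm ->]] /mapP[h hj ->].
move: jm hj; rewrite !mem_index_iota => /andP[j1 jm] /andP[h1 hj] /andP[Nk _].
by nia.
Qed.

Lemma single_family_ext N N' : (N <= N')%N ->
  exists2 ext, single_family N' = single_family N ++ ext & all (fun h => N < h)%N ext.
Proof.
move=> NN; rewrite /single_family (@index_iota_cat 1 N.+1) //.
by exists (index_iota N.+1 N'.+1) => //; apply/allP => e; rewrite mem_index_iota => /andP[].
Qed.

Lemma single_familyS N :
  exists2 ext, perm_eq (single_family N.+1) (single_family N ++ ext) & all (fun h => N < h)%N ext.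
Proof. by have [ext -> ?] := single_family_ext (leqnSn N); exists ext. Qed.

Lemma pair_familyS m N :
  exists2 ext, perm_eq (pair_exps m N.+1) (pair_exps m N ++ ext) & all (fun h => N < h)%N ext.
Proof. by have [ext -> ?] := pair_exps_ext m (leqnSn N); exists ext. Qed.

Lemma exps_familyS m : (0 < m)%N -> forall N,
  exists2 ext, perm_eq (exps_family m N.+1) (exps_family m N ++ ext) & all (fun h => N < h)%N ext.
Proof.
move=> m0 N; rewrite /exps_family /exps -!/(single_family _).
have [e1 -> a1] := @single_family_ext (m * (2 * N)) (m * (2 * N.+1)) ltac:(nia).
have [e2 -> a2] := @pair_exps_ext m (2 * N) (2 * N.+1) ltac:(lia).
exists (e1 ++ e2); first by rewrite -!catA perm_cat2l perm_catCA.
rewrite all_cat; apply/andP; split; [apply: sub_all a1 | apply: sub_all a2] => h.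
  by apply: leq_ltn_trans; nia.
by apply: leq_ltn_trans; lia.
Qed.

Lemma expsum_cat (r : R) s t : expsum r (s ++ t) = expsum r s + expsum r t.
Proof. by rewrite /expsum big_cat. Qed.

Lemma expsum_ge0 (r : R) s : 0 <= r -> 0 <= expsum r s.
Proof. by move=> r0; apply: sumr_ge0 => h _; exact: exprn_ge0. Qed.

Lemma exps_familyB m : (0 < m)%N -> forall r : R, 0 <= r -> r < 1 ->
  exists B, forall N, expsum r (exps_family m N) <= B.
Proof. by move=> m0 r r0 r1; exists (2 * ((1 - r)^-1) ^+ 3) => N; exact: expsum_cubic. Qed.

Lemma pair_familyB m : (0 < m)%N -> forall r : R, 0 <= r -> r < 1 ->
  exists B, forall N, expsum r (pair_exps m N) <= B.
Proof.
move=> m0 r r0 r1; exists (2 * ((1 - r)^-1) ^+ 3) => N.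
apply: le_trans (expsum_cubic N r0 r1 m0); rewrite /exps expsum_cat.
by rewrite lerDr expsum_ge0.
Qed.

Lemma single_familyB (r : R) : 0 <= r -> r < 1 ->
  exists B, forall N, expsum r (single_family N) <= B.
Proof.
move=> r0 r1; exists (2 * ((1 - r)^-1) ^+ 3) => N.
apply: le_trans (expsum_cubic N r0 r1 (ltn0Sn 0)); rewrite /exps expsum_cat mul1n.
by rewrite lerDl expsum_ge0.
Qed.

Lemma gen_fun_family m (z : R) : (0 < m)%N -> `|z| < 1 ->
  gen_fun m z = gen0 (exps_family m) z.
Proof.
move=> m0 z1.
have ls := fam_lim0 single_family_gt0 single_familyS single_familyB z1.
have lp := fam_lim0 (pair_exps_gt0 m) (pair_familyS m) (pair_familyB m0) z1.
have le := fam_lim0 (fun N => exps_gt0 m (2 * N)) (exps_familyS m0) (exps_familyB m0) z1.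
have -> : gen_fun m z = gen0 single_family z * gen0 (pair_exps m) z.
  rewrite /gen_fun; congr (_ * _); first exact: (cvg_lim (@Rhausdorff R) ls).
  rewrite (_ : (fun N => \prod_(0 <= k < N) _) = (fun N => euler (pair_exps m N) z)).
    exact: (cvg_lim (@Rhausdorff R) lp).
  by apply/funext => N; rewrite /euler big_pair_exps.
(* Both factors are evaluated along subsequences of their own truncations. *)
have toy (c : nat) : (0 < c)%N -> (c * (2 * N))%N @[N --> \oo] --> \oo.
  by move=> c0; apply/cvgnyPge => A; exists A => //= N /= AN; nia.
have ls' := cvg_comp _ _ (toy m m0) ls.
have lp' := cvg_comp _ _ (toy 1 (ltn0Sn 0)) lp.
have E : (fun N => euler (exps_family m N) z) = (fun N =>
    euler (single_family (m * (2 * N))%N) z * euler (pair_exps m (1 * (2 * N))%N) z).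
  by apply/funext => N; rewrite /euler /exps_family /exps big_cat /= mul1n.
rewrite E in le; have lsp : (fun N => euler (single_family (m * (2 * N))%N) z *
    euler (pair_exps m (1 * (2 * N))%N) z) @ \oo -->
    gen0 single_family z * gen0 (pair_exps m) z by exact: cvgM ls' lp'.
exact: (cvg_unique (@Rhausdorff R) lsp le).
Qed.

Lemma near_gen_fun m (z : R) : (0 < m)%N -> `|z| < 1 ->
  \forall x \near z, gen_fun m x = gen0 (exps_family m) x.
Proof.
move=> m0 z1; have zi : z \in `](-1 : R), 1[ by rewrite in_itv /= -ltr_norml.
have := near_in_itvoo zi; apply: filterS => x; rewrite in_itv /= -ltr_norml.
exact: gen_fun_family.
Qed.

End Families.

(** * The saddle-point equation *)

Section Coefficients.
Variable R : realType.
Implicit Types (m n : nat).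

Lemma near_eq_derive1n (f g : R -> R) (z : R) n : (\forall x \near z, f x = g x) ->
  f^`(n)%classic z = g^`(n)%classic z.
Proof.
elim: n f g => [|n IH] f g fg; first by rewrite !derive1n0; exact: nbhs_singleton fg.
rewrite !derive1Sn; apply: IH; have := near_join fg; apply: filterS => x.
by move=> fgx; rewrite !derive1E; exact: near_eq_derive.
Qed.

Lemma iter_diffs_0 (c : nat -> R) n k :
  k`!%:R * iter n (@pseries_diffs R) c k = (k + n)`!%:R * c (k + n)%N.
Proof.
elim: n k => [|n IH] k; first by rewrite addn0.
rewrite iterS {1}/pseries_diffs mulrA -natrM mulnC -factS IH.
by rewrite addSnnS.
Qed.

Section Family.
Variable hs : nat -> seq nat.
Hypothesis hs0 : forall N, all (fun h => 0 < h)%N (hs N).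
Hypothesis hsS : forall N, exists2 ext, perm_eq (hs N.+1) (hs N ++ ext) & all (fun h => N < h)%N ext.
Hypothesis hsB : forall r : R, 0 <= r -> r < 1 -> exists B, forall N, expsum r (hs N) <= B.

Lemma taylor_gen0 n : (gen0 hs)^`(n)%classic 0 / n`!%:R = lim_coefs R hs n.
Proof.
pose c k := iter k (@pseries_diffs R) (lim_coefs R hs).
have c0 k j : 0 <= c k j.
  elim: k j => [|k IH] j; first exact: fam_ge0.
  by rewrite /c /= /pseries_diffs; apply: mulr_ge0 => //; exact: IH.
have cc k r : 0 <= r -> r < 1 -> cvgn (pseries (c k) r).
  elim: k r => [|k IH] r r0 r1; first exact: (fam_cvg hs0 hsS hsB).
  have [t rt t1] := between_lt1 r0 r1; apply: (cvg_pseries_diffs (c0 k) r0 rt).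
  by apply: IH => //; rewrite (le_trans r0) // ltW.
have D k (z : R) : `|z| < 1 -> (gen0 hs)^`(k)%classic z = limn (pseries (c k) z).
  elim: k z => [|k IH] z z1; first by rewrite derive1n0.
  rewrite derive1nS derive1E (@near_eq_derive _ _ _ _ (fun x => limn (pseries (c k) x))).
    have d := pseries_derive (c0 k) (cc k) z1; exact: derive_val.
  have zi : z \in `](-1 : R), 1[ by rewrite in_itv /= -ltr_norml.
  have := near_in_itvoo zi; apply: filterS => x; rewrite in_itv /= -ltr_norml.
  exact: IH.
rewrite D ?normr0 //; have E : pseries (c n) 0 @ \oo --> c n 0%N.
  rewrite -(cvg_shiftn 1); apply: cvg_near_cst; apply: nearW => k.
  rewrite /pseries /series /= addn1 big_nat_recl //= big1 ?addr0 => [|i _].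
    by rewrite expr0 mulr1.
  by rewrite expr0n /= mulr0.
rewrite (cvg_lim (@Rhausdorff R) E).
have := iter_diffs_0 (lim_coefs R hs) n 0; rewrite fact0 mul1r add0n /c => ->.
by rewrite mulrAC divff ?mul1r // pnatr_eq0 -lt0n fact_gt0.
Qed.

End Family.

(** The Taylor coefficients for [m <= 2] and the numbers of banded plane
    partitions for [m > 2] are the same coefficients. *)
Lemma num_bppE m n : (0 < m)%N -> num_bpp R m n = lim_coefs R (exps_family m) n.
Proof.
move=> m0; rewrite /num_bpp; case: leqP => m2.
  rewrite -(taylor_gen0 (fun N => exps_gt0 m (2 * N)) (exps_familyS m0) (exps_familyB m0)).
  congr (_ / _); apply: near_eq_derive1n; apply: near_gen_fun => //.
  by rewrite normr0.
rewrite (card_banded_plane_partition m2 (ltnSn n)).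
exact: (fam_agree R (fun N => exps_gt0 m (2 * N)) (exps_familyS m0) (leqnSn n)).
Qed.

Definition boltzmann_mean m (z : R) : R := logd1 (exps_family m) z.
Definition boltzmann_var m (z : R) : R := logd2 (exps_family m) z.

Lemma expRN_lt1 (rho : R) : 0 < rho -> 0 < expR (- rho) < 1.
Proof. by move=> r0; rewrite expR_gt0 expR_lt1 oppr_lt0. Qed.

Lemma near_Lambda m (z : R) : (0 < m)%N -> `|z| < 1 ->
  \forall x \near z, Lambda m x = ln (gen0 (exps_family m) x).
Proof. by move=> m0 z1; have := near_gen_fun m0 z1; apply: filterS => x; rewrite /Lambda => ->. Qed.

Lemma Lambda1E m (rho : R) : (0 < m)%N -> 0 < rho ->
  Lambda1 m rho = rho * boltzmann_mean m (expR (- rho)).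
Proof.
move=> m0 r0; have /andP[q0 q1] := expRN_lt1 r0.
rewrite /Lambda1 -mulrA; congr (_ * _).
have := near_eq_derive1n 1 (near_Lambda m0 (itv01_norm q0 q1)); rewrite !derive1n1 => ->.
exact: (derive1_log (fun N => exps_gt0 m (2 * N)) (exps_familyS m0) (exps_familyB m0)).
Qed.

Lemma Lambda2E m (rho : R) : (0 < m)%N -> 0 < rho ->
  Lambda2 m rho = rho ^+ 2 * boltzmann_var m (expR (- rho)).
Proof.
move=> m0 r0; have /andP[q0 q1] := expRN_lt1 r0.
have nl := near_Lambda m0 (itv01_norm q0 q1).
rewrite /Lambda2 (near_eq_derive1n 2 nl).
have := near_eq_derive1n 1 nl; rewrite !derive1n1 => ->.
have -> : expR (- (2 * rho)) = expR (- rho) ^+ 2 by rewrite -expRM_natl mulrN.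
congr (_ * _).
exact: (derive2_log (fun N => exps_gt0 m (2 * N)) (exps_familyS m0) (exps_familyB m0)).
Qed.

Lemma saddle_eqE m n (rho : R) : (0 < m)%N -> 0 < rho ->
  n%:R * rho - Lambda1 m rho = 0 <-> n%:R = boltzmann_mean m (expR (- rho)).
Proof.
move=> m0 r0; rewrite Lambda1E // mulrC -mulrBr; split=> [/eqP|->]; last by rewrite subrr mulr0.
by rewrite mulf_eq0 gt_eqF //= subr_eq0 => /eqP.
Qed.

Lemma derive_log_gen_fun m (rho : R) : (0 < m)%N -> 0 < rho ->
  - (fun tau : R => ln (gen_fun m (expR (- tau))))^`()%classic rho = boltzmann_mean m (expR (- rho)).
Proof.
move=> m0 r0; have /andP[q0 q1] := expRN_lt1 r0.
pose f := fun x : R => ln (gen0 (exps_family m) x).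
have d := is_derive_log (fun N => exps_gt0 m (2 * N)) (exps_familyS m0) (exps_familyB m0) q0 q1.
have e : is_derive rho (1 : R) (fun t => expR (- t)) (- expR (- rho)).
  by apply: is_derive_eq; rewrite /GRing.scale /= mulrN1.
have c := @is_derive1_comp R f (fun t => expR (- t)) rho _ _ d e.
have -> : (fun tau : R => ln (gen_fun m (expR (- tau))))^`()%classic rho =
    (f \o (fun t => expR (- t)))^`()%classic rho.
  rewrite !derive1E; apply: near_eq_derive.
  apply: filterS (lt_nbhsr r0) => t t0; rewrite /f /= gen_fun_family //.
  by have /andP[a b] := expRN_lt1 t0; exact: itv01_norm.
by rewrite derive1E derive_val /boltzmann_mean /logd1; ring.
Qed.

Lemma mean_sum_lim m (z : R) : (0 < m)%N -> 0 < z -> z < 1 ->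
  mean_sum z (exps m (2 * N)) @[N --> \oo] --> boltzmann_mean m z.
Proof. by move=> m0; exact: (lim_mean_sum (fun N => exps_gt0 m (2 * N)) (exps_familyS m0) (exps_familyB m0)). Qed.

Lemma var_sum_lim m (z : R) : (0 < m)%N -> 0 < z -> z < 1 ->
  var_sum z (exps m (2 * N)) @[N --> \oo] --> boltzmann_var m z.
Proof. by move=> m0; exact: (lim_var_sum (fun N => exps_gt0 m (2 * N)) (exps_familyS m0) (exps_familyB m0)). Qed.

Lemma exps_head m N : (0 < m)%N -> (0 < N)%N ->
  exists2 t, exps m (2 * N) = 1%N :: t & all (fun h => 0 < h)%N t.
Proof.
move=> m0 N0; have X0 : (0 < m * (2 * N))%N by rewrite !muln_gt0 m0.
have := exps_gt0 m (2 * N); rewrite /exps /index_iota subn1 /=.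
case: (m * (2 * N))%N X0 => // X _ /= e0.
by exists (iota 2 X ++ pair_exps m (2 * N)).
Qed.

Lemma mean_sum_le (s : seq nat) (x y : R) : all (fun h => 0 < h)%N s -> 0 < x -> x <= y -> y < 1 ->
  mean_sum x s <= mean_sum y s.
Proof.
move=> s0 x0 xy y1; have y0 := lt_le_trans x0 xy; have x1 := le_lt_trans xy y1.
rewrite /mean_sum; elim: s s0 => [|h s IH] /=; first by rewrite !big_nil.
move=> /andP[h0 /IH le]; rewrite !big_cons lerD //.
have xh : x ^+ h < 1 by rewrite exprn_ilt1 ?ltW // -lt0n.
have yh : y ^+ h < 1 by rewrite exprn_ilt1 ?ltW // -lt0n.
have xyh : x ^+ h <= y ^+ h by rewrite lerXn2r // nnegrE ltW.
have xh0 : 0 <= x ^+ h by rewrite exprn_ge0 // ltW.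
apply: ler_pM.
- by rewrite mulr_ge0.
- by rewrite invr_ge0; lra.
- by rewrite ler_wpM2l.
- by rewrite lef_pV2 ?posrE; lra.
Qed.

(** The factor [1 / (1 - z)] alone makes the mean size increase strictly. *)
Lemma boltzmann_mean_mono m (x y : R) : (0 < m)%N -> 0 < x -> x <= y -> y < 1 ->
  y / (1 - y) - x / (1 - x) <= boltzmann_mean m y - boltzmann_mean m x.
Proof.
move=> m0 x0 xy y1; have y0 := lt_le_trans x0 xy; have x1 := le_lt_trans xy y1.
have l : mean_sum y (exps m (2 * N)) - mean_sum x (exps m (2 * N)) @[N --> \oo] -->
    boltzmann_mean m y - boltzmann_mean m x by exact: cvgB (mean_sum_lim m0 y0 y1) (mean_sum_lim m0 x0 x1).
apply: (ler_cvg_to (cvg_cst (y / (1 - y) - x / (1 - x))) l); exists 1%N => //= N N0.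
have [t -> t0] := exps_head m0 N0; have := mean_sum_le t0 x0 xy y1.
by rewrite /mean_sum !big_cons !mul1r !expr1; lra.
Qed.

Lemma boltzmann_mean_ge m (x : R) : (0 < m)%N -> 0 < x -> x < 1 -> x / (1 - x) <= boltzmann_mean m x.
Proof.
move=> m0 x0 x1; have l := mean_sum_lim m0 x0 x1.
apply: (ler_cvg_to (cvg_cst (x / (1 - x))) l); exists 1%N => //= N N0.
have [t -> t0] := exps_head m0 N0; rewrite /mean_sum big_cons mul1r expr1 lerDl.
elim: t t0 => [|h t IH] /=; first by rewrite big_nil.
move=> /andP[h0 /IH t0]; have xh : x ^+ h < 1 by rewrite exprn_ilt1 ?ltW // -lt0n.
by rewrite big_cons addr_ge0 // divr_ge0 ?mulr_ge0 ?exprn_ge0 ?(ltW x0) // subr_ge0 ltW.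
Qed.

Lemma boltzmann_mean_cont m (z : R) : (0 < m)%N -> 0 <= z -> z < 1 -> boltzmann_mean m x @[x --> z] --> boltzmann_mean m z.
Proof.
move=> m0 z0 z1; have zn : `|z| < 1 by rewrite ger0_norm.
have g1 := gen0_ge1 (fun N => exps_gt0 m (2 * N)) (exps_familyS m0) (exps_familyB m0) z0 z1.
have d0 := fam_derive0 (fun N => exps_gt0 m (2 * N)) (exps_familyS m0) (exps_familyB m0) zn.
have d1 := fam_derive1 (fun N => exps_gt0 m (2 * N)) (exps_familyS m0) (exps_familyB m0) zn.
have c0 : {for z, continuous (gen0 (exps_family m) : R -> R)}.
  by apply: differentiable_continuous; apply/derivable1_diffP; exact: ex_derive.
have c1 : {for z, continuous (gen1 (exps_family m) : R -> R)}.
  by apply: differentiable_continuous; apply/derivable1_diffP; exact: ex_derive.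
apply: cvgM; first by apply: cvgM => //; exact: cvg_id.
by apply: cvgV => //; rewrite gt_eqF // (lt_le_trans _ g1).
Qed.

Lemma saddle_point_exists m n : (0 < m)%N -> (0 < n)%N ->
  exists2 rho : R, 0 < rho & n%:R = boltzmann_mean m (expR (- rho)).
Proof.
move=> m0 n0; pose y : R := n%:R / n.+1%:R.
have np : 0 < n%:R :> R by rewrite ltr0n.
have y0 : 0 < y by rewrite divr_gt0.
have y1 : y < 1 by rewrite ltr_pdivrMr // mul1r ltr_nat.
have yn : y / (1 - y) = n%:R by rewrite /y -natr1; field; lra.
have s0 : boltzmann_mean m 0 = 0 by rewrite /boltzmann_mean /logd1 !mul0r.
have sy : n%:R <= boltzmann_mean m y by rewrite -yn; exact: boltzmann_mean_ge.
have cont : {within `[0, y], continuous (boltzmann_mean m : R -> R)}.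
  apply: continuous_in_subspaceT => x; rewrite inE /= in_itv /= => /andP[x0 xy].
  by apply: boltzmann_mean_cont => //; exact: le_lt_trans y1.
have [|c + cn] := IVT (ltW y0) cont (v := n%:R).
  rewrite s0; apply/andP; split; [rewrite ge_min ler0n // | by rewrite le_max sy orbT].
rewrite in_itv /= => /andP[c0 cy].
have cp : 0 < c by rewrite lt_neqAle c0 andbT; apply: contraTneq np => e; rewrite -cn -e s0 ltxx.
have c1 : c < 1 by exact: le_lt_trans y1.
exists (- ln c); first by rewrite oppr_gt0 ln_lt0 // cp.
by rewrite opprK lnK ?posrE // cn.
Qed.

Lemma saddle_point_uniq m (r r' : R) : (0 < m)%N -> 0 < r -> 0 < r' ->
  boltzmann_mean m (expR (- r)) = boltzmann_mean m (expR (- r')) -> r = r'.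
Proof.
move=> m0; wlog le : r r' / r <= r' => [H|] r0 r0' e.
  by have [le|/ltW le] := leP r r'; [exact: H | apply/esym; exact: H].
have /andP[q0 q1] := expRN_lt1 r0; have /andP[p0 p1] := expRN_lt1 r0'.
have pq : expR (- r') <= expR (- r) by rewrite ler_expR lerN2.
have := boltzmann_mean_mono m0 p0 pq q1; rewrite e subrr subr_le0.
rewrite ler_pdivrMr ?subr_gt0 // mulrAC ler_pdivlMr ?subr_gt0 // => h.
have eq : expR (- r) = expR (- r') by apply/le_anti; rewrite pq andbT; lra.
by have := expR_inj eq; lra.
Qed.

End Coefficients.

(** * The asymptotic formula *)

Section Asymptotics.
Variable R : realType.
Implicit Types (m n : nat) (rho : R).

Lemma Lambda2_gt0 m rho : (0 < m)%N -> 0 < rho -> 0 < Lambda2 m rho.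
Proof.
move=> m0 r0; have /andP[q0 q1] := expRN_lt1 r0.
rewrite Lambda2E //; apply: (lt_le_trans q0).
have l : rho ^+ 2 * var_sum (expR (- rho)) (exps m (2 * N)) @[N --> \oo] -->
    rho ^+ 2 * boltzmann_var m (expR (- rho)) by apply: cvgM; [exact: cvg_cst | exact: var_sum_lim].
apply: (ler_cvg_to (cvg_cst (expR (- rho))) l); exists 1%N => //= N N0.
apply: le_trans (expsum_le_var (exps_gt0 m (2 * N)) r0).
have [t -> t0] := exps_head m0 N0; rewrite /expsum big_cons expr1 lerDl.
by apply: sumr_ge0 => h _; rewrite exprn_ge0 // ltW.
Qed.

Lemma Lambda2_le m rho : (0 < m)%N -> 0 < rho -> rho <= 1 ->
  Lambda2 m rho <= 16 * kappa R / rho ^+ 3.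
Proof.
move=> m0 r0 r1; have /andP[q0 q1] := expRN_lt1 r0.
rewrite Lambda2E //.
have l : rho ^+ 2 * var_sum (expR (- rho)) (exps m (2 * N)) @[N --> \oo] -->
    rho ^+ 2 * boltzmann_var m (expR (- rho)) by apply: cvgM; [exact: cvg_cst | exact: var_sum_lim].
apply: (ler_cvg_to l (cvg_cst (16 * kappa R / rho ^+ 3))); exists 1%N => //= N N0.
have hs0 := exps_gt0 m (2 * N).
have -> : rho ^+ 2 * var_sum (expR (- rho)) (exps m (2 * N)) = \sum_(h <- exps m (2 * N))
    (h%:R * rho) ^+ 2 * expR (- rho) ^+ h / (1 - expR (- rho) ^+ h) ^+ 2.
  by rewrite /var_sum mulr_sumr; apply: eq_bigr => h _; rewrite exprMn; ring.
apply: (le_trans (moment_sum_half hs0 r0 (isT : (2 <= 4)%N))).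
have qh : rho / 2 <= 1 - expR (- rho).
  have : expR rho * expR (- rho) = 1 by rewrite -expRD subrr expR0.
  have := expR_ge1Dx rho; move: (expR rho) => E E1 Eq.
  have h : expR (- rho) * (1 + rho) <= 1 by rewrite -[leRHS]Eq mulrC ler_wpM2r // ltW.
  by nra.
have p0 : 0 < 1 - expR (- rho) by lra.
have h1 := expsum_cubic (2 * N) (ltW q0) q1 m0.
have h2 : (1 - expR (- rho))^-1 ^+ 3 <= (2 / rho) ^+ 3.
  rewrite lerXn2r ?nnegrE ?invr_ge0 ?(ltW p0) ?divr_ge0 ?(ltW r0) //.
  by rewrite -[leRHS]invf_div lef_pV2 ?posrE // divr_gt0.
have h3 := exps_double m0 N0 r0 r1.
have -> : 16 * kappa R / rho ^+ 3 = kappa R * (2 * (2 / rho) ^+ 3) by field; rewrite gt_eqF.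
have h4 : 0 <= 2 * (2 / rho) ^+ 3 by rewrite mulr_ge0 // exprn_ge0 // divr_ge0 // ltW.
have h5 : 4096 * (16 * (2 * (2 / rho) ^+ 3)) <= kappa R * (2 * (2 / rho) ^+ 3).
  have -> : 4096 * (16 * (2 * (2 / rho) ^+ 3)) = (16 * 4096) * (2 * (2 / rho) ^+ 3) by ring.
  by rewrite ler_wpM2r ?kappa_ge.
apply: le_trans h5; lra.
Qed.

(** [h <= h * rho], so the mean is a moment sum, which [expsum_cubic] bounds at
    [rho / 2] independently of [m]. *)
Lemma boltzmann_mean_bounded m rho : (0 < m)%N -> 1 < rho -> boltzmann_mean m (expR (- rho)) <= 4096 * 54.
Proof.
move=> m0 r1; have r0 : 0 < rho by lra.
have /andP[q0 q1] := expRN_lt1 r0.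
apply: (ler_cvg_to (mean_sum_lim m0 q0 q1) (cvg_cst (4096 * 54 : R))); exists 1%N => //= N N0.
have hs0 := exps_gt0 m (2 * N).
have h0 := moment_sum_half hs0 r0 (isT : (1 <= 4)%N).
apply: (@le_trans _ _ (\sum_(h <- exps m (2 * N)) (h%:R * rho) ^+ 1 * expR (- rho) ^+ h /
    (1 - expR (- rho) ^+ h) ^+ 1)).
  rewrite /mean_sum; apply: (ler_sum_hs hs0) => h hp; rewrite !expr1.
  have xh : expR (- rho) ^+ h < 1 by rewrite exprn_ilt1 ?ltW // -lt0n.
  rewrite ler_wpM2r ?invr_ge0 ?subr_ge0 ?(ltW xh) // ler_wpM2r ?exprn_ge0 ?(ltW q0) //.
  by rewrite ler_peMr // ltW.
apply: (le_trans h0); apply: ler_wpM2l; first exact: ler0n.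
set r := expR (- (rho / 2)).
have rr : r <= 2 / 3.
  have h : 3 / 2 <= expR (rho / 2) by apply: le_trans (expR_ge1Dx _); lra.
  rewrite /r expRN -[leRHS]invf_div lef_pV2 ?posrE ?expR_gt0 //.
have r_ge0 : 0 <= r by exact: expR_ge0.
have rl : r < 1 by lra.
apply: (le_trans (expsum_cubic (2 * N) r_ge0 rl m0)).
have -> : 54 = 2 * 3 ^+ 3 :> R by ring.
rewrite ler_pM2l // lerXn2r ?nnegrE ?invr_ge0 //; first lra.
by rewrite -[leRHS]invrK lef_pV2 ?posrE ?invr_gt0 //; lra.
Qed.


(** The limit of [saddle_truncated]: the defect of the saddle-point equation
    tends to [0] as [n] is the limit of the truncated means. *)
Lemma saddle_limit m n rho (q := expR (- rho)) (C0 : R := 6144 * (kappa R ^+ 2 + kappa R))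
  (c1 : R := tail_rate R / 5) : (0 < m)%N -> 0 < rho -> rho <= 1 ->
  n%:R = boltzmann_mean m q ->
  `|2 * pi * (num_bpp R m n * q ^+ n / gen_fun m q) - Num.sqrt (2 * pi / Lambda2 m rho) * rho| <=
  C0 / Lambda2 m rho * (Num.sqrt (2 * pi / Lambda2 m rho) * rho) + 2 * pi * expR (- (c1 / rho)).
Proof.
move=> m0 r0 r1 sn; have /andP[q0 q1] := expRN_lt1 r0; rewrite -/q in q0 q1.
have qn := itv01_norm q0 q1.
have L0 := Lambda2_gt0 m0 r0.
have lE := fam_lim0 (fun N => exps_gt0 m (2 * N)) (exps_familyS m0) (@exps_familyB R m m0) qn.
have l1 := mean_sum_lim m0 q0 q1; have l2 := var_sum_lim m0 q0 q1.
have G1 := gen0_ge1 (fun N => exps_gt0 m (2 * N)) (exps_familyS m0) (@exps_familyB R m m0) (ltW q0) q1.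
have G0 : gen0 (exps_family m) q != 0 by rewrite gt_eqF // (lt_le_trans _ G1).
pose LN N := rho ^+ 2 * var_sum q (exps m (2 * N)).
have lL : LN N @[N --> \oo] --> Lambda2 m rho.
  by rewrite Lambda2E //; apply: cvgM => //; exact: cvg_cst.
have lLV : (LN N)^-1 @[N --> \oo] --> (Lambda2 m rho)^-1 by apply: cvgV => //; rewrite gt_eqF.
have lS : Num.sqrt (2 * pi / LN N) * rho @[N --> \oo] --> Num.sqrt (2 * pi / Lambda2 m rho) * rho.
  apply: cvgM; last exact: cvg_cst.
  apply: (cvg_comp (fun N => 2 * pi / LN N) (@Num.sqrt R)); last exact: sqrt_continuous.
  by apply: cvgM => //; exact: cvg_cst.
have lLHS : `|2 * pi * (num_bpp R m n * q ^+ n * (euler (exps_family m N) q)^-1) -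
    Num.sqrt (2 * pi / LN N) * rho| @[N --> \oo] -->
   `|2 * pi * (num_bpp R m n * q ^+ n / gen_fun m q) - Num.sqrt (2 * pi / Lambda2 m rho) * rho|.
  apply: cvg_norm; apply: cvgB => //; apply: cvgM; first exact: cvg_cst.
  apply: cvgM; first exact: cvg_cst.
  by rewrite gen_fun_family //; apply: cvgV.
have lD : 16 * ((mean_sum q (exps m (2 * N)) - n%:R) * (mean_sum q (exps m (2 * N)) - n%:R)) @[N --> \oo] --> (0 : R).
  have lz : mean_sum q (exps m (2 * N)) - n%:R @[N --> \oo] --> (0 : R).
    by rewrite -(subrr (n%:R : R)) {2}sn; apply: cvgB => //; exact: cvg_cst.
  have lz2 : (mean_sum q (exps m (2 * N)) - n%:R) * (mean_sum q (exps m (2 * N)) - n%:R) @[N --> \oo] -->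
      (0 * 0 : R) by exact: cvgM.
  have : 16 * ((mean_sum q (exps m (2 * N)) - n%:R) * (mean_sum q (exps m (2 * N)) - n%:R)) @[N --> \oo] -->
      (16 * (0 * 0) : R) by apply: cvgM; [exact: cvg_cst | exact: lz2].
  by rewrite !mulr0.
have lq : q ^+ (m * (2 * N)).+1 @[N --> \oo] --> (0 : R).
  have lq0 := cvg_expr qn.
  have toy : (m * (2 * N)).+1 @[N --> \oo] --> \oo.
    by apply/cvgnyPge => A; exists A => //= N /= AN; nia.
  exact: (cvg_comp _ _ toy lq0).
have lEx : expR (- ((tail_rate R / rho - 3 * q ^+ (m * (2 * N)).+1 / (1 - q) ^+ 2) / 5))
    @[N --> \oo] --> expR (- (c1 / rho)).
  apply: (cvg_comp (fun N => - ((tail_rate R / rho - 3 * q ^+ (m * (2 * N)).+1 / (1 - q) ^+ 2) / 5))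
    (@expR R)); last exact: continuous_expR.
  have -> : c1 / rho = (tail_rate R / rho - 3 * 0 / (1 - q) ^+ 2) / 5.
    have p0 : 0 < 1 - q by lra.
    by rewrite /c1; field; rewrite !gt_eqF.
  apply: cvgN; apply: cvgM; last exact: cvg_cst.
  apply: cvgB; first exact: cvg_cst.
  apply: cvgM; last exact: cvg_cst.
  by apply: cvgM => //; exact: cvg_cst.
have lRHS : C0 / LN N * (Num.sqrt (2 * pi / LN N) * rho) + 2 * pi *
   (16 * ((mean_sum q (exps m (2 * N)) - n%:R) * (mean_sum q (exps m (2 * N)) - n%:R)) +
    expR (- ((tail_rate R / rho - 3 * q ^+ (m * (2 * N)).+1 / (1 - q) ^+ 2) / 5)))
   @[N --> \oo] --> C0 / Lambda2 m rho * (Num.sqrt (2 * pi / Lambda2 m rho) * rho) +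
   2 * pi * (0 + expR (- (c1 / rho))).
  apply: cvgD; first by apply: cvgM => //; apply: cvgM => //; exact: cvg_cst.
  by apply: cvgM; [exact: cvg_cst | exact: cvgD].
rewrite add0r in lRHS.
apply: (ler_cvg_to lLHS lRHS); exists n.+1 => //= N nN.
have N0 : (0 < N)%N by exact: leq_ltn_trans nN.
have := saddle_truncated n m0 N0 r0 r1.
rewrite -/q -/(LN N) -/C0 expr2 num_bppE //.
have -> : (coefs (exps m (2 * N)) n)%:R = lim_coefs R (exps_family m) n.
  exact: (fam_agree R (fun N => exps_gt0 m (2 * N)) (exps_familyS m0) (ltnW nN)).
have -> : \prod_(h <- exps m (2 * N)) (1 - q ^+ h) = (euler (exps_family m N) q)^-1
  by rewrite /euler prodfV invrK.
by [].
Qed.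

(** Dividing [saddle_limit] by the main term leaves the relative error
    [C0 / Lambda2] and a tail [sqrt (2 pi Lambda2) / rho * expR (- c1 / rho)];
    as [Lambda2 = O(rho ^- 3)], the exponential beats every power of [1 / rho]
    in the tail, in particular the one that turns it into [O(Lambda2^-1)]. *)
Lemma relative_error : exists C : R, forall m n rho, (0 < m)%N -> 0 < rho -> rho <= 1 ->
  n%:R = boltzmann_mean m (expR (- rho)) ->
  exists2 E : R, `|E| <= C * (Lambda2 m rho)^-1
    & num_bpp R m n = saddle_point_approx m n rho * (1 + E).
Proof.
pose C0 : R := 6144 * (kappa R ^+ 2 + kappa R); pose c1 : R := tail_rate R / 5.
pose A : R := 16 * kappa R.
exists (C0 + (1 + 2 * pi * A) * A * (5040 / c1 ^+ 7)) => m n rho m0 r0 r1 sn.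
have /andP[q0 q1] := expRN_lt1 r0.
have L0 := Lambda2_gt0 m0 r0; have LA := Lambda2_le m0 r0 r1.
have SL := saddle_limit m0 r0 r1 sn; rewrite -/C0 -/c1 -/A in SL LA.
have G0 : 0 < gen_fun m (expR (- rho)).
  rewrite (gen_fun_family m0) ?itv01_norm //; apply: lt_le_trans ltr01 _.
  exact: (gen0_ge1 (fun N => exps_gt0 m (2 * N)) (exps_familyS m0) (@exps_familyB R m m0) (ltW q0) q1).
have Eq : expR (n%:R * rho) * expR (- rho) ^+ n = 1.
  by rewrite -expRM_natl -expRD mulrN subrr expR0.
have p0 : 0 < 2 * pi :> R by rewrite mulr_gt0 ?pi_gt0.
set e := expR (- (c1 / rho)) in SL; set L := Lambda2 m rho in L0 LA SL *.
set s1 := Num.sqrt (2 * pi / L) in SL.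
pose s2 := Num.sqrt (2 * pi * L).
have s20 : 0 < s2 by rewrite sqrtr_gt0 mulr_gt0.
have s12 : s1 * s2 = 2 * pi.
  rewrite /s1 /s2 -sqrtrM ?divr_ge0 ?ltW //.
  have -> : 2 * pi / L * (2 * pi * L) = (2 * pi) ^+ 2 by field; rewrite gt_eqF.
  by rewrite sqrtr_sqr gtr0_norm.
pose X := num_bpp R m n * expR (- rho) ^+ n / gen_fun m (expR (- rho)).
rewrite -/X in SL.
exists (X * s2 / rho - 1); last first.
  rewrite /saddle_point_approx -/L -/s2 /X.
  transitivity (num_bpp R m n * (expR (n%:R * rho) * expR (- rho) ^+ n)).
    by rewrite Eq mulr1.
  by field; rewrite !gt_eqF.
have -> : X * s2 / rho - 1 = s2 / (2 * pi * rho) * (2 * pi * X - s1 * rho).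
  move: (2 * pi) p0 s12 => t t0 s12.
  have -> : s1 = t / s2 by rewrite -s12 mulfK // gt_eqF.
  by field; rewrite !gt_eqF.
have f0 : 0 < s2 / (2 * pi * rho) by rewrite divr_gt0 // mulr_gt0.
rewrite normrM (gtr0_norm f0); apply: le_trans (ler_wpM2l (ltW f0) SL) _.
have -> : s2 / (2 * pi * rho) * (C0 / L * (s1 * rho) + 2 * pi * e) = C0 / L + s2 / rho * e.
  move: (2 * pi) p0 s12 => t t0 s12.
  have -> : s1 = t / s2 by rewrite -s12 mulfK // gt_eqF.
  by field; rewrite !gt_eqF.
rewrite mulrDl lerD2l ler_pdivlMr //.
have A0 : 0 <= A by rewrite mulr_ge0 // (le_trans _ (@kappa_ge1 R)).
have i0 : 1 <= rho^-1 by rewrite invf_ge1.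
have c0 : 0 < c1 by rewrite divr_gt0 ?tail_rate_gt0.
have LA' : L <= A * rho^-1 ^+ 3 by rewrite exprVn.
have i3 : 1 <= rho^-1 ^+ 3 by rewrite exprn_ege1.
(* The tail costs [sqrt L / rho] and one more [L] to be compared with [1 / L]:
   in all at most [rho ^- 7]. *)
have sq : s2 <= (1 + 2 * pi * A) * rho^-1 ^+ 3.
  apply: (@le_trans _ _ (1 + 2 * pi * L)).
    have x0 : 0 <= 2 * pi * L by rewrite mulr_ge0 ?ltW.
    by have := sqr_sqrtr x0; rewrite -/s2; move: (2 * pi * L) x0 => y; nra.
  by rewrite [leRHS]mulrDl mul1r lerD // -[leRHS]mulrA ler_wpM2l // ltW.
have ex : e * rho^-1 ^+ 7 <= 5040 / c1 ^+ 7.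
  have x0 : 0 <= c1 / rho by rewrite divr_ge0 ?ltW.
  have := expR_ge_pow 7 x0; have -> : 7`!%:R = 5040 :> R by congr (_%:R).
  rewrite exprMn ler_pdivlMr ?exprn_gt0 // /e expRN => h.
  by rewrite -mulrA mulrC ler_pdivrMr ?expR_gt0 // mulrC.
have e0 : 0 <= e by exact: expR_ge0.
apply: (@le_trans _ _ ((1 + 2 * pi * A) * rho^-1 ^+ 3 / rho * e * (A * rho^-1 ^+ 3))).
  apply: ler_pM => //; first by rewrite !mulr_ge0 ?invr_ge0 // ltW.
  - exact: ltW.
  - by rewrite !ler_wpM2r // invr_ge0 ltW.
have -> : (1 + 2 * pi * A) * rho^-1 ^+ 3 / rho * e * (A * rho^-1 ^+ 3) =
  (1 + 2 * pi * A) * A * (e * rho^-1 ^+ 7) by ring.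
by rewrite ler_wpM2l // mulr_ge0 // addr_ge0 // mulr_ge0 // ltW.
Qed.

End Asymptotics.

Theorem theorem4p1 (R : realType) :
  (* rho(n, m) is well defined *)
  (forall m n : nat, (1 <= m)%N -> (1 <= n)%N ->
     exists! rho : R, 0 < rho /\ n%:R * rho - Lambda1 m rho = 0) /\
  (* the two forms of the saddle-point equation are equivalent *)
  (forall (m n : nat) (rho : R), (1 <= m)%N -> 0 < rho ->
     (n%:R * rho - Lambda1 m rho = 0 <->
      n%:R = - derive1 (fun tau : R => ln (gen_fun m (expR (- tau)))) rho)) /\
  (* the asymptotic formula, uniformly in m *)
  (exists (C : R) (N : nat), forall (n m : nat) (rho : R),
     (N <= n)%N -> (1 <= m)%N -> 0 < rho ->
     n%:R * rho - Lambda1 m rho = 0 ->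
     exists2 E : R, `|E| <= C * (Lambda2 m rho)^-1
       & num_bpp R m n = saddle_point_approx m n rho * (1 + E)).
Proof.
split; [|split].
- move=> m n m1 n1; have [rho r0 sn] := saddle_point_exists R m1 n1.
  exists rho; split; first by split=> //; exact/saddle_eqE.
  move=> rho' [r0' /(saddle_eqE n m1 r0') sn'].
  by apply: (saddle_point_uniq m1 r0 r0'); rewrite -sn -sn'.
- move=> m n rho m1 r0; apply: (iff_trans (saddle_eqE n m1 r0)).
  by rewrite derive_log_gen_fun.
have [C err] := relative_error R; pose B : R := 4096 * 54.
have B0 : 0 <= B by apply: mulr_ge0; exact: ler0n.
(* The threshold makes [n] exceed every value of the mean size at [rho > 1]. *)
exists C, (Num.Def.archi_bound B) => n m rho Nn m1 r0 /(saddle_eqE n m1 r0) sn.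
apply: err => //; rewrite leNgt; apply/negP => r1.
have := le_lt_trans (boltzmann_mean_bounded m1 r1) (archi_boundP B0).
by rewrite -sn ltr_nat ltnNge Nn.
Qed.
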